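(* Let $d\mu(w)=\frac1\pi e^{-|w|^2}dA(w)$ on $\mathbb{C}$ and $K(z,w)=e^{z\overline w+\overline zw}$. The integral transform $$\mathcal{B}(f)(z)=\int_{\mathbb{C}}e^{-|z|^2}K(z,w)f(w)\,d\mu(w),\qquad z\in\mathbb{C},$$ is an isomorphism from $L^2(\mathbb{C},d\mu)$ onto $\mathcal{SF}(\mathbb{C})$, and for any $f\in L^2(\mathbb{C},d\mu)$ we have $$\|\mathcal{B}(f)\|_{\mathcal{SF}(\mathbb{C})}=\|f\|_{L^2(\mathbb{C},d\mu)}.$$
   Context: $\mathcal{F}(\mathbb{C})$ is the classical Fock space of entire functions $h$ with $\|h\|^2_{\mathcal F(\mathbb C)}=\frac1\pi\int_{\mathbb C}|h(z)|^2e^{-|z|^2}dA(z)<\infty$. The polyanalytic Fock space of infinite order $\mathcal{SF}(\mathbb{C})$ is the set of functions $f(z)=\sum_{n=0}^{\infty}\overline{z}^nf_n(z)$ with $f_n\in\mathcal{F}(\mathbb{C})$ for all $n\ge0$ and $\|f\|^2_{\mathcal{SF}(\mathbb{C})}=\sum_{n=0}^{\infty}n!\,\|f_n\|^2_{\mathcal{F}(\mathbb{C})}<\infty$, with scalar product $\langle f,g\rangle_{\mathcal{SF}(\mathbb{C})}=\sum_{k}k!\,\langle f_k,g_k\rangle_{\mathcal{F}(\mathbb{C})}$. $dA$ is Lebesgue area measure. *)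

(* Defs.v *)
From HB Require Import structures.
From mathcomp Require Import all_boot all_order all_algebra.
From mathcomp Require Import all_classical all_reals all_analysis.
From mathcomp Require Import measurable_realfun complex.

Set Implicit Arguments.
Unset Strict Implicit.
Unset Printing Implicit Defensive.

Import Order.TTheory GRing.Theory Num.Theory.
Import numFieldNormedType.Exports.

Local Open Scope classical_set_scope.
Local Open Scope ring_scope.

(* The modulus as a real number ([`|z|] lives in R[i]). *)
Notation normc := ComplexField.Normc.normc.

(* R[i] carries no sigma-algebra in the library: measures live on the plane
   R * R, and functions on R[i] are integrated after composition with toC. *)
Notation plane R := (measurableTypeR R * measurableTypeR R)%type.

Definition toC (R : realType) (p : plane R) : R[i] := Complex p.1 p.2.

Notation dA R := ((@lebesgue_measure R) \x (@lebesgue_measure R))%E.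

Definition gauss_density (R : realType) (w : R[i]) : R :=
  pi^-1 * expR (- normc w ^+ 2).

Definition gauss2 (R : realType) (A : set (plane R)) : \bar R :=
  (\int[dA R]_(p in A) (gauss_density (toC p))%:E)%E.

Section gauss2_measure.
Variable R : realType.

Lemma gauss_density_ge0 (w : R[i]) : 0 <= gauss_density w.
Proof. by rewrite mulr_ge0 ?expR_ge0// invr_ge0 pi_ge0. Qed.

Lemma measurable_gauss_density :
  measurable_fun [set: plane R] (fun p => gauss_density (toC p)).
Proof.
have -> : (fun p : plane R => gauss_density (toC p)) =
    (fun p => pi^-1 * expR (- (p.1 ^+ 2 + p.2 ^+ 2))).
  by apply/funext => p; rewrite /gauss_density /= sqr_sqrtr// addr_ge0 ?sqr_ge0.
apply: measurable_funM => //; apply: measurableT_comp => //.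
apply: measurableT_comp => //.
by apply: measurable_funD; apply: measurable_funX.
Qed.

Let gauss2_0 : gauss2 (R := R) set0 = 0%E.
Proof. exact: integral_set0. Qed.

Let gauss2_ge0 A : (0 <= gauss2 (R := R) A)%E.
Proof. by apply: integral_ge0 => p _; rewrite lee_fin gauss_density_ge0. Qed.

Let gauss2_sigma_additive : semi_sigma_additive (@gauss2 R).
Proof.
move=> F mF tF mUF; rewrite /gauss2 ge0_integral_bigcup//.
- apply: is_cvg_ereal_nneg_natsum_cond => n _ _; exact: gauss2_ge0.
- apply/measurable_EFinP; apply: measurable_funS measurable_gauss_density => //.
- by move=> p _; rewrite lee_fin gauss_density_ge0.
Qed.

HB.instance Definition _ :=
  isMeasure.Build _ _ _ (@gauss2 R) gauss2_0 gauss2_ge0 gauss2_sigma_additive.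

End gauss2_measure.

Notation mu R := (@gauss2 R).

Definition cmeasurable (R : realType) (f : R[i] -> R[i]) : Prop :=
  measurable_fun [set: plane R] (fun p => complex.Re (f (toC p))) /\
  measurable_fun [set: plane R] (fun p => complex.Im (f (toC p))).

Definition cintegrable (R : realType) (f : R[i] -> R[i]) : Prop :=
  (mu R).-integrable setT (fun p => (complex.Re (f (toC p)))%:E) /\
  (mu R).-integrable setT (fun p => (complex.Im (f (toC p)))%:E).

Definition cintegral (R : realType) (f : R[i] -> R[i]) : R[i] :=
  Complex (\int[mu R]_p complex.Re (f (toC p)))
          (\int[mu R]_p complex.Im (f (toC p))).

Definition cexp (R : realType) (z : R[i]) : R[i] :=
  Complex (expR (complex.Re z) * cos (complex.Im z))
          (expR (complex.Re z) * sin (complex.Im z)).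

Definition normL2sq (R : realType) (f : R[i] -> R[i]) : \bar R :=
  (\int[mu R]_p (normc (f (toC p)) ^+ 2)%:E)%E.

(* Elements of L^2(C, mu) are represented by functions; their equality is
   aeq below. *)
Definition L2 (R : realType) (f : R[i] -> R[i]) : Prop :=
  cmeasurable f /\ (normL2sq f < +oo)%E.

Definition normL2 (R : realType) (f : R[i] -> R[i]) : R :=
  Num.sqrt (fine (normL2sq f)).

Definition aeq (R : realType) (f g : R[i] -> R[i]) : Prop :=
  {ae mu R, forall p, f (toC p) = g (toC p)}.

Definition entire (R : realType) (h : R[i] -> R[i]) : Prop :=
  forall z : R[i]^o, derivable (h : R[i]^o -> R[i]^o) z 1.

Definition normFsq (R : realType) (h : R[i] -> R[i]) : \bar R :=
  ((pi^-1)%:E *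
   \int[dA R]_p (normc (h (toC p)) ^+ 2 * expR (- normc (toC p) ^+ 2))%:E)%E.

Definition Fock (R : realType) (h : R[i] -> R[i]) : Prop :=
  entire h /\ (normFsq h < +oo)%E.

Definition normSFsq_seq (R : realType) (fn : nat -> R[i] -> R[i]) : \bar R :=
  (\sum_(0 <= n <oo) (n`!%:R)%:E * normFsq (fn n))%E.

Definition SF_decomp (R : realType) (f : R[i] -> R[i])
    (fn : nat -> R[i] -> R[i]) : Prop :=
  [/\ forall n, Fock (fn n), (normSFsq_seq fn < +oo)%E &
      forall z : R[i],
        ([series (conjc z) ^+ n * fn n z]_n : nat -> R[i]^o) @ \oo
          --> (f z : R[i]^o)].

Definition SF (R : realType) (f : R[i] -> R[i]) : Prop :=
  exists fn, SF_decomp f fn.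

(* The sequence (f_n) is determined by f; choice only serves to turn the
   decomposition into a function of f. *)
Definition SF_coef (R : realType) (f : R[i] -> R[i]) : nat -> R[i] -> R[i] :=
  xget (fun _ _ => 0) [set fn | SF_decomp f fn].

Definition normSF (R : realType) (f : R[i] -> R[i]) : R :=
  Num.sqrt (fine (normSFsq_seq (SF_coef f))).

Definition K (R : realType) (z w : R[i]) : R[i] :=
  cexp (z * conjc w + conjc z * w).

Definition B_integrand (R : realType) (f : R[i] -> R[i]) (z w : R[i]) : R[i] :=
  (expR (- normc z ^+ 2))%:C%C * K z w * f w.

Definition B (R : realType) (f : R[i] -> R[i]) (z : R[i]) : R[i] :=
  cintegral (B_integrand f z).

(* Isomorphism of normed spaces of L^2(C, mu) onto SF(C): a linear bijection
   (on a.e. classes), bounded with bounded inverse. *)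
Definition isomorphism_L2_SF (R : realType)
    (T : (R[i] -> R[i]) -> R[i] -> R[i]) : Prop :=
  [/\ forall f, L2 f -> SF (T f),
      forall (a : R[i]) f g, L2 f -> L2 g ->
        T (fun w => a * f w + g w) = (fun z => a * T f z + T g z),
      forall f g, L2 f -> L2 g -> T f = T g <-> aeq f g,
      forall h, SF h -> (exists2 f, L2 f & T f = h) &
      exists c d : R, [/\ 0 < c, 0 < d &
        forall f, L2 f ->
          c * normL2 f <= normSF (T f) /\ normSF (T f) <= d * normL2 f]].

(* Main.v *)
Require Import Defs.
From HB Require Import structures.
From mathcomp Require Import all_boot all_order all_algebra.
From mathcomp Require Import all_classical all_reals all_analysis.
From mathcomp Require Import measurable_realfun complex.
From mathcomp Require Import ring lra zify.

(* The kernel satisfies e^(-|z|^2) K(z,w) = e^(conj(z) (w-z)) e^(z conj(w)), so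
   expanding the first exponential gives B f = sum_n conj(z)^n f_n with
   f_n(z) = (1/n!) int f(w) (w-z)^n e^(z conj(w)) dmu(w).  The function
   (w-z)^n e^(z conj(w)) generates the complex Hermite polynomials H_{m,n}(w),
   which are orthogonal in L^2(mu) with squared norm m! n!; hence the Taylor
   coefficients of f_n are <f, conj H_{m,n}> / (m! n!), and
   sum_n n! ||f_n||^2 is the squared norm of the Hermite expansion of f.  Bessel
   and Riesz-Fischer turn square-summable coefficients into elements of either
   space.  That h in the Fock space is the sum of its Fock expansion follows
   from the reproducing formula, i.e. the mean value property (Goursat)
   integrated over circles.

   Completeness of the Hermite polynomials is replaced by injectivity of B: if
   B f = 0, the Laplace transform of f mu vanishes on R^2.  The functions psi for
   which the Laplace transform of psi f mu vanishes are stable under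
   multiplication by affine functions, hence by sines of affine functions, by
   the signs of these sines, and finally by indicators of half-planes and of all
   Borel sets; so f = 0 almost everywhere. *)

Set Implicit Arguments.
Unset Strict Implicit.
Unset Printing Implicit Defensive.

Import Order.TTheory GRing.Theory Num.Theory.
Import numFieldNormedType.Exports.

Local Open Scope classical_set_scope.
Local Open Scope ring_scope.

(** * Gaussian measure on the plane *)

(** The Fock space is given by complex differentiability alone, so beyond Goursat's lemma the facts
    of Cauchy theory are drawn from the Gaussian measure. Its rotation invariance does the work of
    polar coordinates: it kills the off-diagonal moments, turns circle means into Gaussian means
    and, through the reproducing formula, even gives the value m! of the diagonal moments. Series
    and integrals are exchanged by dominated convergence with a bound |f(w)| e^(c|w|), integrable
    because f lies in L^2(mu). Applied to f itself, Bessel's inequality shows that B f lies in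
    SF(C), but not that norms are equal. Equality comes from the other side: out of any
    decomposition (f_n) of h, Riesz-Fischer builds a preimage g whose squared norm is exactly sum_n
    n! ||f_n||^2. For h = B f, injectivity identifies g with f, so the norm has the same value for
    every decomposition that [SF_coef] may select. Bessel and Riesz-Fischer are stated for one
    orthogonal sequence and applied twice: to the monomials and, through an enumeration of pairs, to
    the Hermite polynomials. *)

Section lebesgue_plane.
Variable R : realType.
Local Notation lb := (@lebesgue_measure R).
Local Open Scope ereal_scope.

(** The image of Lebesgue measure under a translation has the right value on half-open intervals,
    and these values determine Lebesgue measure. *)
Lemma ge0_integral_lebesgue_shift (f : measurableTypeR R -> \bar R) (c : R) :
  measurable_fun setT f -> (forall x, 0 <= f x) ->
  \int[lb]_x f (x + c)%R = \int[lb]_x f x.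
Proof.
move=> mf f0.
have mc : measurable_fun setT ((fun x => (x + c)%R) : measurableTypeR R -> measurableTypeR R).
  by apply: measurable_funD.
pose nu := measure_function_pushforward__canonical__measure_function_Measure lb mc.
have -> : \int[lb]_x f x = \int[nu]_x f x.
  apply: eq_measure_integral => A mA _; apply: lebesgue_measure_unique => //.
  move=> _ [[a b] /= _ <-].
  rewrite /pushforward/=.
  have -> : (fun x : R => (x + c)%R) @^-1` `]a, b] = `](a - c)%R, (b - c)%R]%classic.
    by apply/seteqP; split=> x /=; rewrite !in_itv/= ltrBlDr lerBrDr.
  rewrite !lebesgue_measure_itv/= !lte_fin ltrD2r; case: ifPn => // _.
  by rewrite -!EFinB; congr EFin; lra.
by rewrite /nu/= ge0_integral_pushforward.
Qed.

(** On each horizontal line the shear is a translation, so Tonelli reduces it to dimension one. *)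
Lemma ge0_integral_shear1 (F : plane R -> \bar R) (phi : R -> R) :
  measurable_fun setT (phi : measurableTypeR R -> measurableTypeR R) ->
  measurable_fun setT F -> (forall p, 0 <= F p) ->
  \int[dA R]_p F (p.1 + phi p.2, p.2)%R = \int[dA R]_p F p.
Proof.
move=> mphi mF F0.
rewrite (fubini_tonelli2 (fun p : plane R => F (p.1 + phi p.2, p.2)%R))//; last first.
  apply: measurableT_comp => //; apply: measurable_fun_pair => //.
  by apply: measurable_funD => //; apply: measurableT_comp.
rewrite (fubini_tonelli2 F mF F0); apply: eq_integral => y _.
rewrite /fubini_G/=.
apply: (@ge0_integral_lebesgue_shift (fun x => F (x, y))) => //.
by apply: measurableT_comp.
Qed.

Lemma ge0_integral_shear2 (F : plane R -> \bar R) (phi : R -> R) :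
  measurable_fun setT (phi : measurableTypeR R -> measurableTypeR R) ->
  measurable_fun setT F -> (forall p, 0 <= F p) ->
  \int[dA R]_p F (p.1, p.2 + phi p.1)%R = \int[dA R]_p F p.
Proof.
move=> mphi mF F0.
rewrite (fubini_tonelli1 (fun p : plane R => F (p.1, p.2 + phi p.1)%R))//; last first.
  apply: measurableT_comp => //; apply: measurable_fun_pair => //.
  by apply: measurable_funD => //; apply: measurableT_comp.
rewrite (fubini_tonelli1 F mF F0); apply: eq_integral => x _.
rewrite /fubini_F/=.
apply: (@ge0_integral_lebesgue_shift (fun y => F (x, y))) => //.
by apply: measurableT_comp.
Qed.


Definition rotp (c s : R) (p : plane R) : plane R :=
  (p.1 * c - p.2 * s, p.1 * s + p.2 * c)%R.

Lemma measurable_rotp (c s : R) : measurable_fun setT (rotp c s).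
Proof.
apply: measurable_fun_pair => /=.
  by apply: measurable_funB; apply: measurable_funM.
by apply: measurable_funD; apply: measurable_funM.
Qed.

(* A rotation is a product of three shears unless it is the half-turn [c = -1],
   which is the square of the quarter-turn. *)
Lemma ge0_integral_rot (c s : R) (F : plane R -> \bar R) :
  (c ^+ 2 + s ^+ 2 = 1)%R ->
  measurable_fun setT F -> (forall p, 0 <= F p) ->
  \int[dA R]_p F (rotp c s p) = \int[dA R]_p F p.
Proof.
have mlin (t : R) : measurable_fun setT
   ((fun x => t * x)%R : measurableTypeR R -> measurableTypeR R).
  exact: measurable_funM.
have msh1 (t : R) : measurable_fun setT
   ((fun p => (p.1 + t * p.2, p.2)%R) : plane R -> plane R).
  apply: measurable_fun_pair => //.
  by apply: measurable_funD => //; apply: measurable_funM.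
have msh2 (t : R) : measurable_fun setT
   ((fun p => (p.1, p.2 + t * p.1)%R) : plane R -> plane R).
  apply: measurable_fun_pair => //.
  by apply: measurable_funD => //; apply: measurable_funM.
have main a b G : (a ^+ 2 + b ^+ 2 = 1)%R -> (1 + a != 0)%R ->
    measurable_fun setT G -> (forall p, 0 <= G p) ->
    \int[dA R]_p G (rotp a b p) = \int[dA R]_p G p.
  (* For (a, b) = (cos u, sin u) this is - tan (u/2), the coefficient for which the shears by [t],
     [b] and [t] compose to the rotation. *)
  move=> ab a1 mG G0; pose t := (- (b / (1 + a)))%R.
  have E : (fun p => G (rotp a b p)) = (fun p : plane R =>
     (fun q : plane R => (fun r : plane R => G (r.1 + t * r.2, r.2)%R) (q.1, q.2 + b * q.1)%R)
       (p.1 + t * p.2, p.2)%R).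
    apply/funext => -[x y] /=; congr G; rewrite /rotp/=.
    have b2 : (b ^+ 2 = (1 - a) * (1 + a))%R.
      by transitivity (a ^+ 2 + b ^+ 2 - a ^+ 2)%R; [ring|rewrite ab; ring].
    have ht : (t * b = a - 1)%R by rewrite /t mulNr mulrAC -expr2 b2 mulfK// opprB.
    have ht2 : (t * a = - b - t)%R.
      by rewrite /t; field.
    congr pair.
      transitivity (x + t * y + (t * b) * (x + t * y) + t * y)%R; last by ring.
      rewrite ht; transitivity (x * a + (t * a) * y + t * y)%R; last by ring.
      by rewrite ht2; ring.
    transitivity (y + b * x + (t * b) * y)%R; last by ring.
    by rewrite ht; ring.
  rewrite E (@ge0_integral_shear1 (fun q : plane R => G (q.1 + t * (q.2 + b * q.1), q.2 + b * q.1)%R) (fun x => t * x)%R)//; last first.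
    exact: (measurableT_comp mG (measurableT_comp (msh1 t) (msh2 b))).
  rewrite (@ge0_integral_shear2 (fun r : plane R => G (r.1 + t * r.2, r.2)%R) (fun x => b * x)%R)//; last first.
    exact: (measurableT_comp mG (msh1 t)).
  by rewrite (@ge0_integral_shear1 G (fun x => t * x)%R).
move=> cs mF F0.
have [c1|c1] := eqVneq (1 + c)%R 0%R; last exact: main.
have cE : c = (-1)%R by lra.
have sE : s = 0%R.
  by apply/eqP; rewrite -sqrf_eq0; apply/eqP; move: cs; rewrite cE sqrrN expr1n; lra.
have -> : (fun p => F (rotp c s p)) = (fun p => (F \o rotp 0%R 1%R) (rotp 0%R 1%R p)).
  by apply/funext => p /=; rewrite /rotp/=; congr F; rewrite cE sE; congr pair; ring.
have h01 : (0 ^+ 2 + 1 ^+ 2 = 1 :> R)%R by rewrite expr0n expr1n add0r.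
have h10 : (1 + 0 != 0 :> R)%R by rewrite addr0 oner_eq0.
rewrite (main _ _ _ h01 h10); first exact: main.
- exact: (measurableT_comp mF (measurable_rotp _ _)).
- by move=> p; exact: F0.
Qed.

End lebesgue_plane.

Section gauss_measure.
Variable R : realType.
Local Open Scope ereal_scope.
Import HBNNSimple.

(** For indicators this is the definition of [gauss2]; linearity gives simple functions and monotone
    convergence the rest. *)
Lemma ge0_integral_gauss2 (F : plane R -> \bar R) :
  measurable_fun setT F -> (forall p, 0 <= F p) ->
  \int[mu R]_p F p = \int[dA R]_p (F p * (gauss_density (toC p))%:E).
Proof.
move=> mF F0.
have mg := @measurable_gauss_density R.
have ind E : measurable E ->
    \int[mu R]_x (\1_E x)%:E = \int[dA R]_x ((\1_E x)%:E * (gauss_density (toC x))%:E).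
  move=> mE; rewrite integral_indic//= setIT /gauss2 integral_mkcond.
  apply: eq_integral => x _; rewrite patchE indicE.
  by case: ifPn => xE; rewrite ?mul1e ?mul0e.
have nns (f : {nnsfun plane R >-> R}) :
    \int[mu R]_x (f x)%:E = \int[dA R]_x ((f x)%:E * (gauss_density (toC x))%:E).
  under [LHS]eq_integral do rewrite fimfunE -fsumEFin//.
  rewrite [LHS]ge0_integral_fsum//; last 2 first.
  - by move=> r; exact/measurable_EFinP/measurableT_comp.
  - by move=> n x _; rewrite EFinM nnfun_muleindic_ge0.
  under [RHS]eq_integral.
    move=> x xD; rewrite fimfunE -fsumEFin// ge0_mule_fsuml; last first.
      by move=> r; rewrite EFinM nnfun_muleindic_ge0.
    over.
  rewrite [RHS]ge0_integral_fsum//; last 2 first.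
  - move=> r; apply: emeasurable_funM; last exact/measurable_EFinP.
    exact/measurable_EFinP/measurableT_comp.
  - move=> n x _; rewrite mule_ge0//; last by rewrite lee_fin gauss_density_ge0.
    by rewrite EFinM nnfun_muleindic_ge0.
  apply: eq_fsbigr => r _.
  have [r0|r0] := leP 0%R r; last first.
    rewrite preimage_nnfun0// integral0_eq => [|x _]; last by rewrite indic0 mulr0.
    by rewrite integral0_eq// => x _; rewrite indic0 mulr0 mul0e.
  under [LHS]eq_integral do rewrite EFinM.
  under [RHS]eq_integral do rewrite EFinM -muleA.
  rewrite [RHS]ge0_integralZl//; last 2 first.
  - by apply: emeasurable_funM; apply/measurable_EFinP.
  - by move=> x _; rewrite mule_ge0// lee_fin gauss_density_ge0.
  rewrite ge0_integralZl//; last first.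
  - exact/measurable_EFinP.
  by rewrite ind.
pose f := nnsfun_approx measurableT mF.
transitivity (lim (\int[mu R]_x (f n x)%:E @[n --> \oo])).
  rewrite -monotone_convergence//=.
  - apply: eq_integral => ? /[!inE] xD; apply/esym/cvg_lim => //=.
    exact: cvg_nnsfun_approx.
  - by move=> n; exact/measurable_EFinP/measurable_funTS.
  - by move=> n ? _; rewrite lee_fin.
  - by move=> ? _ ? ? mn; rewrite lee_fin; exact/lefP/nd_nnsfun_approx.
transitivity (lim (\int[dA R]_x ((f n x)%:E * (gauss_density (toC x))%:E) @[n --> \oo])).
  by apply: congr_lim; apply/funext => n /=; exact: nns.
rewrite -monotone_convergence//=.
- apply: eq_integral => x _; apply/cvg_lim => //=.
  apply: cvgeZr => //; exact: cvg_nnsfun_approx.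
- move=> n; apply: emeasurable_funM; last exact/measurable_EFinP.
  exact/measurable_EFinP/measurable_funTS.
- by move=> n x _; rewrite mule_ge0// lee_fin// gauss_density_ge0.
- move=> x _ a b ab; rewrite lee_wpmul2r ?lee_fin ?gauss_density_ge0//.
  exact/lefP/nd_nnsfun_approx.
Qed.

Lemma gauss_densityE (p : plane R) :
  gauss_density (toC p) = (pi^-1 * expR (- (p.1 ^+ 2 + p.2 ^+ 2)))%R.
Proof. by rewrite /gauss_density /= sqr_sqrtr// addr_ge0 ?sqr_ge0. Qed.

Lemma ge0_integral_gauss2_rot (c s : R) (F : plane R -> \bar R) :
  (c ^+ 2 + s ^+ 2 = 1)%R ->
  measurable_fun setT F -> (forall p, 0 <= F p) ->
  \int[mu R]_p F (rotp c s p) = \int[mu R]_p F p.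
Proof.
move=> cs mF F0; rewrite ge0_integral_gauss2//; last first.
  exact: (measurableT_comp mF (measurable_rotp _ _)).
rewrite (ge0_integral_gauss2 mF F0).
rewrite -(@ge0_integral_rot R c s (fun p => F p * (gauss_density (toC p))%:E) cs).
- apply: eq_integral => p _; rewrite !gauss_densityE /rotp/=.
  congr (_ * (_ * expR (- _))%:E).
  by rewrite -[LHS]mulr1 -cs; ring.
- apply: emeasurable_funM => //; apply/measurable_EFinP.
  exact: measurable_gauss_density.
- by move=> p; rewrite mule_ge0// lee_fin gauss_density_ge0.
Qed.

Lemma integral_gauss2_rot (c s : R) (F : plane R -> \bar R) :
  (c ^+ 2 + s ^+ 2 = 1)%R -> measurable_fun setT F ->
  \int[mu R]_p F (rotp c s p) = \int[mu R]_p F p.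
Proof.
move=> cs mF; rewrite [LHS]integralE [RHS]integralE.
congr (_ - _).
  rewrite -(ge0_integral_gauss2_rot cs (measurable_funepos mF)) => [|p]; last exact: funepos_ge0.
  by apply: eq_integral => p _; rewrite !funepos.unlock.
rewrite -(ge0_integral_gauss2_rot cs (measurable_funeneg mF)) => [|p]; last exact: funeneg_ge0.
by apply: eq_integral => p _; rewrite !funeneg.unlock.
Qed.

Lemma integral_gauss1 : \int[@lebesgue_measure R]_x (expR (- x ^+ 2))%:E = (Num.sqrt pi)%:E.
Proof. exact: integralT_gauss. Qed.

(* Completing the square. *)
Lemma integral_gauss2_expR (s t : R) :
  \int[mu R]_p (expR (2 * (s * p.1 + t * p.2)))%:E = (expR (s ^+ 2 + t ^+ 2))%:E.
Proof.
rewrite ge0_integral_gauss2//; last first.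
  apply/measurable_EFinP; apply: measurableT_comp => //; apply: measurable_funM => //.
  by apply: measurable_funD; apply: measurable_funM.
pose g (x : R) := expR (- x ^+ 2).
have mg : measurable_fun setT (g : measurableTypeR R -> measurableTypeR R).
  by apply: measurableT_comp => //; apply: measurableT_comp => //; apply: measurable_funX.
have mgc (c : R) : measurable_fun setT ((fun x => g (x + c)%R) : measurableTypeR R -> measurableTypeR R).
  by apply: (measurableT_comp mg); apply: measurable_funD.
transitivity (\int[dA R]_p ((expR (s ^+ 2 + t ^+ 2) * pi^-1 * (g (p.1 - s) * g (p.2 - t)))%R)%:E).
  apply: eq_integral => -[x y] _; rewrite gauss_densityE -EFinM; congr EFin.
  rewrite /g /= mulrCA [in RHS](mulrC (expR _)) -mulrA; congr (_ * _)%R.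
  by rewrite -!expRD; congr expR; ring.
rewrite fubini_tonelli1//=; last 2 first.
- apply/measurable_EFinP; apply: measurable_funM => //; apply: measurable_funM.
    exact: (measurableT_comp (mgc _) measurable_fst).
  exact: (measurableT_comp (mgc _) measurable_snd).
- by move=> p; rewrite lee_fin !mulr_ge0 ?expR_ge0 ?invr_ge0 ?pi_ge0.
rewrite /fubini_F/=.
have gi c : \int[@lebesgue_measure R]_x (g (x + c)%R)%:E = (Num.sqrt pi)%:E.
  rewrite (@ge0_integral_lebesgue_shift R (fun x => (g x)%:E))//.
  - exact: integral_gauss1.
  - exact/measurable_EFinP.
  - by move=> x; rewrite lee_fin expR_ge0.
have gk k c : (0 <= k)%R ->
    \int[@lebesgue_measure R]_x (k * g (x + c)%R)%:E = (k * Num.sqrt pi)%:E.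
  move=> k0; rewrite EFinM -(gi c).
  rewrite -(@ge0_integralZl_EFin _ _ R lebesgue_measure setT _ (fun x => (g (x + c)%R)%:E))//.
    by move=> x _; rewrite lee_fin expR_ge0.
  apply/measurable_EFinP. apply: mgc.
set k := (expR _ * _)%R.
have k0 : (0 <= k)%R by rewrite mulr_ge0 ?expR_ge0 ?invr_ge0 ?pi_ge0.
transitivity (\int[@lebesgue_measure R]_x (k * Num.sqrt pi * g (x - s))%:E).
  apply: eq_integral => x _; rewrite mulrAC -(gk _ (- t)%R); last by rewrite mulr_ge0 ?expR_ge0.
  by apply: eq_integral => y _; rewrite mulrA.
rewrite gk; last by rewrite mulr_ge0 ?sqrtr_ge0.
congr EFin; rewrite -mulrA -expr2 sqr_sqrtr ?pi_ge0//.
by rewrite /k -mulrA mulVf ?mulr1// gt_eqF// pi_gt0.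
Qed.

Lemma gauss2_setT : mu R setT = 1.
Proof.
have := integral_gauss2_expR 0 0; rewrite expr0n/= addr0 expR0 => <-.
rewrite -[LHS]mul1e -integral_cst//; apply: eq_integral => p _.
by rewrite !mul0r addr0 mulr0 expR0.
Qed.

(** The integrability behind all the exponential dominating functions below. *)
Lemma integral_gauss2_expR_abs (c : R) :
  \int[mu R]_p (expR (c * (`|p.1| + `|p.2|)))%:E < +oo.
Proof.
pose e (s t : R) (p : plane R) : R := expR (2 * (s * p.1 + t * p.2)).
have me s t : measurable_fun setT (EFin \o e s t).
  apply/measurable_EFinP; apply: measurableT_comp => //; apply: measurable_funM => //.
  by apply: measurable_funD; apply: measurable_funM.
have e0 s t p : 0 <= (EFin \o e s t) p by rewrite lee_fin expR_ge0.
(* The half compensates the factor 2 in [integral_gauss2_expR]; the four sign patterns come from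
   multiplying out e^(c|u|) <= e^(cu) + e^(-cu) over the two coordinates. *)
pose d := (c / 2)%R.
apply: (@le_lt_trans _ _ (\int[mu R]_p (((EFin \o e d d) p + (EFin \o e d (- d)%R) p) +
    ((EFin \o e (- d)%R d) p + (EFin \o e (- d)%R (- d)%R) p)))); last first.
  rewrite ge0_integralD//; [|by move=> p _; rewrite adde_ge0|exact: emeasurable_funD
    |by move=> p _; rewrite adde_ge0|exact: emeasurable_funD].
  by rewrite !ge0_integralD// !integral_gauss2_expR// -!EFinD ltry.
apply: ge0_le_integral => //.
- apply/measurable_EFinP; apply: measurableT_comp => //; apply: measurable_funM => //.
  by apply: measurable_funD; apply: measurableT_comp.
- by apply: emeasurable_funD; apply: emeasurable_funD.
move=> [x y] _ /=; rewrite -!EFinD lee_fin /e/=.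
rewrite mulrDr expRD.
have abs1 (u : R) : (expR (c * `|u|) <= expR (c * u) + expR (- (c * u)))%R.
  have := expR_ge0 (c * u); have := expR_ge0 (- (c * u)).
  by case: (ger0P u) => _; rewrite ?mulrN; lra.
apply: (le_trans (ler_pM (expR_ge0 _) (expR_ge0 _) (abs1 x) (abs1 y))).
rewrite mulrDl !mulrDr -!expRD.
by rewrite le_eqVlt; apply/orP; left; apply/eqP; congr (_ + _ + (_ + _))%R; congr expR; rewrite /d; field.
Qed.

End gauss_measure.

(** * Moduli, limits and complex differentiability *)

Section complex_basics.
Variable R : realType.
Implicit Types (z w : R[i]) (x y r : R).

Lemma cReD z w : complex.Re (z + w) = complex.Re z + complex.Re w.
Proof. by case: z w => [? ?] [? ?]. Qed.
Lemma cImD z w : complex.Im (z + w) = complex.Im z + complex.Im w.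
Proof. by case: z w => [? ?] [? ?]. Qed.
Lemma cReN z : complex.Re (- z) = - complex.Re z.
Proof. by case: z => [? ?]. Qed.
Lemma cImN z : complex.Im (- z) = - complex.Im z.
Proof. by case: z => [? ?]. Qed.
Lemma cReM z w : complex.Re (z * w) =
  complex.Re z * complex.Re w - complex.Im z * complex.Im w.
Proof. by case: z w => [? ?] [? ?]. Qed.
Lemma cImM z w : complex.Im (z * w) =
  complex.Re z * complex.Im w + complex.Im z * complex.Re w.
Proof. by case: z w => [? ?] [? ?]. Qed.

Lemma eq_ReIm z w : complex.Re z = complex.Re w -> complex.Im z = complex.Im w -> z = w.
Proof. by case: z w => [a b] [c d] /= -> ->. Qed.

Lemma normc_ReIm z : normc z = Num.sqrt (complex.Re z ^+ 2 + complex.Im z ^+ 2).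
Proof. by case: z. Qed.

Lemma normc_sqr z : normc z ^+ 2 = complex.Re z ^+ 2 + complex.Im z ^+ 2.
Proof. by rewrite normc_ReIm sqr_sqrtr// addr_ge0 ?sqr_ge0. Qed.

Lemma normc_ge0 z : 0 <= normc z.
Proof. by rewrite normc_ReIm sqrtr_ge0. Qed.

Lemma normrE z : `|z| = (normc z)%:C%C.
Proof. by case: z. Qed.

Lemma ler_normcD z w : normc (z + w) <= normc z + normc w.
Proof. by have := ler_normD z w; rewrite !normrE -rmorphD/= lecR. Qed.

Lemma normcM z w : normc (z * w) = normc z * normc w.
Proof. exact: ComplexField.Normc.normcM. Qed.

Lemma normcN z : normc (- z) = normc z.
Proof. by rewrite !normc_ReIm cReN cImN !sqrrN. Qed.

Lemma ler_normcB z w : normc (z - w) <= normc z + normc w.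
Proof. by rewrite -(normcN w) ler_normcD. Qed.

Lemma normc_dist z w : normc (z - w) = normc (w - z).
Proof. by rewrite -normcN opprB. Qed.

Lemma normc_conj z : normc (conjc z) = normc z.
Proof. by case: z => a b; rewrite /= sqrrN. Qed.

Lemma normcX z n : normc (z ^+ n) = normc z ^+ n.
Proof.
by elim: n => [|n IH]; rewrite ?expr0 ?ComplexField.Normc.normc1// !exprS normcM IH.
Qed.

Lemma normcR x : normc (x%:C)%C = `|x|.
Proof. by rewrite /= expr0n addr0 sqrtr_sqr. Qed.

Lemma normc_nat n : normc (n%:R : R[i]) = n%:R.
Proof. by rewrite -(rmorph_nat (real_complex R)) normcR normr_nat. Qed.

Lemma normc0P z : normc z = 0 -> z = 0.
Proof. exact: ComplexField.Normc.eq0_normc. Qed.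

Lemma normc0 : normc (0 : R[i]) = 0.
Proof. exact: ComplexField.Normc.normc0. Qed.

Lemma Re_le_normc z : `|complex.Re z| <= normc z.
Proof. by rewrite normc_ReIm -sqrtr_sqr ler_wsqrtr// lerDl sqr_ge0. Qed.

Lemma Im_le_normc z : `|complex.Im z| <= normc z.
Proof. by rewrite normc_ReIm -sqrtr_sqr ler_wsqrtr// lerDr sqr_ge0. Qed.

Lemma normc_le_ReIm z : normc z <= `|complex.Re z| + `|complex.Im z|.
Proof.
rewrite [X in normc X]complexE.
rewrite (le_trans (ler_normcD _ _))// normcM !normcR.
by rewrite (_ : normc 'i%C = 1) ?mul1r//= expr0n add0r expr1n sqrtr1.
Qed.

Lemma normc_sum (I : Type) (s : seq I) (P : pred I) (F : I -> R[i]) :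
  normc (\sum_(i <- s | P i) F i) <= \sum_(i <- s | P i) normc (F i).
Proof.
elim/big_ind2 : _ => [|x1 x2 y1 y2 h1 h2|//]; first by rewrite normc0.
by rewrite (le_trans (ler_normcD _ _))// lerD.
Qed.

Lemma Re_sum (I : Type) (s : seq I) (P : pred I) (F : I -> R[i]) :
  complex.Re (\sum_(i <- s | P i) F i) = \sum_(i <- s | P i) complex.Re (F i).
Proof. by elim/big_ind2 : _ => // *; rewrite cReD; congr +%R. Qed.

Lemma Im_sum (I : Type) (s : seq I) (P : pred I) (F : I -> R[i]) :
  complex.Im (\sum_(i <- s | P i) F i) = \sum_(i <- s | P i) complex.Im (F i).
Proof. by elim/big_ind2 : _ => // *; rewrite cImD; congr +%R. Qed.

(** Limits in [R[i]^o] use a modulus with values in [R[i]], where a positive element is a positive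
    real; this brings them back to real limits. *)
Lemma cvgcP (u : nat -> R[i]) (l : R[i]) :
  ((u : nat -> R[i]^o) @ \oo --> (l : R[i]^o)) <->
  ((fun n => normc (u n - l)) @ \oo --> (0 : R)).
Proof.
split=> [|] h.
- apply/cvgrPdist_lt => e e0.
  have e0' : 0 < (e%:C)%C :> R[i] by rewrite ltcR.
  move/cvgrPdist_lt/(_ _ e0') : h; apply: filterS => n.
  by rewrite normrE ltcR sub0r normrN ger0_norm ?normc_ge0// normc_dist.
- apply/cvgrPdist_lt => -[e e'] /=; rewrite ltcE/= => /andP[/eqP -> e0].
  move/cvgrPdist_lt/(_ _ e0) : h; apply: filterS => n.
  by rewrite normrE (ltcR _ e) sub0r normrN ger0_norm ?normc_ge0// normc_dist.
Qed.

Lemma cvgc_ReIm (u : nat -> R[i]) (l : R[i]) :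
  ((u : nat -> R[i]^o) @ \oo --> (l : R[i]^o)) <->
  ((fun n => complex.Re (u n)) @ \oo --> complex.Re l /\
   (fun n => complex.Im (u n)) @ \oo --> complex.Im l).
Proof.
rewrite cvgcP; split=> [h|[h1 h2]].
- split; apply/cvgrPdist_lt => e e0; move/cvgrPdist_lt/(_ _ e0) : h;
    apply: filterS => n; rewrite sub0r normrN ger0_norm ?normc_ge0// => h;
    rewrite distrC.
  + by rewrite -cReN -cReD (le_lt_trans (Re_le_normc _)).
  + by rewrite -cImN -cImD (le_lt_trans (Im_le_normc _)).
- have h : (fun n => `|complex.Re (u n) - complex.Re l| + `|complex.Im (u n) - complex.Im l|) @ \oo --> (0 : R).
    rewrite -[X in _ --> X](addr0 0); apply: cvgD.
      by rewrite -(normr0 R); apply: cvg_norm; rewrite -(subrr (complex.Re l)); apply: cvgB => //; exact: cvg_cst.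
    by rewrite -(normr0 R); apply: cvg_norm; rewrite -(subrr (complex.Im l)); apply: cvgB => //; exact: cvg_cst.
  apply: (squeeze_cvgr _ (cvg_cst 0) h).
  apply: nearW => n; rewrite normc_ge0/=.
  by rewrite (le_trans (normc_le_ReIm _))// cReD cImD cReN cImN.
Qed.

Lemma cvgc_unique (u : nat -> R[i]) (l l' : R[i]) :
  ((u : nat -> R[i]^o) @ \oo --> (l : R[i]^o)) ->
  ((u : nat -> R[i]^o) @ \oo --> (l' : R[i]^o)) -> l = l'.
Proof. by move=> h h'; exact: (cvg_unique _ h h'). Qed.

(** Differentiability with real tolerances and without division, so that k = 0 needs no
    exclusion. *)
Definition cdiff (h : R[i] -> R[i]) (z c : R[i]) := forall e : R, 0 < e ->
  exists2 d : R, 0 < d & forall k, normc k < d ->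
    normc (h (z + k) - h z - c * k) <= e * normc k.

Lemma derivable_cdiff (h : R[i] -> R[i]) z :
  derivable (h : R[i]^o -> R[i]^o) z 1 <-> exists c, cdiff h z c.
Proof.
have scaleA (k : R[i]) : k%:A = k :> R[i]^o by exact: mulr1.
split.
- move=> /cvg_ex[/= c hc]; exists c => e e0.
  have e0' : 0 < (e%:C)%C :> R[i] by rewrite ltcR.
  move/cvgrPdist_lt/(_ _ e0') : hc.
  rewrite near_withinE => /nbhs_ballP[/= [d d'] /=]; rewrite ltcE/= => /andP[/eqP -> d0] hd.
  exists d => // k kd.
  have [->|k0] := eqVneq k 0; first by rewrite addr0 subrr mulr0 subr0 normc0 mulr0.
  have nk : 0 < normc k.
    rewrite lt_neqAle normc_ge0 andbT eq_sym; apply: contra k0 => /eqP/normc0P ->//.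
  have := hd k; rewrite /ball/= sub0r normrN normrE (ltcR _ d) => /(_ kd k0).
  rewrite normrE ltcR => hk.
  have -> : h (z + k) - h z - c * k = k * (k^-1 * (h (z + k) - h z) - c).
    by rewrite mulrBr mulrA divff// mul1r (mulrC c).
  rewrite normcM mulrC ler_pM2r// ltW//.
  by move: hk; rewrite normc_dist scaleA (addrC k).
- move=> [c hc]; apply/cvg_ex; exists c; apply/cvgrPdist_lt => -[e e'].
  rewrite ltcE/= => /andP[/eqP -> e0].
  have e2 : 0 < e / 2 by rewrite divr_gt0.
  have [d d0 hd] := hc _ e2.
  rewrite near_withinE; apply/nbhs_ballP; exists (d%:C)%C; first by rewrite /= ltcR.
  move=> k; rewrite /ball/= sub0r normrN normrE (ltcR _ d) => /hd hk k0.
  rewrite normrE (ltcR _ e) normc_dist /= scaleA.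
  have nk : 0 < normc k.
    rewrite lt_neqAle normc_ge0 andbT eq_sym; apply: contra k0 => /eqP/normc0P ->//.
  rewrite -(ltr_pM2l nk) -normcM mulrBr -[k^-1 *: _]/(k^-1 * _) mulrA divff// mul1r.
  rewrite (addrC k) (mulrC k c) (le_lt_trans hk)// mulrC ltr_pM2l//.
  by rewrite ltr_pdivrMr// ltr_pMr// ltr1n.
Qed.
End complex_basics.

(** * The complex exponential *)

Lemma normc_lim_le (R : realType) (u : nat -> R[i]) (l c : R[i]) (M : R) :
  ((u : nat -> R[i]^o) @ \oo --> (l : R[i]^o)) ->
  (forall n, normc (u n - c) <= M) -> normc (l - c) <= M.
Proof.
move=> /cvgcP h H; apply/ler_addgt0Pr => e e0.
move/cvgrPdist_lt/(_ _ e0) : h => [n _ /(_ n (leqnn _))] /=.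
rewrite sub0r normrN ger0_norm ?normc_ge0// => h.
have -> : l - c = (l - u n) + (u n - c) by ring.
by rewrite (le_trans (ler_normcD _ _))// addrC lerD// normc_dist ltW.
Qed.

Section exp_partial_sums.
Variable F : numFieldType.
Implicit Types a b : F.

(** Generic in the field, because complex partial sums are compared with the real ones at the
    moduli. *)
Definition expS (N : nat) a := \sum_(0 <= n < N) a ^+ n / n`!%:R.

Lemma expS_D_triangle N a b : expS N (a + b) =
  \sum_(0 <= i < N) \sum_(0 <= j < N - i) (a ^+ i / i`!%:R) * (b ^+ j / j`!%:R).
Proof.
elim: N => [|N IH]; first by rewrite /expS !big_geq.
rewrite /expS big_nat_recr//= -/(expS _ _) IH [RHS]big_nat_recr//=.
rewrite subSnn big_nat1 expr0 fact0 divr1 mulr1.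
under [in RHS]eq_big_nat => i /andP[_ iN].
  rewrite subSn ?(ltnW iN)// big_nat_recr//=; over.
rewrite big_split/= -addrA; congr +%R.
transitivity (\sum_(0 <= i < N.+1) a ^+ i / i`!%:R * (b ^+ (N - i) / (N - i)`!%:R)); last first.
  by rewrite big_nat_recr//= subnn expr0 fact0 divr1 mulr1.
rewrite addrC exprDn big_mkord mulr_suml; apply: eq_bigr => i _.
have iN : (i <= N)%N by rewrite -ltnS.
rewrite -mulr_natr -(bin_fact iN) !natrM.
have ? : (i`!%:R : F) != 0 by rewrite pnatr_eq0 -lt0n fact_gt0.
have ? : ((N - i)`!%:R : F) != 0 by rewrite pnatr_eq0 -lt0n fact_gt0.
have ? : ('C(N, i)%:R : F) != 0 by rewrite pnatr_eq0 -lt0n bin_gt0.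
by field; rewrite ?mulf_neq0//; apply/and3P.
Qed.

(** The product runs over a square of indices, the sum at [a + b] over the triangle i + j < N by the
    binomial formula. The remaining terms are nonnegative when [a] and [b] are moduli. *)
Lemma expS_M_subD N a b : expS N a * expS N b - expS N (a + b) =
  \sum_(0 <= i < N) \sum_(N - i <= j < N) (a ^+ i / i`!%:R) * (b ^+ j / j`!%:R).
Proof.
rewrite expS_D_triangle /expS mulr_suml -sumrB; apply: eq_bigr => i _.
rewrite mulr_sumr (big_cat_nat (n := N - i))//= ?leq_subr//.
by rewrite addrAC subrr add0r.
Qed.

Lemma expSS N a : expS N.+1 a = 1 + \sum_(0 <= n < N) a ^+ n.+1 / n.+1`!%:R.
Proof. by rewrite /expS big_nat_recl//= expr0 fact0 divr1. Qed.

End exp_partial_sums.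
Arguments expS {F} N a.

Section complex_exponential.
Variable R : realType.
Implicit Types (z w : R[i]) (x y : R).

Lemma expS_cvg x : (expS ^~ x) @ \oo --> expR x.
Proof. exact: is_cvg_series_exp_coeff. Qed.

Lemma expS_le_expR N x : 0 <= x -> expS N x <= expR x.
Proof.
move=> x0; rewrite -(cvg_lim _ (@expS_cvg x))//.
apply: (@nondecreasing_cvgn_le _ (expS ^~ x)); last by apply/cvg_ex; exists (expR x); exact: expS_cvg.
apply/nondecreasing_seqP => n; rewrite /expS big_nat_recr//= lerDl.
by rewrite divr_ge0// ?exprn_ge0.
Qed.

Lemma normc_expS_term z n : normc (z ^+ n / n`!%:R) = normc z ^+ n / n`!%:R.
Proof. by rewrite normcM normcX ComplexField.Normc.normcV normc_nat. Qed.

Lemma normc_expS N z : normc (expS N z) <= expR (normc z).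
Proof.
apply: le_trans (expS_le_expR N (normc_ge0 z)).
by apply: le_trans (normc_sum _ _ _) _; under eq_bigr do rewrite normc_expS_term.
Qed.

(** Term by term the remainder is bounded by the same remainder at the moduli, which tends to e^a
    e^b - e^(a+b) = 0. *)
Lemma expS_M_subD_cvg z w :
  ((fun N => expS N z * expS N w - expS N (z + w)) : nat -> R[i]^o) @ \oo --> (0 : R[i]^o).
Proof.
apply/cvgcP; pose a := normc z; pose b := normc w.
have h : (fun N => expS N a * expS N b - expS N (a + b)) @ \oo --> (0 : R).
  rewrite -(subrr (expR (a + b))) {1}expRD; apply: cvgB; last exact: expS_cvg.
  by apply: cvgM; exact: expS_cvg.
apply: (squeeze_cvgr _ (cvg_cst 0) h); apply: nearW => N /=.
rewrite normc_ge0 subr0 !expS_M_subD/=.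
apply: (le_trans (normc_sum _ _ _)); apply: ler_sum => i _.
apply: (le_trans (normc_sum _ _ _)); apply: ler_sum => j _.
by rewrite normcM !normc_expS_term.
Qed.

Lemma expS_real_cvg x :
  ((fun N => expS N (x%:C)%C) : nat -> R[i]^o) @ \oo --> ((expR x)%:C%C : R[i]^o).
Proof.
have E N : expS N (x%:C)%C = (expS N x)%:C%C.
  rewrite /expS rmorph_sum/=; apply: eq_bigr => i _.
  by rewrite rmorphM/= rmorphXn/= fmorphV/= rmorph_nat.
apply/cvgc_ReIm; split => /=.
  by under eq_fun do rewrite E; exact: expS_cvg.
by under eq_fun do rewrite E/=; exact: cvg_cst.
Qed.

Lemma expS_imag_cvg y :
  ((fun N => expS N (Complex 0 y)) : nat -> R[i]^o) @ \oo --> (Complex (cos y) (sin y) : R[i]^o).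
Proof.
have E n : (Complex 0 y) ^+ n / n`!%:R = Complex (cos_coeff y n) (sin_coeff y n).
  have -> : Complex 0 y = 'i%C * y%:C%C by apply: eq_ReIm; rewrite ?cReM ?cImM/= !mul0r ?mul1r ?subr0 ?add0r.
  have iE : ('i%C ^+ n : R[i]) = Complex ((~~ odd n)%:R * (-1) ^+ n./2) ((odd n)%:R * (-1) ^+ n.-1./2).
    have e : (-1 : R[i]) = (-1)%:C%C by rewrite rmorphN rmorph1.
    rewrite -{1}[n]odd_double_half exprD -mul2n exprM sqr_i e -rmorphXn/=.
    case on : (odd n) => /=; rewrite ?expr1 ?expr0.
      have -> : n.-1./2 = n./2 by rewrite -{1}[n]odd_double_half on add1n /= doubleK.
      by apply: eq_ReIm; rewrite ?cReM ?cImM/=; ring.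
    by apply: eq_ReIm; rewrite ?cReM ?cImM/=; ring.
  rewrite exprMn iE -rmorphXn/= /cos_coeff /sin_coeff/= -exprnP.
  rewrite (_ : n`!%:R^-1 = (n`!%:R^-1)%:C%C); last by rewrite fmorphV/= rmorph_nat.
  by apply: eq_ReIm; rewrite ?cReM ?cImM/= ?cReM ?cImM/=; ring.
apply/cvgc_ReIm; split => /=.
  rewrite (_ : (fun n => _) = series (cos_coeff y)); last first.
    by apply/funext => n; rewrite /expS Re_sum; apply: eq_bigr => i _; rewrite E.
  by rewrite unlock; exact: is_cvg_series_cos_coeff.
rewrite (_ : (fun n => _) = series (sin_coeff y)); last first.
  by apply/funext => n; rewrite /expS Im_sum; apply: eq_bigr => i _; rewrite E.
by rewrite unlock; exact: is_cvg_series_sin_coeff.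
Qed.

(** Here the definition of [cexp] by [expR], [cos] and [sin] meets the power series: the real and
    the imaginary argument are summed separately and joined by the Cauchy product. *)
Lemma cexp_cvg z : ((fun N => expS N z) : nat -> R[i]^o) @ \oo --> (cexp z : R[i]^o).
Proof.
case: z => x y.
have -> : Complex x y = x%:C%C + Complex 0 y by apply: eq_ReIm; rewrite ?cReD ?cImD/= ?addr0 ?add0r.
have -> : (fun N => expS N (x%:C%C + Complex 0 y)) =
   (fun N => expS N x%:C%C * expS N (Complex 0 y) - (expS N x%:C%C * expS N (Complex 0 y) - expS N (x%:C%C + Complex 0 y))).
  by apply/funext => N; rewrite subKr.
have -> : cexp (x%:C%C + Complex 0 y) = (expR x)%:C%C * Complex (cos y) (sin y) - 0.
  by rewrite /cexp cReD cImD /= addr0 add0r subr0; apply: eq_ReIm; rewrite ?cReM ?cImM/=; ring.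
apply: (@cvgB _ (R[i]^o)); last exact: expS_M_subD_cvg.
by apply: (@cvgM (R[i])); [exact: expS_real_cvg|exact: expS_imag_cvg].
Qed.

Lemma cexpD z w : cexp (z + w) = cexp z * cexp w.
Proof.
rewrite /cexp cReD cImD expRD cosD sinD.
by apply: eq_ReIm; rewrite ?cReM ?cImM/=; ring.
Qed.

Lemma cexp0 : cexp (0 : R[i]) = 1.
Proof. by rewrite /cexp/= expR0 cos0 sin0 mul1r mulr0. Qed.

Lemma normc_cexp z : normc (cexp z) = expR (complex.Re z).
Proof.
rewrite /cexp /normc/= !exprMn -mulrDr cos2Dsin2 mulr1 sqrtr_sqr ger0_norm.
  by [].
exact: expR_ge0.
Qed.

Lemma normc_cexp_le z : normc (cexp z) <= expR (normc z).
Proof. by rewrite normc_cexp ler_expR (le_trans _ (Re_le_normc z))// ler_norm. Qed.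

(** After removing two terms, |z|^(n+2) / (n+2)! <= |z|^2 |z|^n / n!. This bound gives the
    derivative of [cexp] and, later, differentiation under the integral. *)
Lemma normc_cexpB1 z : normc (cexp z - (1 + z)) <= normc z ^+ 2 * expR (normc z).
Proof.
have h := @cexp_cvg z; rewrite -(cvg_shiftn 2) in h.
apply: (normc_lim_le h) => N /=.
rewrite addn2 expSS big_nat_recl//= expr1 (_ : 1`!%N = 1%N)// divr1 addrA [X in normc X]addrC addKr.
apply: (le_trans (normc_sum _ _ _)).
apply: (@le_trans _ _ (normc z ^+ 2 * expS N (normc z))); last first.
  by rewrite ler_wpM2l ?sqr_ge0// expS_le_expR// normc_ge0.
rewrite /expS mulr_sumr; apply: ler_sum => i _; rewrite normc_expS_term.
rewrite mulrA -exprD add2n ler_wpM2l ?exprn_ge0 ?normc_ge0//.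
by rewrite lef_pV2 ?posrE ?ltr0n ?fact_gt0// ler_nat leq_fact// ltnW.
Qed.

End complex_exponential.

(** * Goursat's lemma on rectangles *)

Section interval_integral.
Variable R : realType.
Implicit Types (f g : R -> R) (a b c : R).

Definition Ri f a b : R := \int[@lebesgue_measure R]_(x in `[a, b]) f x.

Lemma continuous_Ri_integrable f a b : continuous f ->
  (@lebesgue_measure R).-integrable `[a, b]%classic (EFin \o f).
Proof.
move=> cf; apply: continuous_compact_integrable; first exact: segment_compact.
exact: continuous_subspaceT.
Qed.

Lemma Ri_split f a b m : continuous f -> a <= m -> m <= b ->
  Ri f a b = Ri f a m + Ri f m b.
Proof.
move=> cf am mb; have := @Rintegral_itvB R f (BLeft a) (BRight b) m.
move=> /(_ (continuous_Ri_integrable _ _ cf)).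
rewrite !bnd_simp => /(_ am mb) h.
rewrite /Ri -(@Rintegral_itv_obnd_cbnd _ m (BRight b)); last first.
  apply: integrableS (continuous_Ri_integrable m b cf) => //.
  by apply: subset_itvr; rewrite bnd_simp.
by rewrite -h addrC subrK.
Qed.

Lemma Ri_cst k a b : a <= b -> Ri (fun=> k) a b = k * (b - a).
Proof.
move=> ab; rewrite /Ri Rintegral_cst//= lebesgue_measure_itv/= lte_fin.
case: ltP => // ba; rewrite (_ : b = a) ?subrr//.
by apply/eqP; rewrite eq_le ab ba.
Qed.

Lemma RiB f g a b : continuous f -> continuous g ->
  Ri (fun x => f x - g x) a b = Ri f a b - Ri g a b.
Proof. by move=> cf cg; rewrite /Ri RintegralB//; exact: continuous_Ri_integrable. Qed.

Lemma Ri_bound f a b M : continuous f -> a <= b ->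
  (forall x, a <= x -> x <= b -> `|f x| <= M) -> `|Ri f a b| <= M * (b - a).
Proof.
move=> cf ab H; have cn : continuous (fun x => `|f x|).
  by move=> x; apply: (continuous_comp (cf x)); exact: norm_continuous.
apply: (le_trans (le_normr_Rintegral _ (continuous_Ri_integrable _ _ cf))) => //.
rewrite -Ri_cst//; apply: le_Rintegral => //.
- exact: continuous_Ri_integrable.
- by apply: continuous_Ri_integrable; exact: cst_continuous.
- by move=> x /=; rewrite in_itv/= => /andP[? ?]; exact: H.
Qed.

End interval_integral.

Section goursat.
Variable R : realType.
Variables A B : R -> R -> R.

(* The form [A dx + B dy] is closed: [be] is both the [y]-derivative of [A] and
   the [x]-derivative of [B]. *)
Hypothesis AB_diff : forall x0 y0, exists al be ga : R, forall e : R, 0 < e ->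
  exists2 d : R, 0 < d & forall h k, `|h| < d -> `|k| < d ->
    `|A (x0 + h) (y0 + k) - (A x0 y0 + al * h + be * k)| <= e * (`|h| + `|k|) /\
    `|B (x0 + h) (y0 + k) - (B x0 y0 + be * h + ga * k)| <= e * (`|h| + `|k|).

Let Acont y : continuous (A ^~ y).
Proof.
move=> x; apply/cvgrPdist_le => e e0.
have [al [be [ga H]]] := AB_diff x y.
have [d d0 Hd] := H _ ltr01.
have M0 : 0 < `|al| + 1 by rewrite ltr_wpDl.
have m0 : 0 < Num.min d (e / (`|al| + 1)) by rewrite lt_min d0 divr_gt0.
near=> z.
have zx : `|z - x| < Num.min d (e / (`|al| + 1)).
  by rewrite distrC; near: z; exact: (@cvgr_dist_lt _ _ _ _ _ id).
move: zx; rewrite lt_min => /andP[zd ze].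
have k0 : `|0 : R| < d by rewrite normr0.
have [+ _] := Hd _ _ zd k0; rewrite addr0 normr0 addr0 mul1r mulr0 addr0 => h.
have {h} : `|A z y - A x y| <= (`|al| + 1) * `|z - x|.
  move: h; rewrite [x + (z - x)]addrC subrK => h.
  have -> : A z y - A x y = (A z y - (A x y + al * (z - x))) + al * (z - x) by ring.
  by rewrite (le_trans (ler_normD _ _))// normrM mulrDl mul1r addrC lerD2l.
rewrite distrC => h; rewrite (le_trans h)// mulrC -ler_pdivlMr//; exact: ltW.
Unshelve. all: by end_near. Qed.

Let Bcont x : continuous (B x).
Proof.
move=> y; apply/cvgrPdist_le => e e0.
have [al [be [ga H]]] := AB_diff x y.
have [d d0 Hd] := H _ ltr01.
have M0 : 0 < `|ga| + 1 by rewrite ltr_wpDl.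
have m0 : 0 < Num.min d (e / (`|ga| + 1)) by rewrite lt_min d0 divr_gt0.
near=> z.
have zx : `|z - y| < Num.min d (e / (`|ga| + 1)).
  by rewrite distrC; near: z; exact: (@cvgr_dist_lt _ _ _ _ _ id).
move: zx; rewrite lt_min => /andP[zd ze].
have k0 : `|0 : R| < d by rewrite normr0.
have [_] := Hd _ _ k0 zd; rewrite addr0 normr0 add0r mul1r mulr0 addr0 => h.
have {h} : `|B x z - B x y| <= (`|ga| + 1) * `|z - y|.
  move: h; rewrite [y + (z - y)]addrC subrK => h.
  have -> : B x z - B x y = (B x z - (B x y + ga * (z - y))) + ga * (z - y) by ring.
  by rewrite (le_trans (ler_normD _ _))// normrM mulrDl mul1r addrC lerD2l.
rewrite distrC => h; rewrite (le_trans h)// mulrC -ler_pdivlMr//; exact: ltW.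
Unshelve. all: by end_near. Qed.

(** The integral of [A dx + B dy] along the boundary of [a, a+s] x [c, c+t], counterclockwise. *)
Definition circulation a c s t := Ri (A ^~ c) a (a + s) + Ri (B (a + s)) c (c + t)
  - Ri (A ^~ (c + t)) a (a + s) - Ri (B a) c (c + t).

Let circ_split a c s t : 0 <= s -> 0 <= t ->
  circulation a c (s + s) (t + t) = circulation a c s t + circulation (a + s) c s t +
   (circulation a (c + t) s t + circulation (a + s) (c + t) s t).
Proof.
move=> s0 t0; rewrite /circulation !addrA.
rewrite (@Ri_split _ (A ^~ c) a (a + s + s) (a + s)) ?lerDl//.
rewrite (@Ri_split _ (A ^~ (c + t + t)) a (a + s + s) (a + s)) ?lerDl//.
rewrite (@Ri_split _ (B a) c (c + t + t) (c + t)) ?lerDl//.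
rewrite (@Ri_split _ (B (a + s + s)) c (c + t + t) (c + t)) ?lerDl//.
ring.
Qed.

(** The linear parts contribute - be t s on the horizontal sides and be s t on the vertical ones,
    which cancel. The remainders on opposite sides leave at most 2 e (s + t) s + 2 e (s + t) t. *)
Let circ_local x0 y0 e : 0 < e -> exists2 d, 0 < d &
  forall a c s t, 0 <= s -> 0 <= t -> s < d -> t < d ->
   a <= x0 <= a + s -> c <= y0 <= c + t -> `|circulation a c s t| <= 2 * e * (s + t) ^+ 2.
Proof.
move=> e0; have [al [be [ga H]]] := AB_diff x0 y0; have [d d0 Hd] := H _ e0.
exists d => // a c s t s0 t0 sd td /andP[ax xa] /andP[cy yc].
have dist x : a <= x -> x <= a + s -> `|x - x0| <= s.
  by move=> h1 h2; rewrite ler_norml; apply/andP; split; lra.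
have dist' y : c <= y -> y <= c + t -> `|y - y0| <= t.
  by move=> h1 h2; rewrite ler_norml; apply/andP; split; lra.
have cas : a <= a + s by rewrite lerDl.
have cct : c <= c + t by rewrite lerDl.
have HA x y : a <= x -> x <= a + s -> c <= y -> y <= c + t ->
   `|A x y - (A x0 y0 + al * (x - x0) + be * (y - y0))| <= e * (s + t).
  move=> h1 h2 h3 h4.
  have [+ _] := Hd _ _ (le_lt_trans (dist _ h1 h2) sd) (le_lt_trans (dist' _ h3 h4) td).
  rewrite [x0 + _]addrC [y0 + _]addrC !subrK => /le_trans; apply.
  by rewrite ler_wpM2l ?(ltW e0)// lerD ?dist ?dist'.
have HB x y : a <= x -> x <= a + s -> c <= y -> y <= c + t ->
   `|B x y - (B x0 y0 + be * (x - x0) + ga * (y - y0))| <= e * (s + t).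
  move=> h1 h2 h3 h4.
  have [_] := Hd _ _ (le_lt_trans (dist _ h1 h2) sd) (le_lt_trans (dist' _ h3 h4) td).
  rewrite [x0 + _]addrC [y0 + _]addrC !subrK => /le_trans; apply.
  by rewrite ler_wpM2l ?(ltW e0)// lerD ?dist ?dist'.
have cd (f g : R -> R) (k : R) : continuous f -> continuous g -> continuous (fun x : R => (f x - g x) - k).
  by move=> cf cg x; apply: cvgB; [apply: cvgB; [exact: cf|exact: cg]|exact: cvg_cst].
have c0 (f g : R -> R) : continuous f -> continuous g -> continuous (fun x : R => f x - g x).
  by move=> cf cg x; apply: cvgB; [exact: cf|exact: cg].
have E1 : `|Ri (fun x => A x c - A x (c + t) - (- (be * t))) a (a + s)| <= 2 * e * (s + t) * (a + s - a).
  apply: Ri_bound => //; first exact: (cd (A ^~ c) (A ^~ (c + t))).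
  move=> x h1 h2.
  have := HA _ _ h1 h2 (lexx c) cct; have := HA _ _ h1 h2 cct (lexx _).
  rewrite !ler_norml => /andP[u1 u2] /andP[u3 u4]; apply/andP; split; lra.
have E2 : `|Ri (fun y => B (a + s) y - B a y - be * s) c (c + t)| <= 2 * e * (s + t) * (c + t - c).
  apply: Ri_bound => //; first exact: cd.
  move=> y h1 h2.
  have := HB _ _ cas (lexx _) h1 h2; have := HB _ _ (lexx a) cas h1 h2.
  rewrite !ler_norml => /andP[u1 u2] /andP[u3 u4]; apply/andP; split; lra.
move: E1 E2.
rewrite (@RiB _ (fun x => A x c - A x (c + t)) (fun=> - (be * t)))//; last 2 first.
  exact: (c0 (A ^~ c) (A ^~ (c + t))).
  exact: cst_continuous.
rewrite (@RiB _ (fun y => B (a + s) y - B a y) (fun=> be * s))//; last 2 first.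
  exact: c0.
  exact: cst_continuous.
rewrite (@RiB _ (A ^~ c) (A ^~ (c + t)))// (@RiB _ (B (a + s)) (B a))// !Ri_cst//.
rewrite !ler_norml /circulation => /andP[u1 u2] /andP[u3 u4]; apply/andP.
move: (Ri _ _ _) (Ri _ _ _) (Ri _ _ _) (Ri _ _ _) u1 u2 u3 u4 => r1 r2 r3 r4 u1 u2 u3 u4.
by split; nra.
Qed.

(** Repeated bisection keeps the ratio of |circulation| to (s + t)^2 at least [eta], while near the
    common point of the nested rectangles [circ_local] makes it arbitrarily small. Continuity of the
    derivative is not assumed. *)
Lemma goursat a c s t : 0 <= s -> 0 <= t -> circulation a c s t = 0.
Proof.
move=> s0 t0; apply/eqP; apply: contraT => /negP Phi0.
have Phi : 0 < `|circulation a c s t| by rewrite normr_gt0; apply/negP.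
have st0 : 0 < s + t.
  rewrite lt_neqAle addr_ge0// andbT eq_sym; apply/negP => /eqP st.
  have ss : s = 0 by lra.
  have tt : t = 0 by lra.
  move: Phi; rewrite ss tt /circulation !addr0.
  rewrite (_ : _ - _ - _ = 0) ?normr0 ?ltxx//; lra.
pose eta := `|circulation a c s t| / (s + t) ^+ 2.
have eta0 : 0 < eta by rewrite divr_gt0// exprn_gt0.
pose S n : R := s / 2 ^+ n; pose T n : R := t / 2 ^+ n.
have S0 n : 0 <= S n by rewrite divr_ge0// exprn_ge0.
have T0 n : 0 <= T n by rewrite divr_ge0// exprn_ge0.
have SS n : S n = S n.+1 + S n.+1.
  by rewrite /S exprS invfM; field; rewrite expf_neq0.
have TT n : T n = T n.+1 + T n.+1.
  by rewrite /T exprS invfM; field; rewrite expf_neq0.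
have S1 n : S n.+1 <= S n by rewrite [leRHS]SS lerDl.
have T1 n : T n.+1 <= T n by rewrite [leRHS]TT lerDl.
pose P n (p : R * R) := eta * (S n + T n) ^+ 2 <= `|circulation p.1 p.2 (S n) (T n)|.
have /choice[nxt Hnxt] : forall np : nat * (R * R), exists p' : R * R,
   P np.1 np.2 -> [/\ P np.1.+1 p', np.2.1 <= p'.1, np.2.2 <= p'.2,
      p'.1 + S np.1.+1 <= np.2.1 + S np.1 & p'.2 + T np.1.+1 <= np.2.2 + T np.1].
  move=> [n [x y]] /=.
  have [Pn|nP] := pselect (P n (x, y)); last by exists (x, y) => /nP.
  have [h1|h1] := pselect (P n.+1 (x, y)).
    by exists (x, y) => _; split; rewrite /= -?addrA -?SS -?TT ?lerDl ?lerD2l ?S1 ?T1.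
  have [h2|h2] := pselect (P n.+1 (x + S n.+1, y)).
    by exists (x + S n.+1, y) => _; split; rewrite /= -?addrA -?SS -?TT ?lerDl ?lerD2l ?S1 ?T1.
  have [h3|h3] := pselect (P n.+1 (x, y + T n.+1)).
    by exists (x, y + T n.+1) => _; split; rewrite /= -?addrA -?SS -?TT ?lerDl ?lerD2l ?S1 ?T1.
  have [h4|h4] := pselect (P n.+1 (x + S n.+1, y + T n.+1)).
    by exists (x + S n.+1, y + T n.+1) => _; split; rewrite /= -?addrA -?SS -?TT ?lerDl ?lerD2l ?S1 ?T1.
  (* Four quarters, each with circulation below a quarter of the bound, cannot add up to the
     circulation of the whole. *)
  exfalso; move: Pn h1 h2 h3 h4; rewrite /P/= => Pn.
  move=> /negP; rewrite -ltNge => h1 /negP; rewrite -ltNge => h2.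
  move=> /negP; rewrite -ltNge => h3 /negP; rewrite -ltNge => h4.
  move: Pn; rewrite (SS n) (TT n) circ_split// => Pn.
  have := le_trans Pn (le_trans (ler_normD _ _) (lerD (ler_normD _ _) (ler_normD _ _))).
  by move=> h; nra.
pose p := fix p n := if n is m.+1 then nxt (m, p m) else (a, c).
have Pp n : P n (p n).
  elim: n => [|n IH]; last by case: (Hnxt (n, p n) IH).
  rewrite /P/= /S /T expr0 !divr1 /eta -mulrA mulVf ?mulr1//.
  by rewrite expf_neq0// gt_eqF.
have mono n := Hnxt (n, p n) (Pp n).
have nest (u : nat -> R) (L : nat -> R) : (forall n, 0 <= L n) ->
    (forall n, u n <= u n.+1) -> (forall n, u n.+1 + L n.+1 <= u n + L n) ->
    exists x0, forall n, u n <= x0 <= u n + L n.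
  move=> L0 u1 u2.
  have um m n : (m <= n)%N -> u m <= u n.
    by move=> mn; apply: (@homo_leq _ u (fun x y => x <= y)) => //; exact: le_trans.
  have ul m n : (m <= n)%N -> u n + L n <= u m + L m.
    move=> mn; rewrite -lerN2.
    by apply: (@homo_leq _ (fun n => - (u n + L n)) (fun x y => x <= y)) => // [x y z|k];
      [exact: le_trans|rewrite lerN2].
  have ub m n : u n <= u m + L m.
    have [mn|nm] := leqP m n; first by rewrite (le_trans _ (ul _ _ mn))// lerDl.
    by rewrite (le_trans (um _ _ (ltnW nm)))// lerDl.
  exists (sup (range u)) => n; apply/andP; split.
    apply: ub_le_sup; last by exists n.
    by exists (u 0%N + L 0%N) => _ [m _ <-].
  apply: ge_sup; first by exists (u 0%N); exists 0%N.
  by move=> _ [m _ <-].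
have [x0 Hx] := nest (fun n => (p n).1) S S0
  (fun n => let: And5 _ h _ _ _ := mono n in h) (fun n => let: And5 _ _ _ h _ := mono n in h).
have [y0 Hy] := nest (fun n => (p n).2) T T0
  (fun n => let: And5 _ _ h _ _ := mono n in h) (fun n => let: And5 _ _ _ _ h := mono n in h).
(* With this tolerance [circ_local] bounds the ratio by 2 (eta / 4), half of [eta]. *)
have eta4 : 0 < eta / 4 by rewrite divr_gt0.
have [d d0 Hd] := circ_local x0 y0 eta4.
(* Since n < 2^n, the sides at stage [n] are shorter than [d]. *)
pose n := Num.bound ((s + t) / d).
have hn : s + t < d * 2 ^+ n.
  rewrite mulrC -ltr_pdivrMr//; apply: (@lt_trans _ _ n%:R).
    by rewrite archi_boundP// divr_ge0// ltW.
  by rewrite -natrX ltr_nat ltn_expl.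
have Sd : S n < d by rewrite ltr_pdivrMr ?exprn_gt0//; lra.
have Td : T n < d by rewrite ltr_pdivrMr ?exprn_gt0//; lra.
have := Hd _ _ _ _ (S0 n) (T0 n) Sd Td (Hx n) (Hy n).
have := Pp n; rewrite /P => h1 h2.
have := le_trans h1 h2.
have : 0 < S n + T n by rewrite -mulrDl divr_gt0// exprn_gt0.
by move=> h3; rewrite ler_pM2r ?exprn_gt0// => h4; clear -eta0 h4; lra.
Qed.

End goursat.

(** * Entire functions and the mean value property *)

Section plane_measurability.
Variable R : realType.

(** The sigma-algebra of the plane is the product one, so the open preimage of a ray has to be
    exhibited as a countable union of boxes with rational corners. *)
Lemma continuous2_measurable (f : R -> R -> R) :
  (forall x y e, 0 < e -> exists2 d, 0 < d & forall x' y', `|x' - x| < d ->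
     `|y' - y| < d -> `|f x' y' - f x y| < e) ->
  measurable_fun setT (fun p : plane R => f p.1 p.2).
Proof.
move=> cf; apply: (measurability _ (RGenOInfty.measurableE R)).
move=> /= _ [_ [a ->] <-]; rewrite setTI.
pose box (q : (rat * rat) * (rat * rat)) : set (plane R) :=
  `]ratr q.1.1, ratr q.1.2[%classic `*` `]ratr q.2.1, ratr q.2.2[%classic.
pose U : set (plane R) := [set p | a < f p.1 p.2].
pose D q := if asbool (box q `<=` U) then box q else set0.
rewrite (_ : _ @^-1` _ = \bigcup_q D q); last first.
  apply/seteqP; split=> [[x y]|[x y] [q _]] /=; last first.
    by rewrite /D; case: asboolP => // h /h /=; rewrite in_itv/= andbT.
  rewrite in_itv/= andbT => axy.
  have e0 : 0 < f x y - a by rewrite subr_gt0.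
  have [d d0 Hd] := cf x y _ e0.
  have near r : exists q1 q2 : rat, [/\ r - d < ratr q1, ratr q1 < r,
      r < ratr q2 & ratr q2 < r + d].
    have [|q1] := @rat_in_itvoo R (r - d) r; first by rewrite ltrBlDr ltrDl.
    rewrite in_itv/= => /andP[h1 h2].
    have [|q2] := @rat_in_itvoo R r (r + d); first by rewrite ltrDl.
    by rewrite in_itv/= => /andP[h3 h4]; exists q1, q2.
  have [q1 [q2 [h1 h2 h3 h4]]] := near x.
  have [r1 [r2 [k1 k2 k3 k4]]] := near y.
  exists ((q1, q2), (r1, r2)) => //; rewrite /D; case: asboolP => [_|].
    by rewrite /box/=; split; rewrite /= in_itv/= ?h2 ?h3 ?k2 ?k3.
  case=> -[x' y'] [] /=; rewrite !in_itv/= => /andP[u1 u2] /andP[v1 v2].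
  have := Hd x' y'; rewrite !ltr_norml.
  have -> : - d < x' - x < d by apply/andP; split; lra.
  have -> : - d < y' - y < d by apply/andP; split; lra.
  by move=> /(_ erefl erefl)/andP[h _]; rewrite /U/=; lra.
apply: countable_bigcupT_measurable => [|q]; first exact: countableP.
rewrite /D; case: asboolP => // _.
by apply: measurableX.
Qed.

End plane_measurability.

Section complex_differentiability.
Variable R : realType.
Implicit Types (f g h : R[i] -> R[i]) (z w c : R[i]).

Definition centire h := forall z, exists c, cdiff h z c.

Lemma entireE h : entire h <-> centire h.
Proof. by split=> H z; apply/derivable_cdiff; exact: H. Qed.

Lemma cdiff_lip f z c : cdiff f z c -> exists2 d : R, 0 < d &
  forall k, normc k < d -> normc (f (z + k) - f z) <= (normc c + 1) * normc k.
Proof.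
move=> /(_ 1 ltr01)[d d0 H]; exists d => // k /H; rewrite mul1r => h.
have -> : f (z + k) - f z = (f (z + k) - f z - c * k) + c * k by rewrite subrK.
by rewrite (le_trans (ler_normcD _ _))// normcM mulrDl mul1r addrC lerD2l.
Qed.

Lemma cdiff_comp f g z c c' : cdiff f z c -> cdiff g (f z) c' ->
  cdiff (fun w => g (f w)) z (c' * c).
Proof.
move=> hf hg e e0.
have c0 := normc_ge0 c; have c'0 := normc_ge0 c'.
have e1 : 0 < e / 2 / (normc c' + 1) by rewrite !divr_gt0// ltr_wpDl.
have e2 : 0 < e / 2 / (normc c + 1) by rewrite !divr_gt0// ltr_wpDl.
have [d1 d10 h1] := hf _ e1; have [d2 d20 h2] := hg _ e2.
have [d3 d30 h3] := cdiff_lip hf.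
have d4 : 0 < d2 / (normc c + 1) by rewrite divr_gt0// ltr_wpDl.
exists (Num.min d1 (Num.min d3 (d2 / (normc c + 1)))); first by rewrite !lt_min d10 d30.
move=> k; rewrite !lt_min => /and3P[k1 k3 k4].
have hk := h1 _ k1; have hk3 := h3 _ k3.
set k' := f (z + k) - f z in hk hk3.
have k'd : normc k' < d2.
  by rewrite (le_lt_trans hk3)// mulrC -ltr_pdivlMr// ltr_wpDl.
have fk : f z + k' = f (z + k) by rewrite /k' addrC subrK.
have := h2 _ k'd; rewrite fk => hg2.
set t := g _ - g _ - _ in hg2 *.
have -> : g (f (z + k)) - g (f z) - c' * c * k = t + c' * (k' - c * k).
  by rewrite /t; ring.
apply: (le_trans (ler_normcD _ _)); rewrite normcM.
rewrite [e]splitr mulrDl lerD//.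
  apply: (le_trans hg2).
  apply: (le_trans (ler_wpM2l (ltW e2) hk3)).
  by rewrite mulrA divfK// gt_eqF// ltr_wpDl.
have -> : e / 2 * normc k = (normc c' + 1) * (e / 2 / (normc c' + 1) * normc k).
  by rewrite mulrA (mulrC (normc c' + 1)) divfK// gt_eqF// ltr_wpDl.
by rewrite ler_pM ?normc_ge0// lerDl.
Qed.

Lemma cdiff_mul f g z c c' : cdiff f z c -> cdiff g z c' ->
  cdiff (fun w => f w * g w) z (c * g z + f z * c').
Proof.
move=> hf hg e e0.
have [d3 d30 h3] := cdiff_lip hf; have [d4 d40 h4] := cdiff_lip hg.
have c0 := normc_ge0 c; have c'0 := normc_ge0 c'.
have f0 := normc_ge0 (f z); have g0 := normc_ge0 (g z).
have e3 : 0 < e / 3 by rewrite divr_gt0.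
have e1 : 0 < e / 3 / (normc (g z) + 1) by rewrite !divr_gt0// ltr_wpDl.
have e2 : 0 < e / 3 / (normc (f z) + 1) by rewrite !divr_gt0// ltr_wpDl.
have [d1 d10 h1] := hf _ e1; have [d2 d20 h2] := hg _ e2.
pose M := (normc c + 1) * (normc c' + 1).
have M0 : 0 < M by rewrite mulr_gt0// ltr_wpDl.
exists (Num.min (Num.min d1 d2) (Num.min (Num.min d3 d4) (e / 3 / M))).
  by rewrite !lt_min d10 d20 d30 d40 divr_gt0.
move=> k; rewrite !lt_min => /and3P[/andP[k1 k2] /andP[k3 k4] k5].
have := h1 _ k1; have := h2 _ k2; have := h3 _ k3; have := h4 _ k4.
set a := f (z + k) - f z; set b := g (z + k) - g z => hb ha hb' ha'.
have -> : f (z + k) * g (z + k) - f z * g z - (c * g z + f z * c') * k =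
   (a - c * k) * g z + f z * (b - c' * k) + a * b by rewrite /a /b; ring.
apply: (le_trans (ler_normcD _ _)).
have -> : e * normc k = e / 3 * normc k + e / 3 * normc k + e / 3 * normc k by field.
rewrite lerD//; last first.
  rewrite normcM; apply: (le_trans (ler_pM (normc_ge0 _) (normc_ge0 _) ha hb)).
  rewrite mulrACA -/M mulrA ler_wpM2r ?normc_ge0//.
  by rewrite mulrC -ler_pdivlMr// ltW.
apply: (le_trans (ler_normcD _ _)); rewrite lerD// normcM.
  have -> : e / 3 * normc k = (e / 3 / (normc (g z) + 1) * normc k) * (normc (g z) + 1).
    by rewrite [RHS]mulrAC divfK// gt_eqF// ltr_wpDl.
  by rewrite ler_pM ?normc_ge0// lerDl.
have -> : e / 3 * normc k = (normc (f z) + 1) * (e / 3 / (normc (f z) + 1) * normc k).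
  by rewrite mulrA (mulrC (normc (f z) + 1)) divfK// gt_eqF// ltr_wpDl.
by rewrite ler_pM ?normc_ge0// lerDl.
Qed.

Lemma cdiff_affine (a b : R[i]) z : cdiff (fun w => a + b * w) z b.
Proof.
move=> e e0; exists 1 => // k _.
have -> : a + b * (z + k) - (a + b * z) - b * k = 0 by ring.
by rewrite normc0 mulr_ge0 ?normc_ge0// ltW.
Qed.

Lemma cdiff_cexp z : cdiff (@cexp R) z (cexp z).
Proof.
move=> e e0; pose M := expR (complex.Re z) * expR 1.
have M0 : 0 < M by rewrite mulr_gt0 ?expR_gt0.
exists (Num.min 1 (e / M)); first by rewrite lt_min ltr01 divr_gt0.
move=> k; rewrite lt_min => /andP[k1 k2].
have -> : cexp (z + k) - cexp z - cexp z * k = cexp z * (cexp k - (1 + k)).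
  by rewrite cexpD; ring.
rewrite normcM normc_cexp.
apply: (le_trans (ler_wpM2l (expR_ge0 _) (normc_cexpB1 k))).
have h : expR (normc k) <= expR 1 by rewrite ler_expR ltW.
rewrite mulrCA expr2 -mulrA mulrC ler_wpM2r ?normc_ge0//.
apply: (@le_trans _ _ (normc k * M)).
  by rewrite ler_wpM2l ?normc_ge0// /M ler_wpM2l ?expR_ge0.
by rewrite -ler_pdivlMr// ltW.
Qed.

Lemma centire_affine a b : centire (fun w => a + b * w).
Proof. by move=> z; exists b; exact: cdiff_affine. Qed.

Lemma centire_comp f g : centire f -> centire g -> centire (fun w => g (f w)).
Proof.
by move=> hf hg z; have [c hc] := hf z; have [c' hc'] := hg (f z); eexists; exact: cdiff_comp hc hc'.
Qed.

Lemma centire_mul f g : centire f -> centire g -> centire (fun w => f w * g w).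
Proof.
by move=> hf hg z; have [c hc] := hf z; have [c' hc'] := hg z; eexists; exact: cdiff_mul hc hc'.
Qed.

Lemma centire_cexp : centire (@cexp R).
Proof. by move=> z; eexists; exact: cdiff_cexp. Qed.

Lemma centire_expr n : centire (fun w => w ^+ n).
Proof.
elim: n => [|n IH].
  by move=> z; exists 0 => e e0; exists 1 => // k _; rewrite !expr0 subrr mul0r subr0 normc0 mulr_ge0 ?normc_ge0// ltW.
have := centire_mul (@centire_affine 0 1) IH.
by under eq_fun do rewrite add0r mul1r -exprS.
Qed.

Lemma centire_continuous f z (e : R) : centire f -> 0 < e ->
  exists2 d : R, 0 < d & forall k, normc k < d -> normc (f (z + k) - f z) < e.
Proof.
move=> /(_ z)[c /cdiff_lip[d d0 H]] e0; have c0 := normc_ge0 c.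
exists (Num.min d (e / (normc c + 1))).
  by rewrite lt_min d0 divr_gt0// ltr_wpDl.
move=> k; rewrite lt_min => /andP[/H h k2]; apply: (le_lt_trans h).
by rewrite mulrC -ltr_pdivlMr// ltr_wpDl.
Qed.

Lemma centire_cmeasurable f : centire f -> cmeasurable f.
Proof.
move=> cf.
have H x y e : 0 < e -> exists2 d, 0 < d & forall x' y', `|x' - x| < d ->
     `|y' - y| < d -> normc (f (Complex x' y') - f (Complex x y)) < e.
  move=> e0; have [d d0 Hd] := centire_continuous (Complex x y) cf e0.
  have d2 : 0 < d / 2 by rewrite divr_gt0.
  exists (d / 2) => // x' y' hx hy.
  have := Hd (Complex (x' - x) (y' - y)).
  have -> : Complex x y + Complex (x' - x) (y' - y) = Complex x' y'.
    by apply: eq_ReIm; rewrite ?cReD ?cImD/= addrC subrK.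
  apply; rewrite (le_lt_trans (normc_le_ReIm _))//=; lra.
split.
  apply: (@continuous2_measurable R (fun x y => complex.Re (f (Complex x y)))).
  move=> x y e /(H x y)[d d0 Hd]; exists d => // x' y' hx hy.
  by rewrite -cReN -cReD (le_lt_trans (Re_le_normc _))// Hd.
apply: (@continuous2_measurable R (fun x y => complex.Im (f (Complex x y)))).
move=> x y e /(H x y)[d d0 Hd]; exists d => // x' y' hx hy.
by rewrite -cImN -cImD (le_lt_trans (Im_le_normc _))// Hd.
Qed.

Lemma centire_Re_continuous f x : centire f ->
  continuous (fun y : R => complex.Re (f (Complex x y))).
Proof.
move=> cf y; apply/cvgrPdist_lt => e e0.
have [d d0 Hd] := centire_continuous (Complex x y) cf e0.
near=> y'.
have yy : `|y' - y| < d by rewrite distrC; near: y'; exact: (@cvgr_dist_lt _ _ _ _ _ id).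
have := Hd (Complex 0 (y' - y)).
have -> : Complex x y + Complex 0 (y' - y) = Complex x y'.
  by apply: eq_ReIm; rewrite ?cReD ?cImD/= ?addr0// addrC subrK.
move=> /(_ _)H; rewrite distrC -cReN -cReD (le_lt_trans (Re_le_normc _))// H//.
by rewrite (le_lt_trans (normc_le_ReIm _))//= normr0 add0r.
Unshelve. all: by end_near. Qed.

End complex_differentiability.

Section mean_value.
Variable R : realType.
Implicit Types (g : R[i] -> R[i]) (w : R[i]).

(* Goursat for [zeta |-> g (w e^zeta)] on [[-k, 0] x [0, 2 pi]], with [k] so
   large that the left side is mapped near [0]. *)
Lemma circle_mean_Re g w : centire g ->
  Ri (fun t => complex.Re (g (w * cexp (Complex 0 t)))) 0 (2 * pi) =
  2 * pi * complex.Re (g 0).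
Proof.
move=> cg.
have p0 : 0 < 2 * pi :> R by rewrite mulr_gt0 ?pi_gt0.
pose U z := g (0 + w * cexp z).
have cU : centire U.
  exact: (centire_comp (centire_comp (@centire_cexp R) (@centire_affine R 0 w)) cg).
(* [A dx + B dy] is the imaginary part of U dz; the Cauchy-Riemann equations, read off from the
   derivative [c1 + i c2], make it closed. *)
pose A x y := complex.Im (U (Complex x y)); pose B x y := complex.Re (U (Complex x y)).
have AB x0 y0 : exists al be ga : R, forall e : R, 0 < e ->
  exists2 d : R, 0 < d & forall h k, `|h| < d -> `|k| < d ->
    `|A (x0 + h) (y0 + k) - (A x0 y0 + al * h + be * k)| <= e * (`|h| + `|k|) /\
    `|B (x0 + h) (y0 + k) - (B x0 y0 + be * h + ga * k)| <= e * (`|h| + `|k|).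
  have [[c1 c2] hc] := cU (Complex x0 y0).
  exists c2, c1, (- c2) => e e0; have [d d0 Hd] := hc _ e0.
  have d2 : 0 < d / 2 by rewrite divr_gt0.
  exists (d / 2) => // h k hh hk.
  have nhk : normc (Complex h k) <= `|h| + `|k| by exact: normc_le_ReIm.
  have := Hd (Complex h k) ltac:(apply: (le_lt_trans nhk); lra).
  have -> : Complex x0 y0 + Complex h k = Complex (x0 + h) (y0 + k).
    by apply: eq_ReIm; rewrite ?cReD ?cImD.
  move=> H; have {}H := le_trans H (ler_wpM2l (ltW e0) nhk).
  split.
    apply: le_trans H; apply: le_trans (Im_le_normc _).
    rewrite !(cImD, cImN, cImM) /= /A le_eqVlt; apply/orP; left; apply/eqP.
    by congr (`| _ |); ring.
  apply: le_trans H; apply: le_trans (Re_le_normc _).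
  rewrite !(cReD, cReN, cReM) /= /B le_eqVlt; apply/orP; left; apply/eqP.
  by congr (`| _ |); ring.
(* The period 2 pi i of the exponential makes the two horizontal sides cancel. *)
have per x : A x (0 + 2 * pi) = A x 0.
  rewrite /A /U /cexp/=.
  by rewrite !add0r mulr_natl cos2pi sin2pi cos0 sin0.
have eqM s : 0 <= s -> Ri (B 0) 0 (2 * pi) = Ri (B (- s)) 0 (2 * pi).
  move=> s0; have := goursat AB (- s) 0 s0 (ltW p0).
  rewrite /circulation addNr add0r.
  have -> : A ^~ (2 * pi) = A ^~ 0.
    by apply/funext => x; have := per x; rewrite add0r.
  by move: (Ri _ _ _) (Ri _ _ _) (Ri _ _ _) => r1 r2 r3 h; clear -h; lra.
have cB x : continuous (B x) by exact: centire_Re_continuous.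
have -> : (fun t => complex.Re (g (w * cexp (Complex 0 t)))) = B 0.
  by apply/funext => t; rewrite /B /U add0r.
apply/eqP; rewrite -subr_eq0 -normr_le0; apply/ler_addgt0Pr => e e0; rewrite add0r.
have e1 : 0 < e / (2 * pi) by rewrite divr_gt0.
have [d d0 Hd] := centire_continuous 0 cg e1.
(* On the line of abscissa - s the argument of [g] has modulus |w| e^(-s), which is below [d]
   because e^s >= 1 + s > |w| / d. *)
pose s := normc w / d.
have s0 : 0 <= s by rewrite divr_ge0 ?normc_ge0// ltW.
rewrite (eqM s s0).
have -> : 2 * pi * complex.Re (g 0) = Ri (fun=> complex.Re (g 0)) 0 (2 * pi).
  by rewrite Ri_cst ?subr0 ?(ltW p0)// mulrC.
rewrite -RiB//; last exact: cst_continuous.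
have -> : e = e / (2 * pi) * (2 * pi - 0) by rewrite subr0 divfK// gt_eqF.
apply: Ri_bound; last 2 first.
- exact: ltW.
- move=> t _ _; rewrite -cReN -cReD (le_trans (Re_le_normc _))// ltW//.
  rewrite /U; apply: Hd; rewrite normcM normc_cexp/=.
  rewrite expRN -ltr_pdivlMr ?invr_gt0 ?expR_gt0// invrK.
  rewrite mulrC -ltr_pdivrMr// -/s.
  by rewrite (lt_le_trans _ (expR_ge1Dx _))// ltrDr.
- by move=> y; apply: cvgB; [exact: cB|exact: cvg_cst].
Qed.

End mean_value.

(** * Complex integrals against the Gaussian measure *)

HB.instance Definition _ (R : realType) :=
  Measure_isProbability.Build _ _ _ (@gauss2 R) (gauss2_setT R).

Section complex_integral.
Variable R : realType.
Implicit Types (f g : R[i] -> R[i]) (F G : R[i] -> R) (c : R[i]).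

Definition rmeasurable F := measurable_fun [set: plane R] (fun p => F (toC p)).
Definition rintegrable F := (mu R).-integrable setT (fun p : plane R => (F (toC p))%:E).
Definition rintegral F : R := \int[mu R]_p F (toC p).

Lemma rintegrable_measurable F : rintegrable F -> rmeasurable F.
Proof. by move/measurable_int/measurable_EFinP. Qed.

Lemma rintegrable_le F G : rmeasurable F -> rintegrable G ->
  (forall w, `|F w| <= G w) -> rintegrable F.
Proof.
move=> mF iG FG; apply: le_integrable iG => //; first exact/measurable_EFinP.
by move=> p _ /=; rewrite lee_fin (le_trans (FG _))// ler_norm.
Qed.

Lemma rintegrableP F : rmeasurable F -> (forall w, 0 <= F w) ->
  (\int[mu R]_p (F (toC p))%:E < +oo)%E -> rintegrable F.
Proof.
move=> mF F0 Fy; apply/integrableP; split; first exact/measurable_EFinP.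
by under eq_integral do rewrite gee0_abs ?lee_fin//.
Qed.

Lemma rintegrableD F G : rintegrable F -> rintegrable G ->
  rintegrable (fun w => F w + G w).
Proof. by move=> iF iG; exact: (integrableD measurableT iF iG). Qed.

Lemma rintegrableB F G : rintegrable F -> rintegrable G ->
  rintegrable (fun w => F w - G w).
Proof. by move=> iF iG; exact: (integrableB measurableT iF iG). Qed.

Lemma rintegrableZ (k : R) F : rintegrable F -> rintegrable (fun w => k * F w).
Proof. by move=> iF; exact: (integrableZl measurableT k iF). Qed.

Lemma rintegralD F G : rintegrable F -> rintegrable G ->
  rintegral (fun w => F w + G w) = rintegral F + rintegral G.
Proof. by move=> iF iG; rewrite /rintegral RintegralD. Qed.

Lemma rintegralB F G : rintegrable F -> rintegrable G ->
  rintegral (fun w => F w - G w) = rintegral F - rintegral G.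
Proof. by move=> iF iG; rewrite /rintegral RintegralB. Qed.

Lemma rintegralZ (k : R) F : rintegrable F -> rintegral (fun w => k * F w) = k * rintegral F.
Proof. by move=> iF; rewrite /rintegral RintegralZl. Qed.

Lemma rintegral_ge0 F : (forall w, 0 <= F w) -> 0 <= rintegral F.
Proof. by move=> F0; apply: Rintegral_ge0. Qed.

Lemma rintegral_le F G : rintegrable F -> rintegrable G ->
  (forall w, F w <= G w) -> rintegral F <= rintegral G.
Proof. by move=> iF iG FG; apply: le_Rintegral. Qed.

Lemma rintegralE F : rintegrable F -> (\int[mu R]_p (F (toC p))%:E = (rintegral F)%:E)%E.
Proof. by move=> iF; rewrite /rintegral fineK// integrable_fin_num. Qed.

Lemma rintegral_cvg (F_ : nat -> R[i] -> R) F G :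
  (forall n, rmeasurable (F_ n)) -> rintegrable G ->
  (forall n w, `|F_ n w| <= G w) -> (forall w, (fun n => F_ n w) @ \oo --> F w) ->
  rintegrable F /\ (fun n => rintegral (F_ n)) @ \oo --> rintegral F.
Proof.
move=> mF iG FG FF.
have mF' : rmeasurable F.
  by apply: (@measurable_fun_cvg _ _ _ _ (fun n (p : plane R) => F_ n (toC p))) => [n|p _]; [exact: mF|exact: FF].
have := @dominated_convergence _ _ R (mu R) setT measurableT
  (fun n (p : plane R) => (F_ n (toC p))%:E) (fun p => (F (toC p))%:E) (fun p => (G (toC p))%:E).
case=> //.
- by move=> n; apply/measurable_EFinP; exact: mF.
- by apply/measurable_EFinP; exact: mF'.
- by apply/nearW => p _; apply: cvg_EFin; [exact: nearW|exact: FF].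
- by apply/nearW => p n _; rewrite lee_fin.
move=> iF _ cF; split=> //.
by apply: fine_cvg; rewrite fineK ?integrable_fin_num.
Qed.

Lemma cmeasurable_cst c : cmeasurable (fun=> c).
Proof. by split; exact: measurable_cst. Qed.

Lemma cmeasurableD f g : cmeasurable f -> cmeasurable g -> cmeasurable (fun w => f w + g w).
Proof.
move=> [f1 f2] [g1 g2]; split.
  by under eq_fun do rewrite cReD; exact: measurable_funD.
by under eq_fun do rewrite cImD; exact: measurable_funD.
Qed.

Lemma cmeasurableM f g : cmeasurable f -> cmeasurable g -> cmeasurable (fun w => f w * g w).
Proof.
move=> [f1 f2] [g1 g2]; split.
  by under eq_fun do rewrite cReM; apply: measurable_funB; exact: measurable_funM.
by under eq_fun do rewrite cImM; apply: measurable_funD; exact: measurable_funM.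
Qed.

Lemma cmeasurable_conj f : cmeasurable f -> cmeasurable (fun w => conjc (f w)).
Proof.
move=> [f1 f2]; split.
  by rewrite (_ : (fun p => _) = (fun p => complex.Re (f (toC p))))//; apply/funext => p; case: (f _).
rewrite (_ : (fun p => _) = (fun p => - complex.Im (f (toC p)))); last by apply/funext => p; case: (f _).
exact: measurableT_comp.
Qed.

Lemma cmeasurable_normc f : cmeasurable f -> rmeasurable (fun w => normc (f w)).
Proof.
move=> [f1 f2]; rewrite /rmeasurable; under eq_fun do rewrite normc_ReIm.
apply: (measurableT_comp (continuous_measurable_fun (@sqrt_continuous R))).
by apply: measurable_funD; apply: measurable_funX.
Qed.

Lemma cmeasurable_cvg (f_ : nat -> R[i] -> R[i]) f : (forall n, cmeasurable (f_ n)) ->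
  (forall w, ((fun n => f_ n w) : nat -> R[i]^o) @ \oo --> (f w : R[i]^o)) -> cmeasurable f.
Proof.
move=> mf cf; split.
- apply: (@measurable_fun_cvg _ _ _ _ (fun n (p : plane R) => complex.Re (f_ n (toC p)))) => [n|p _].
    by case: (mf n).
  by have /cvgc_ReIm[] := cf (toC p).
- apply: (@measurable_fun_cvg _ _ _ _ (fun n (p : plane R) => complex.Im (f_ n (toC p)))) => [n|p _].
    by case: (mf n).
  by have /cvgc_ReIm[] := cf (toC p).
Qed.

Lemma cintegrable_measurable f : cintegrable f -> cmeasurable f.
Proof. move=> [f1 f2]; split.
  exact: (@rintegrable_measurable (fun w => complex.Re (f w))).
exact: (@rintegrable_measurable (fun w => complex.Im (f w))). Qed.

Lemma cintegrable_le f G : cmeasurable f -> rintegrable G ->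
  (forall w, normc (f w) <= G w) -> cintegrable f.
Proof.
move=> [m1 m2] iG fG; split.
  by apply: (@rintegrable_le (fun w => complex.Re (f w)) G) => // w; exact: le_trans (Re_le_normc _) (fG w).
by apply: (@rintegrable_le (fun w => complex.Im (f w)) G) => // w; exact: le_trans (Im_le_normc _) (fG w).
Qed.

Lemma cintegrable_normc f : cintegrable f -> rintegrable (fun w => normc (f w)).
Proof.
move=> cf; have [h1 h2] := cf.
have i1 := integrable_norm h1; have i2 := integrable_norm h2.
have := @rintegrableD (fun w => `|complex.Re (f w)|) (fun w => `|complex.Im (f w)|) i1 i2.
move=> iG; apply: (rintegrable_le _ iG) => [|w]; first exact: (cmeasurable_normc (cintegrable_measurable cf)).
by rewrite ger0_norm ?normc_ge0// normc_le_ReIm.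
Qed.

Lemma cintegrableD f g : cintegrable f -> cintegrable g -> cintegrable (fun w => f w + g w).
Proof.
move=> [f1 f2] [g1 g2]; split.
  by under eq_fun do rewrite cReD; exact: (@rintegrableD (fun w => complex.Re (f w)) (fun w => complex.Re (g w))).
by under eq_fun do rewrite cImD; exact: (@rintegrableD (fun w => complex.Im (f w)) (fun w => complex.Im (g w))).
Qed.

Lemma cintegrableZ c f : cintegrable f -> cintegrable (fun w => c * f w).
Proof.
move=> cf; have := rintegrableZ (normc c) (cintegrable_normc cf).
move=> iG; apply: (cintegrable_le _ iG) => [|w]; last by rewrite normcM.
apply: cmeasurableM; [exact: cmeasurable_cst|exact: cintegrable_measurable].
Qed.

Lemma cintegralD f g : cintegrable f -> cintegrable g ->
  cintegral (fun w => f w + g w) = cintegral f + cintegral g.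
Proof.
move=> [f1 f2] [g1 g2]; apply: eq_ReIm; rewrite ?cReD ?cImD/=.
  under eq_Rintegral do rewrite cReD.
  exact: (@rintegralD (fun w => complex.Re (f w)) (fun w => complex.Re (g w))).
under eq_Rintegral do rewrite cImD.
exact: (@rintegralD (fun w => complex.Im (f w)) (fun w => complex.Im (g w))).
Qed.

Lemma cintegralZ c f : cintegrable f -> cintegral (fun w => c * f w) = c * cintegral f.
Proof.
move=> [f1 f2].
pose rf w := complex.Re (f w); pose jf w := complex.Im (f w).
have [a1 a2] := (@rintegrableZ (complex.Re c) rf f1, @rintegrableZ (complex.Re c) jf f2).
have [b1 b2] := (@rintegrableZ (complex.Im c) rf f1, @rintegrableZ (complex.Im c) jf f2).
apply: eq_ReIm; rewrite ?cReM ?cImM/=.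
  under eq_Rintegral do rewrite cReM.
  rewrite -(@rintegralZ (complex.Re c) rf)// -(@rintegralZ (complex.Im c) jf)//.
  exact: rintegralB a1 b2.
under eq_Rintegral do rewrite cImM.
rewrite -(@rintegralZ (complex.Re c) jf)// -(@rintegralZ (complex.Im c) rf)//.
exact: rintegralD a2 b1.
Qed.

Lemma cintegralB f g : cintegrable f -> cintegrable g ->
  cintegral (fun w => f w - g w) = cintegral f - cintegral g.
Proof.
move=> cf cg; have := cintegralD cf (cintegrableZ (-1) cg).
rewrite cintegralZ// mulN1r => <-; congr cintegral; apply/funext => w; by rewrite mulN1r.
Qed.

Lemma cintegrableB f g : cintegrable f -> cintegrable g -> cintegrable (fun w => f w - g w).
Proof.
move=> cf cg; have := cintegrableD cf (cintegrableZ (-1) cg).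
by under eq_fun do rewrite mulN1r.
Qed.

Lemma cintegrable0 : cintegrable (fun=> 0 : R[i]).
Proof. by split; exact: integrable0. Qed.

Lemma cintegral0 : cintegral (fun=> 0 : R[i]) = 0.
Proof. by apply: eq_ReIm => /=; rewrite Rintegral_cst// mul0r. Qed.

Lemma cintegrable_sum (I : Type) (s : seq I) (f_ : I -> R[i] -> R[i]) :
  (forall i, cintegrable (f_ i)) -> cintegrable (fun w => \sum_(i <- s) f_ i w).
Proof.
move=> cf; elim: s => [|i s IH].
  by under eq_fun do rewrite big_nil; exact: cintegrable0.
by under eq_fun do rewrite big_cons; exact: cintegrableD.
Qed.

Lemma cintegral_sum (I : Type) (s : seq I) (f_ : I -> R[i] -> R[i]) :
  (forall i, cintegrable (f_ i)) ->
  cintegral (fun w => \sum_(i <- s) f_ i w) = \sum_(i <- s) cintegral (f_ i).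
Proof.
move=> cf; elim: s => [|i s IH].
  by rewrite big_nil; under eq_fun do rewrite big_nil; exact: cintegral0.
rewrite big_cons -IH -cintegralD//; last exact: cintegrable_sum.
by congr cintegral; apply/funext => w; rewrite big_cons.
Qed.

Lemma cintegral_conj f : cintegrable f -> cintegral (fun w => conjc (f w)) = conjc (cintegral f).
Proof.
move=> [f1 f2]; apply: eq_ReIm; rewrite /=.
  by apply: eq_Rintegral => p _; case: (f _).
transitivity (\int[mu R]_p (-1 * complex.Im (f (toC p)))).
  by apply: eq_Rintegral => p _; case: (f _) => a b /=; rewrite mulN1r.
by have := @rintegralZ (-1) (fun w => complex.Im (f w)) f2; rewrite mulN1r.
Qed.

(** The factor 2 comes from bounding real and imaginary parts separately; it is harmless, since the
    estimate serves only to show that something is arbitrarily small. *)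
Lemma normc_cintegral_le f : cintegrable f ->
  normc (cintegral f) <= 2 * rintegral (fun w => normc (f w)).
Proof.
move=> cf; have [f1 f2] := cf; have i := cintegrable_normc cf.
rewrite (le_trans (normc_le_ReIm _))//= mulr_natl mulr2n lerD//.
  apply: le_trans (le_normr_Rintegral _ f1) _ => //.
  apply: (@rintegral_le (fun w => `|complex.Re (f w)|)) => //; first exact: integrable_norm.
  by move=> w; exact: Re_le_normc.
apply: le_trans (le_normr_Rintegral _ f2) _ => //.
apply: (@rintegral_le (fun w => `|complex.Im (f w)|)) => //; first exact: integrable_norm.
by move=> w; exact: Im_le_normc.
Qed.

Lemma cintegral_cvg (f_ : nat -> R[i] -> R[i]) f G :
  (forall n, cmeasurable (f_ n)) -> rintegrable G ->
  (forall n w, normc (f_ n w) <= G w) ->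
  (forall w, ((fun n => f_ n w) : nat -> R[i]^o) @ \oo --> (f w : R[i]^o)) ->
  cintegrable f /\
  ((fun n => cintegral (f_ n)) : nat -> R[i]^o) @ \oo --> (cintegral f : R[i]^o).
Proof.
move=> mf iG fG ff.
have := @rintegral_cvg (fun n w => complex.Re (f_ n w)) (fun w => complex.Re (f w)) G.
case=> //.
- by move=> n; case: (mf n).
- by move=> n w; exact: le_trans (Re_le_normc _) (fG n w).
- by move=> w; have /cvgc_ReIm[] := ff w.
move=> i1 c1.
have := @rintegral_cvg (fun n w => complex.Im (f_ n w)) (fun w => complex.Im (f w)) G.
case=> //.
- by move=> n; case: (mf n).
- by move=> n w; exact: le_trans (Im_le_normc _) (fG n w).
- by move=> w; have /cvgc_ReIm[] := ff w.
move=> i2 c2; split; first by split.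
by apply/cvgc_ReIm; split.
Qed.

End complex_integral.

(** * Square-integrable functions *)

Section L2_functions.
Variable R : realType.
Implicit Types (f g : R[i] -> R[i]) (c : R[i]).

Definition n2 f : R := rintegral (fun w => normc (f w) ^+ 2).

Lemma cmeasurable_sqr f : cmeasurable f -> rmeasurable (fun w => normc (f w) ^+ 2).
Proof. by move=> mf; apply: measurable_funX; exact: cmeasurable_normc mf. Qed.

Lemma L2P f : L2 f <-> cmeasurable f /\ rintegrable (fun w => normc (f w) ^+ 2).
Proof.
split=> -[mf h]; split=> //.
  by apply: rintegrableP => //; [exact: cmeasurable_sqr|move=> w; rewrite sqr_ge0].
rewrite /normL2sq (@rintegralE _ (fun w => normc (f w) ^+ 2))//.
by rewrite ltry.
Qed.

Lemma L2_measurable f : L2 f -> cmeasurable f. Proof. by case. Qed.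

Lemma L2_rintegrable f : L2 f -> rintegrable (fun w => normc (f w) ^+ 2).
Proof. by move/L2P => -[]. Qed.

Lemma normL2sqE f : L2 f -> normL2sq f = (n2 f)%:E.
Proof. by move=> /L2_rintegrable h; rewrite -(rintegralE h). Qed.

Lemma normL2E f : L2 f -> normL2 f = Num.sqrt (n2 f).
Proof. by move=> h; rewrite /normL2 normL2sqE. Qed.

Lemma n2_ge0 f : 0 <= n2 f.
Proof. by apply: rintegral_ge0 => w; rewrite sqr_ge0. Qed.

Lemma L2_mul_rintegrable f g : L2 f -> L2 g -> rintegrable (fun w => normc (f w) * normc (g w)).
Proof.
move=> /L2P[mf hf] /L2P[mg hg].
apply: (rintegrable_le _ (rintegrableD hf hg)) => [|w].
  by apply: measurable_funM; [exact: (cmeasurable_normc mf)|exact: (cmeasurable_normc mg)].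
rewrite ger0_norm ?mulr_ge0 ?normc_ge0//.
have := sqr_ge0 (normc (f w) - normc (g w)).
have := sqr_ge0 (normc (f w) + normc (g w)); rewrite sqrrB sqrrD.
move: (normc _) (normc _) => a b; lra.
Qed.

Lemma L2_mul f g : L2 f -> L2 g -> cintegrable (fun w => f w * g w).
Proof.
move=> hf hg; apply: (cintegrable_le _ (L2_mul_rintegrable hf hg)) => [|w].
  by apply: cmeasurableM; exact: L2_measurable.
by rewrite normcM.
Qed.

Lemma L2_le f g : cmeasurable f -> L2 g -> (forall w, normc (f w) <= normc (g w)) -> L2 f.
Proof.
move=> mf /L2P[mg hg] fg; apply/L2P; split=> //.
apply: (rintegrable_le _ hg) => [|w]; first exact: cmeasurable_sqr.
by rewrite ger0_norm ?sqr_ge0// lerXn2r ?nnegrE ?normc_ge0.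
Qed.

Lemma L2_Z c f : L2 f -> L2 (fun w => c * f w).
Proof.
move=> /L2P[mf hf]; apply/L2P; split.
  by apply: cmeasurableM => //; exact: cmeasurable_cst.
by under eq_fun do rewrite normcM exprMn; exact: rintegrableZ.
Qed.

Lemma L2_D f g : L2 f -> L2 g -> L2 (fun w => f w + g w).
Proof.
move=> /L2P[mf hf] /L2P[mg hg]; apply/L2P; split; first exact: cmeasurableD.
apply: (rintegrable_le _ (rintegrableZ 2 (rintegrableD hf hg))) => [|w].
  by apply: cmeasurable_sqr; exact: cmeasurableD.
rewrite ger0_norm ?sqr_ge0//.
have h : normc (f w + g w) ^+ 2 <= (normc (f w) + normc (g w)) ^+ 2.
  by rewrite lerXn2r ?nnegrE ?normc_ge0 ?addr_ge0 ?normc_ge0// ler_normcD.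
apply: (le_trans h); have := sqr_ge0 (normc (f w) - normc (g w)); rewrite sqrrB sqrrD.
move: (normc _) (normc _) => a b; lra.
Qed.

Lemma L2_B f g : L2 f -> L2 g -> L2 (fun w => f w - g w).
Proof.
move=> hf hg; have := L2_D hf (L2_Z (-1) hg).
by under eq_fun do rewrite mulN1r.
Qed.

Lemma L2_0 : L2 (fun=> 0 : R[i]).
Proof.
apply/L2P; split; first exact: cmeasurable_cst.
under eq_fun do rewrite normc0 expr0n/=.
exact: integrable0.
Qed.

Lemma L2_sum (I : Type) (s : seq I) (f_ : I -> R[i] -> R[i]) :
  (forall i, L2 (f_ i)) -> L2 (fun w => \sum_(i <- s) f_ i w).
Proof.
move=> cf; elim: s => [|i s IH].
  by under eq_fun do rewrite big_nil; exact: L2_0.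
by under eq_fun do rewrite big_cons; exact: L2_D.
Qed.

Lemma L2_conj f : L2 f -> L2 (fun w => conjc (f w)).
Proof.
move=> hf; apply: (L2_le _ hf) => [|w]; last by rewrite normc_conj.
by apply: cmeasurable_conj; exact: L2_measurable.
Qed.

(* Young's inequality [2 a b <= t a^2 + b^2 / t] replaces Cauchy-Schwarz. *)
Lemma normc_cintegralM_le f g (t : R) : 0 < t -> L2 f -> L2 g ->
  normc (cintegral (fun w => f w * g w)) <= t * n2 f + t^-1 * n2 g.
Proof.
move=> t0 hf hg; apply: (le_trans (normc_cintegral_le (L2_mul hf hg))).
rewrite -rintegralZ; last by under eq_fun do rewrite normcM; exact: L2_mul_rintegrable.
have [[mf if_] [mg ig]] := ((L2P f).1 hf, (L2P g).1 hg).
rewrite -(rintegralZ _ if_) -(rintegralZ _ ig) -rintegralD; try exact: rintegrableZ.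
apply: rintegral_le => [||w].
- by apply: rintegrableZ; under eq_fun do rewrite normcM; exact: L2_mul_rintegrable.
- by apply: rintegrableD; exact: rintegrableZ.
- rewrite normcM; move: (normc (f w)) (normc (g w)) => a b.
  have := sqr_ge0 (t * a - b); rewrite -(pmulr_rge0 _ (x := t^-1)) ?invr_gt0//.
  have -> : t^-1 * (t * a - b) ^+ 2 = t * a ^+ 2 + t^-1 * b ^+ 2 - 2 * (a * b).
    by field; rewrite gt_eqF.
  by rewrite subr_ge0.
Qed.

Definition ip f g : R[i] := cintegral (fun w => f w * conjc (g w)).

Lemma ip_self f : L2 f -> ip f f = (n2 f)%:C%C.
Proof.
move=> hf; have E w : f w * conjc (f w) = (normc (f w) ^+ 2)%:C%C.
  case: (f w) => a b; apply: eq_ReIm; rewrite ?cReM ?cImM/=; last by ring.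
  by rewrite sqr_sqrtr ?addr_ge0 ?sqr_ge0//; ring.
rewrite /ip; under eq_fun do rewrite E.
apply: eq_ReIm => //=.
by rewrite Rintegral_cst// mul0r.
Qed.

Lemma ip_conj f g : L2 f -> L2 g -> ip f g = conjc (ip g f).
Proof.
move=> hf hg; rewrite /ip -cintegral_conj; last exact: (L2_mul hg (L2_conj hf)).
by congr cintegral; apply/funext => w; rewrite rmorphM/= conjcK mulrC.
Qed.

Lemma ipBl f g h : L2 f -> L2 g -> L2 h -> ip (fun w => f w - g w) h = ip f h - ip g h.
Proof.
move=> hf hg hh; rewrite /ip -cintegralB; [|exact: (L2_mul hf (L2_conj hh))|exact: (L2_mul hg (L2_conj hh))].
by congr cintegral; apply/funext => w; rewrite mulrBl.
Qed.

Lemma ipZl c f h : L2 f -> L2 h -> ip (fun w => c * f w) h = c * ip f h.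
Proof.
move=> hf hh; rewrite /ip -cintegralZ; last exact: (L2_mul hf (L2_conj hh)).
by congr cintegral; apply/funext => w; rewrite mulrA.
Qed.

Lemma ip_suml (I : Type) (s : seq I) (f_ : I -> R[i] -> R[i]) h :
  (forall i, L2 (f_ i)) -> L2 h ->
  ip (fun w => \sum_(i <- s) f_ i w) h = \sum_(i <- s) ip (f_ i) h.
Proof.
move=> hf hh; rewrite /ip -cintegral_sum; last by move=> i; exact: (L2_mul (hf i) (L2_conj hh)).
by congr cintegral; apply/funext => w; rewrite mulr_suml.
Qed.

Lemma n2B f g : L2 f -> L2 g ->
  n2 (fun w => f w - g w) = n2 f + n2 g - 2 * complex.Re (ip f g).
Proof.
move=> hf hg.
have iff_ := L2_rintegrable hf; have igg := L2_rintegrable hg.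
have ifg : rintegrable (fun w => complex.Re (f w * conjc (g w))).
  by case: (L2_mul hf (L2_conj hg)).
rewrite /n2 -(rintegralD iff_ igg) -(rintegralZ 2 ifg).
rewrite -rintegralB; [|exact: rintegrableD|exact: rintegrableZ].
congr rintegral; apply/funext => w.
case: (f w) (g w) => [a b] [c d]; rewrite !normc_sqr !(cReD, cImD, cReN, cImN, cReM) /=; ring.
Qed.

End L2_functions.

Section exponentially_bounded.
Variable R : realType.
Implicit Types (f g : R[i] -> R[i]) (c : R[i]).

(** The l^1-norm of the plane, comparable with [normc]; its exponential factors over the two
    coordinates, as [integral_gauss2_expR_abs] requires. *)
Definition onorm (w : R[i]) : R := `|complex.Re w| + `|complex.Im w|.

Lemma onorm_ge0 w : 0 <= onorm w. Proof. by rewrite addr_ge0. Qed.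

Lemma rintegrable_onorm (C c : R) : rintegrable (fun w => C * expR (c * onorm w)).
Proof.
apply: rintegrableZ; apply: rintegrableP.
- apply: measurableT_comp => //; apply: measurable_funM => //.
  by rewrite /onorm/=; apply: measurable_funD; apply: measurableT_comp.
- by move=> w; rewrite expR_ge0.
- exact: integral_gauss2_expR_abs.
Qed.

(** An algebra inside L^2(mu), stable under conjugation, that contains the polynomials in w and
    conj(w) and the exponential kernels; it settles integrability once for all of them. *)
Definition expbd f := cmeasurable f /\ exists2 C : R, 0 <= C & exists2 c : R, 0 <= c &
  forall w, normc (f w) <= C * expR (c * onorm w).

Lemma expbd_L2 f : expbd f -> L2 f.
Proof.
move=> [mf [C C0 [c c0 H]]]; apply/L2P; split=> //.
apply: (rintegrable_le _ (rintegrable_onorm (C ^+ 2) (2 * c))) => [|w].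
  exact: cmeasurable_sqr.
rewrite ger0_norm ?sqr_ge0// -mulrA mulr_natl mulr2n expRD -expr2 -exprMn.
by rewrite lerXn2r ?nnegrE ?normc_ge0 ?mulr_ge0 ?expR_ge0.
Qed.

Lemma expbd_cst c : expbd (fun=> c).
Proof.
split; first exact: cmeasurable_cst.
exists (normc c); first exact: normc_ge0.
by exists 0 => // w; rewrite mul0r expR0 mulr1.
Qed.

Lemma expbdM f g : expbd f -> expbd g -> expbd (fun w => f w * g w).
Proof.
move=> [mf [C C0 [c c0 H]]] [mg [C' C'0 [c' c'0 H']]].
split; first exact: cmeasurableM.
exists (C * C'); first exact: mulr_ge0.
exists (c + c') => [|w]; first exact: addr_ge0.
by rewrite normcM mulrDl expRD mulrACA ler_pM ?normc_ge0.
Qed.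

Lemma expbdD f g : expbd f -> expbd g -> expbd (fun w => f w + g w).
Proof.
move=> [mf [C C0 [c c0 H]]] [mg [C' C'0 [c' c'0 H']]].
split; first exact: cmeasurableD.
exists (C + C'); first exact: addr_ge0.
exists (c + c') => [|w]; first exact: addr_ge0.
apply: (le_trans (ler_normcD _ _)); rewrite mulrDl lerD//.
  by rewrite (le_trans (H w))// ler_wpM2l// ler_expR ler_wpM2r ?onorm_ge0// lerDl.
by rewrite (le_trans (H' w))// ler_wpM2l// ler_expR ler_wpM2r ?onorm_ge0// lerDr.
Qed.

Lemma expbdX f n : expbd f -> expbd (fun w => f w ^+ n).
Proof.
move=> hf; elim: n => [|n IH].
  by under eq_fun do rewrite expr0; exact: expbd_cst.
by under eq_fun do rewrite exprS; exact: expbdM.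
Qed.

Lemma expbd_conj f : expbd f -> expbd (fun w => conjc (f w)).
Proof.
move=> [mf [C C0 [c c0 H]]]; split; first exact: cmeasurable_conj.
by exists C => //; exists c => // w; rewrite normc_conj.
Qed.

Lemma expbd_id : expbd id.
Proof.
split; first by split; [exact: measurable_fst|exact: measurable_snd].
exists 1 => //; exists 1 => // w; rewrite !mul1r.
rewrite (le_trans (normc_le_ReIm _))// (le_trans _ (expR_ge1Dx _))//.
by rewrite lerDr.
Qed.

Lemma expbd_cexp (z : R[i]) : expbd (fun w => cexp (z * w)).
Proof.
split.
  apply: centire_cmeasurable.
  have := centire_comp (@centire_affine R 0 z) (@centire_cexp R).
  by under eq_fun do rewrite add0r.
exists 1 => //; exists (normc z); first exact: normc_ge0.
move=> w; rewrite mul1r (le_trans (normc_cexp_le _))// ler_expR normcM.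
by rewrite ler_wpM2l ?normc_ge0// normc_le_ReIm.
Qed.

Lemma conjc_cexp (z : R[i]) : conjc (cexp z) = cexp (conjc z).
Proof. by case: z => a b; rewrite /cexp/= cosN sinN mulrN. Qed.

Lemma expbd_cexp_conj (z : R[i]) : expbd (fun w => cexp (z * conjc w)).
Proof.
have := expbd_conj (expbd_cexp (conjc z)).
by under eq_fun do rewrite conjc_cexp rmorphM/= conjcK.
Qed.

(** The dominating function for expanding kernels against an arbitrary [f] of L^2(mu). *)
Lemma rintegrable_expR_normc f (c : R) : L2 f -> 0 <= c ->
  rintegrable (fun w => normc (f w) * expR (c * normc w)).
Proof.
move=> hf c0; pose g w := ((expR (c * normc w))%:C%C : R[i]).
have nE w : normc (g w) = expR (c * normc w).
  by rewrite normcR ger0_norm ?expR_ge0.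
have hg : L2 g.
  apply: expbd_L2; split.
    split=> /=; last exact: measurable_cst.
    apply: measurableT_comp => //; apply: measurable_funM => //.
    by apply: (@cmeasurable_normc R id); case: expbd_id.
  exists 1 => //; exists c => // w; rewrite nE mul1r ler_expR ler_wpM2l//.
  exact: normc_le_ReIm.
by have := L2_mul_rintegrable hf hg; under eq_fun do rewrite nE.
Qed.

End exponentially_bounded.

(** * Reproducing property of the Fock space *)

Section gauss_mean.
Variable R : realType.
Implicit Types (f g h : R[i] -> R[i]) (F : R[i] -> R) (w z c : R[i]).

Lemma mul_cexp_rot (p : plane R) (t : R) :
  toC p * cexp (Complex 0 t) = toC (rotp (cos t) (sin t) p).
Proof.
rewrite /toC /rotp /cexp/=; apply: eq_ReIm; rewrite ?cReM ?cImM/= expR0 !mul1r//.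
Qed.

Lemma rintegral_rot F (t : R) : rmeasurable F ->
  rintegral (fun w => F (w * cexp (Complex 0 t))) = rintegral F.
Proof.
move=> mF; rewrite /rintegral /Rintegral; congr fine.
rewrite -(@integral_gauss2_rot R (cos t) (sin t) (fun p => (F (toC p))%:E)).
- by apply: eq_integral => p _; rewrite mul_cexp_rot.
- exact: cos2Dsin2.
- exact/measurable_EFinP.
Qed.

(** The function g(w e^(it)) is integrated over [0, 2 pi] and the plane in both orders: w first
    gives 2 pi times the Gaussian mean, by rotation invariance; t first gives 2 pi times the value
    at 0, by [circle_mean_Re]. *)
Lemma gauss_mean_Re g : centire g -> cintegrable g ->
  rintegral (fun w => complex.Re (g w)) = complex.Re (g 0).
Proof.
move=> cg [ig _].
pose G (p : plane R) := complex.Re (g (toC p)).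
have mG : measurable_fun setT G by case: (centire_cmeasurable cg).
pose T : R := 2 * pi.
have T0 : 0 < T by rewrite mulr_gt0 ?pi_gt0.
pose I : set (measurableTypeR R) := `[0, T]%classic.
pose F (q : measurableTypeR R * plane R) : \bar R :=
  (\1_I q.1 * G (rotp (cos q.1) (sin q.1) q.2))%:E.
have mF : measurable_fun setT F.
  apply/measurable_EFinP; apply: measurable_funM.
    have mI1 : measurable_fun setT (\1_I : measurableTypeR R -> R).
      by apply: measurable_indic; exact: measurable_itv.
    exact: (measurableT_comp mI1 measurable_fst).
  apply: (measurableT_comp mG).
  have mc : measurable_fun setT (fun q : measurableTypeR R * plane R => cos q.1).
    exact: (measurableT_comp (continuous_measurable_fun (@continuous_cos R)) measurable_fst).
  have ms : measurable_fun setT (fun q : measurableTypeR R * plane R => sin q.1).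
    exact: (measurableT_comp (continuous_measurable_fun (@continuous_sin R)) measurable_fst).
  have m1 : measurable_fun setT (fun q : measurableTypeR R * plane R => q.2.1).
    exact: (measurableT_comp measurable_fst measurable_snd).
  have m2 : measurable_fun setT (fun q : measurableTypeR R * plane R => q.2.2).
    exact: (measurableT_comp measurable_snd measurable_snd).
  apply: measurable_fun_pair => /=.
    by apply: measurable_funB; exact: measurable_funM.
  by apply: measurable_funD; exact: measurable_funM.
have mGe : measurable_fun setT (fun p => (G p)%:E) by exact/measurable_EFinP.
have mGa : measurable_fun setT (fun p => `|(G p)%:E|%E) by exact: measurableT_comp.
have absG (t : R) : (\int[mu R]_p `|F (t, p)| = (\1_I t)%:E * \int[mu R]_p `|(G p)%:E|)%E.
  rewrite -(@ge0_integralZl_EFin _ _ R (mu R) setT measurableT _ (fun p _ => abse_ge0 _) mGa)//.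
  rewrite -(@integral_gauss2_rot R (cos t) (sin t) (fun p => (\1_I t)%:E * `|(G p)%:E|)%E).
  - by apply: eq_integral => p _; rewrite /F/= normrM ger0_norm.
  - exact: cos2Dsin2.
  - by apply: emeasurable_funM => //; exact: measurable_cst.
have intG (t : R) : (\int[mu R]_p F (t, p) = (\1_I t)%:E * \int[mu R]_p (G p)%:E)%E.
  rewrite -integralZl//.
  rewrite -(@integral_gauss2_rot R (cos t) (sin t) (fun p => (\1_I t)%:E * (G p)%:E)%E).
  - by apply: eq_integral => p _; rewrite /F/= EFinM.
  - exact: cos2Dsin2.
  - by apply: emeasurable_funM => //; exact: measurable_cst.
have II : (\int[@lebesgue_measure R]_t (\1_I t)%:E = T%:E)%E.
  rewrite integral_indic//; last exact: measurable_itv.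
  by rewrite setIT/= /I lebesgue_measure_itv/= lte_fin T0 sube0.
have mI : measurable_fun setT (fun t : measurableTypeR R => (\1_I t : R)%:E).
  by apply/measurable_EFinP; apply: measurable_indic; exact: measurable_itv.
have iF : (@lebesgue_measure R \x mu R)%E.-integrable setT F.
  apply/(@integrable12ltyP _ _ _ _ R lebesgue_measure (mu R) F mF).
  under eq_integral do rewrite absG.
  rewrite ge0_integralZr//; last exact: integral_ge0.
  rewrite II; have /integrableP[_ h] := ig.
  have : (\int[mu R]_p `|(G p)%:E| \is a fin_num)%E.
    by rewrite ge0_fin_numE//; exact: integral_ge0.
  by move=> /fineK <-; rewrite -EFinM ltry.
have := Fubini iF.
under [X in X = _ -> _]eq_integral do rewrite intG.
have fG : (\int[mu R]_p (G p)%:E = (rintegral (fun w => complex.Re (g w)))%:E)%E.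
  exact: rintegralE.
rewrite fG integralZr//; last first.
  apply/integrableP; split => //.
  by under eq_integral do rewrite gee0_abs ?lee_fin//; rewrite II ltry.
rewrite II.
have -> : (\int[mu R]_y \int[@lebesgue_measure R]_x F (x, y) = \int[mu R]_y (T * complex.Re (g 0))%:E)%E.
  apply: eq_integral => p _.
  have := @circle_mean_Re R g (toC p) cg; rewrite -/T => h.
  rewrite -h /Ri /Rintegral fineK; last first.
    apply: integrable_fin_num => //.
    apply: (@continuous_Ri_integrable R (fun t => complex.Re (g (toC p * cexp (Complex 0 t))))).
    apply: (@centire_Re_continuous R (fun z => g (toC p * cexp z)) 0).
    have := centire_comp (centire_comp (@centire_cexp R) (@centire_affine R 0 (toC p))) cg.
    by under eq_fun do rewrite add0r.
  rewrite [RHS]integral_mkcond; apply: eq_integral => t _.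
  rewrite patchE /F/= indicE mul_cexp_rot /G.
  by case: ifPn => ht; rewrite ?mul1r ?mul0r.
rewrite integral_cst//= gauss2_setT mule1 -EFinM => -[].
by move/(mulfI (lt0r_neq0 T0)).
Qed.

(** The imaginary part of [g] is the real part of the entire function - i g. *)
Lemma cintegrable_entire_mean g : centire g -> cintegrable g -> cintegral g = g 0.
Proof.
move=> cg ig; apply: eq_ReIm => /=; first exact: gauss_mean_Re.
pose g' w := 0 + (- 'i%C) * g w.
have cg' : centire g' by exact: (centire_comp cg (@centire_affine R 0 (- 'i%C))).
have E w : complex.Re (g' w) = complex.Im (g w).
  by rewrite /g' add0r; case: (g w) => a b; rewrite cReM/= !oppr0; ring.
have ig' : cintegrable g'.
  by rewrite /g'; under eq_fun do rewrite add0r; exact: cintegrableZ.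
by have := gauss_mean_Re cg' ig'; rewrite /rintegral; under eq_Rintegral do rewrite E; rewrite E.
Qed.

(** The exponential factor is the quotient of the Gaussian densities at p + z and at p; translating
    the plane is done by two shears with constant offset. *)
Lemma ge0_integral_gauss2_translate (z : R[i]) (F : plane R -> \bar R) :
  measurable_fun setT F -> (forall p, (0 <= F p)%E) ->
  (\int[mu R]_p (F (p.1 + complex.Re z, p.2 + complex.Im z)%R *
     (expR (- 2 * (p.1 * complex.Re z + p.2 * complex.Im z) - normc z ^+ 2))%:E) =
   \int[mu R]_p F p)%E.
Proof.
case: z => a b /= mF F0.
have msh : measurable_fun setT (fun p : plane R => ((p.1 + a, p.2 + b)%R : plane R)).
  by apply: measurable_fun_pair => /=; apply: measurable_funD.
rewrite ge0_integral_gauss2; last 2 first.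
- apply: emeasurable_funM; first exact: (measurableT_comp mF msh).
  apply/measurable_EFinP; apply: measurableT_comp => //; apply: measurable_funB => //.
  by apply: measurable_funM => //; apply: measurable_funD; apply: measurable_funM.
- by move=> p; rewrite mule_ge0// lee_fin expR_ge0.
rewrite (ge0_integral_gauss2 mF F0).
pose H p := (F p * (gauss_density (toC p))%:E)%E.
have mH : measurable_fun setT H.
  by apply: emeasurable_funM => //; apply/measurable_EFinP; exact: measurable_gauss_density.
have H0 p : (0 <= H p)%E by rewrite mule_ge0// lee_fin gauss_density_ge0.
have mH1 : measurable_fun setT (fun p : plane R => H (p.1 + a, p.2)%R).
  apply: (measurableT_comp mH).
  by apply: measurable_fun_pair => //=; apply: measurable_funD.
rewrite -(@ge0_integral_shear1 R H (fun=> a) (measurable_cst _) mH H0).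
rewrite -(@ge0_integral_shear2 R (fun p => H (p.1 + a, p.2)%R) (fun=> b) (measurable_cst _) mH1
  (fun p => H0 _)).
apply: eq_integral => -[x y] _; rewrite /H /= !gauss_densityE/= -muleA -EFinM; congr (_ * _%:E)%E.
rewrite sqr_sqrtr ?addr_ge0 ?sqr_ge0// mulrCA -expRD; congr (_ * expR _); ring.
Qed.

Lemma rintegral_translate (z : R[i]) F : rintegrable F ->
  let F' w := F (z + w) * expR (- 2 * complex.Re (conjc z * w) - normc z ^+ 2) in
  rintegrable F' /\ rintegral F' = rintegral F.
Proof.
move=> iF F'.
have tE (p : plane R) : z + toC p = toC (p.1 + complex.Re z, p.2 + complex.Im z).
  by rewrite /toC; case: z {F'} => a b; apply: eq_ReIm; rewrite ?cReD ?cImD/= addrC.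
have kE (p : plane R) : complex.Re (conjc z * toC p) = p.1 * complex.Re z + p.2 * complex.Im z.
  by rewrite cReM /toC; case: z {F' tE} => a b /=; ring.
have pos G : rintegrable G -> (forall w, 0 <= G w) ->
    let G' w := G (z + w) * expR (- 2 * complex.Re (conjc z * w) - normc z ^+ 2) in
    rintegrable G' /\ rintegral G' = rintegral G.
  move=> iG G0 G'; have mG := rintegrable_measurable iG.
  have h := @ge0_integral_gauss2_translate z (fun p => (G (toC p))%:E).
  have {}h : (\int[mu R]_p (G' (toC p))%:E = \int[mu R]_p (G (toC p))%:E)%E.
    rewrite -h; last 2 first.
    - exact/measurable_EFinP.
    - by move=> p; rewrite lee_fin.
    by apply: eq_integral => p _; rewrite /G' EFinM kE tE.
  have mG' : rmeasurable G'.
    apply: measurable_funM.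
      rewrite (_ : (fun p => _) = (fun p : plane R => G (toC p)) \o (fun p : plane R => (p.1 + complex.Re z, p.2 + complex.Im z))).
        apply: measurableT_comp => //.
        by apply: measurable_fun_pair => /=; apply: measurable_funD.
      by apply/funext => p /=; rewrite tE.
    apply: measurableT_comp => //; apply: measurable_funB => //.
    under eq_fun do rewrite kE.
    by apply: measurable_funM => //; apply: measurable_funD; apply: measurable_funM.
  have iG' : rintegrable G'.
    apply: rintegrableP => //; first by move=> w; rewrite mulr_ge0 ?expR_ge0.
    by rewrite h (rintegralE iG) ltry.
  split=> //; apply: EFin_inj.
  by rewrite -(rintegralE iG') -(rintegralE iG).
(* A signed [F] is the difference of the nonnegative functions |F| + F and |F|. *)
have iaF : rintegrable (fun w => `|F w|) by exact: integrable_norm.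
have [i1 e1] := pos _ iaF (fun w => normr_ge0 _).
have iaF2 := rintegrableD iaF iF.
have [i2 e2] := pos _ iaF2 (fun w => ltac:(by rewrite -lerBlDr sub0r -normrN ler_norm)).
have E : F' = (fun w => (fun w => (`|F (z + w)| + F (z + w)) * expR (- 2 * complex.Re (conjc z * w) - normc z ^+ 2)) w -
     (fun w => `|F (z + w)| * expR (- 2 * complex.Re (conjc z * w) - normc z ^+ 2)) w).
  by apply/funext => w /=; rewrite -mulrBl addrAC subrr add0r.
rewrite E; split; first exact: rintegrableB.
by rewrite (rintegralB i2 i1) e1 e2 (rintegralD iaF iF) addrAC subrr add0r.
Qed.

(* Translating by [z] turns [h w * exp (z * conj w)] into the entire function
   [h (z + w) * exp (- conj z * w)], whose Gaussian mean is its value at [0]. *)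
Lemma fock_reproducing h z : centire h -> L2 h ->
  cintegral (fun w => h w * cexp (z * conjc w)) = h z.
Proof.
move=> ch hL; pose f w := h w * cexp (z * conjc w).
have cf : cintegrable f by exact: (L2_mul hL (expbd_L2 (expbd_cexp_conj z))).
pose g w := h (z + 1 * w) * cexp (0 + (- conjc z) * w).
have cg : centire g.
  apply: centire_mul; first exact: (centire_comp (centire_affine z 1) ch).
  exact: (centire_comp (centire_affine 0 (- conjc z)) (@centire_cexp R)).
pose k w : R := expR (- 2 * complex.Re (conjc z * w) - normc z ^+ 2).
have E w : g w = f (z + w) * (k w)%:C%C.
  rewrite /g /f mul1r add0r -mulrA; congr (_ * _).
  have -> : (k w)%:C%C = cexp ((- 2 * complex.Re (conjc z * w) - normc z ^+ 2)%:C%C).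
    by rewrite /cexp/= cos0 sin0 mulr1 mulr0.
  rewrite -cexpD; congr cexp.
  case: z w {f cf g cg k} => [a b] [c d].
  apply: eq_ReIm; rewrite !(cReD, cImD, cReM, cImM) /= ?sqr_sqrtr ?addr_ge0 ?sqr_ge0//; ring.
have [f1 f2] := cf.
have [i1 e1] := rintegral_translate z (F := fun w => complex.Re (f w)) f1.
have [i2 e2] := rintegral_translate z (F := fun w => complex.Im (f w)) f2.
have ER w : complex.Re (g w) = complex.Re (f (z + w)) * k w.
  by rewrite E cReM /= mulr0 subr0.
have EI w : complex.Im (g w) = complex.Im (f (z + w)) * k w.
  by rewrite E cImM /= mulr0 add0r.
have ig : cintegrable g.
  split; first by under eq_fun do rewrite ER; exact: i1.
  by under eq_fun do rewrite EI; exact: i2.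
have := cintegrable_entire_mean cg ig.
rewrite {2}/g mulr0 addr0 mulr0 addr0 cexp0 mulr1 => <-.
apply: eq_ReIm => /=.
  by under [RHS]eq_Rintegral do rewrite ER; rewrite -[LHS]e1.
by under [RHS]eq_Rintegral do rewrite EI; rewrite -[LHS]e2.
Qed.

End gauss_mean.

(** * Moments and complex Hermite polynomials *)

Section moments.
Variable R : realType.
Implicit Types (f g h : R[i] -> R[i]) (w z c : R[i]).

Lemma cintegral_rot f (t : R) : cmeasurable f ->
  cintegral (fun w => f (w * cexp (Complex 0 t))) = cintegral f.
Proof.
move=> [m1 m2]; apply: eq_ReIm => /=.
  exact: (@rintegral_rot R (fun w => complex.Re (f w)) t m1).
exact: (@rintegral_rot R (fun w => complex.Im (f w)) t m2).
Qed.

Definition mono a b w : R[i] := w ^+ a * conjc w ^+ b.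

Lemma expbd_mono a b : expbd (mono a b).
Proof. by apply: expbdM; apply: expbdX; [exact: expbd_id|exact: expbd_conj (expbd_id R)]. Qed.

Lemma L2_mul_expbd f g : L2 f -> expbd g -> cintegrable (fun w => f w * g w).
Proof. by move=> hf hg; exact: L2_mul hf (expbd_L2 hg). Qed.

Lemma expbd_cintegrable f : expbd f -> cintegrable f.
Proof.
move=> hf; have := L2_mul_expbd (expbd_L2 hf) (expbd_cst 1).
by under eq_fun do rewrite mulr1.
Qed.

Lemma cexpX z n : cexp z ^+ n = cexp (n%:R * z).
Proof.
elim: n => [|n IH]; first by rewrite expr0 mul0r cexp0.
by rewrite exprS IH -cexpD -natr1 mulrDl mul1r addrC.
Qed.

(** The rotation by the angle pi / (a - b) multiplies the monomial by e^(i pi) = -1 and leaves its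
    integral unchanged. *)
Lemma moment_neq a b : a != b -> cintegral (mono a b) = 0.
Proof.
move=> ab; pose d : R := a%:R - b%:R.
have d0 : d != 0 by rewrite subr_eq0 eqr_nat.
pose u := cexp (Complex 0 (pi / d)).
have uE : u ^+ a * conjc u ^+ b = -1.
  rewrite conjc_cexp !cexpX -cexpD.
  have -> : a%:R * Complex 0 (pi / d) + b%:R * conjc (Complex 0 (pi / d)) = Complex 0 pi.
    rewrite -!(rmorph_nat (real_complex R)).
    apply: eq_ReIm; rewrite !(cReD, cImD, cReM, cImM)/=; first by ring.
    rewrite !mul0r !addr0 mulrN -mulrBl -/d mulrC divfK//.
  by rewrite /cexp/= expR0 cospi sinpi !mul1r; apply: eq_ReIm; rewrite /= ?oppr0.
have := cintegral_rot (pi / d) (expbd_mono a b).1.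
have -> : (fun w => mono a b (w * cexp (Complex 0 (pi / d)))) = (fun w => -1 * mono a b w).
  apply/funext => w; rewrite -uE /mono rmorphM/= !exprMn -/u.
  by rewrite mulrACA mulrC.
rewrite cintegralZ; last exact: expbd_cintegrable (expbd_mono a b).
rewrite mulN1r => /eqP; rewrite eq_sym -subr_eq0 opprK -mulr2n -mulr_natr mulf_eq0 pnatr_eq0 orbF.
by move/eqP.
Qed.

(** By [fock_series], the m-th Taylor coefficient of an entire [h] in L^2(mu), written as a scalar
    product with the monomial w^m. *)
Definition fock_coef h m : R[i] := cintegral (fun w => h w * conjc w ^+ m) / m`!%:R.

Lemma fock_series h z : centire h -> L2 h ->
  ((fun N => \sum_(0 <= m < N) fock_coef h m * z ^+ m) : nat -> R[i]^o) @ \oo --> (h z : R[i]^o).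
Proof.
move=> ch hL; rewrite -(fock_reproducing z ch hL).
have key := @cintegral_cvg R (fun N w => h w * expS N (z * conjc w))
  (fun w => h w * cexp (z * conjc w)) (fun w => normc (h w) * expR (normc z * normc w)).
have cX n : expbd (fun w => conjc w ^+ n) by apply: expbdX; exact: expbd_conj (expbd_id R).
case: key.
- move=> N; apply: cmeasurableM; first exact: L2_measurable.
  rewrite /expS; elim: N => [|N IH].
    by under eq_fun do rewrite big_geq//; exact: cmeasurable_cst.
  under eq_fun do rewrite big_nat_recr//=.
  apply: cmeasurableD => //; apply: cmeasurableM; last exact: cmeasurable_cst.
  under eq_fun do rewrite exprMn; apply: cmeasurableM; first exact: cmeasurable_cst.
  by case: (cX N).
- by apply: rintegrable_expR_normc => //; exact: normc_ge0.
- move=> N w; rewrite normcM ler_wpM2l ?normc_ge0// (le_trans (normc_expS _ _))//.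
  by rewrite normcM normc_conj.
- move=> w; apply: (@cvgM R[i]); first exact: cvg_cst.
  exact: cexp_cvg.
move=> _; rewrite (_ : (fun N => cintegral _) = (fun N => \sum_(0 <= m < N) fock_coef h m * z ^+ m))//.
apply/funext => N.
have E w : h w * expS N (z * conjc w) = \sum_(m <- index_iota 0 N) (z ^+ m / m`!%:R) * (h w * conjc w ^+ m).
  rewrite /expS mulr_sumr; apply: eq_bigr => m _; rewrite exprMn; ring.
under eq_fun do rewrite E.
have im m : cintegrable (fun w => h w * conjc w ^+ m) by exact: L2_mul_expbd.
rewrite cintegral_sum; last by move=> m; exact: cintegrableZ.
apply: eq_bigr => m _; rewrite cintegralZ// /fock_coef; ring.
Qed.

(** In the expansion of w^a at the point 1 only the term m = a survives, by [moment_neq]; it must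
    equal 1, so the moment is a!. *)
Lemma moment_eq a : cintegral (mono a a) = a`!%:R.
Proof.
have aL : L2 (fun w : R[i] => w ^+ a) by apply: expbd_L2; apply: expbdX; exact: expbd_id.
have := @fock_series _ 1 (@centire_expr R a) aL; rewrite expr1n.
have E N : (a < N)%N -> \sum_(0 <= m < N) fock_coef (fun w => w ^+ a) m * 1 ^+ m =
    cintegral (mono a a) / a`!%:R.
  move=> aN; rewrite (bigD1_seq a) ?mem_index_iota ?iota_uniq//= expr1n mulr1.
  rewrite big1 ?addr0// => m ma.
  by rewrite /fock_coef -/(mono a m) moment_neq ?mul0r// eq_sym.
move=> h.
have h2 : ((fun N => \sum_(0 <= m < N) fock_coef (fun w => w ^+ a) m * 1 ^+ m) : nat -> R[i]^o) @ \oo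
    --> (cintegral (mono a a) / a`!%:R : R[i]^o).
  by apply: cvg_near_cst; exists a.+1 => // N /= aN; apply: E.
have e := cvgc_unique h2 h.
have f0 : (a`!%:R : R[i]) != 0 by rewrite pnatr_eq0 -lt0n fact_gt0.
by rewrite -[LHS](divfK f0) e mul1r.
Qed.

Lemma momentE a b : cintegral (mono a b) = ((a == b) * a`!)%N%:R.
Proof.
have [->|ab] := eqVneq a b; first by rewrite mul1n moment_eq.
by rewrite mul0n moment_neq.
Qed.

End moments.

Section hermite.
Variable R : realType.
Implicit Types (w z : R[i]).

(* Complex Hermite polynomials [H_{m,n}] of Ito, with the index [n] of the
   holomorphic variable first; [herm n m w] is the coefficient of [z^m / m!]
   in [(w - z)^n * exp (z * conj w)]. *)
Fixpoint herm (n m : nat) w : R[i] :=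
  if n is n'.+1 then w * herm n' m w - m%:R * herm n' m.-1 w else conjc w ^+ m.

Lemma expbd_herm n m : expbd (herm n m).
Proof.
elim: n m => [|n IH] m /=.
  by apply: expbdX; exact: expbd_conj (expbd_id R).
have := expbdD (expbdM (expbd_id R) (IH m)) (expbdM (expbd_cst (- m%:R)) (IH m.-1)).
by under eq_fun do rewrite mulNr.
Qed.

(** The recursion of [herm] produces (a+1)! b^_n - m a! b^_n = a! b^_n (a + 1 - m), and a + n + 1 =
    b + m turns the last factor into b - n, the next one of the falling factorial. *)
Lemma herm_moment a b m n : cintegral (fun w => mono a b w * herm n m w) =
  (((m <= a) && (a + n == b + m)) * (a`! * b ^_ n))%N%:R.
Proof.
elim: n a b m => [|n IH] a b m.
  rewrite (_ : (fun w => _) = mono a (b + m)); last first.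
    by apply/funext => w; rewrite /mono /= -mulrA -exprD.
  rewrite momentE ffactn0 muln1 addn0; case: eqP => [->|_]; last by rewrite andbF.
  by rewrite leq_addl.
have i a' b' m' : cintegrable (fun w => mono a' b' w * herm n m' w).
  by apply: expbd_cintegrable; apply: expbdM; [exact: expbd_mono|exact: expbd_herm].
transitivity (cintegral (fun w => mono a.+1 b w * herm n m w - m%:R * (mono a b w * herm n m.-1 w))).
  by congr cintegral; apply/funext => w; rewrite /mono /= exprS; ring.
rewrite cintegralB//; last exact: cintegrableZ.
rewrite cintegralZ// !IH -natrM.
have [E|NE] := eqVneq (a + n.+1)%N (b + m)%N; last first.
  rewrite andbF mul0n.
  have -> : (a.+1 + n == b + m)%N = false by apply/negbTE; rewrite addSnnS.
  rewrite andbF mul0n sub0r; case: m NE => [|m] NE /=; first by rewrite mul0n oppr0.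
  have -> : (a + n == b + m)%N = false.
    by apply/negbTE; move: NE; rewrite !addnS eqSS.
  by rewrite andbF mul0n muln0 oppr0.
rewrite andbT addSnnS E eqxx andbT.
(* Beyond a + 1 both terms vanish; at m = a + 1 they are equal and cancel, which restores the
   condition m <= a. *)
have [ma1|ma1] := leqP m a.+1; last first.
  have -> : (m <= a)%N = false by apply/negbTE; rewrite -ltnNge ltnW.
  have -> : (m.-1 <= a)%N = false by apply/negbTE; case: m ma1 {E} => //= m; rewrite -ltnNge ltnS.
  by rewrite !mul0n muln0 subr0.
have -> : (m * (((m.-1 <= a) && (a + n == b + m.-1)) * (a`! * b ^_ n)) = m * (a`! * b ^_ n))%N.
  case: m ma1 E => [|m] ma1 E /=; first by rewrite !mul0n.
  have -> : (a + n == b + m)%N by rewrite -eqSS -!addnS E.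
  by rewrite -ltnS ma1 mul1n.
rewrite mul1n factS -natrB; last by rewrite -mulnA leq_mul2r ma1 orbT.
rewrite -mulnA -mulnBl ffactnSr.
have [ma|ma] := leqP m a.
  have bn : (b - n = a.+1 - m)%N.
    by move: (congr1 (fun k => (k - n - m)%N) E); rewrite addnS; lia.
  by rewrite bn mul1n; congr _%:R; ring.
have -> : m = a.+1 by apply/eqP; rewrite eqn_leq ma1 ma.
by rewrite subnn !mul0n.
Qed.

(** The extra power conj(w)^b absorbs the factor released by unfolding conj([herm]), so that the
    induction on [n'] closes. The product to the left of [herm n m] has degree m' in w and n' + b in
    conj(w); the integral vanishes when one of them is too small. *)
Lemma herm_ip_aux n' b m' m n :
  ((m' < m)%N || (n' + b < n)%N ->
    cintegral (fun w => conjc (herm n' m' w) * conjc w ^+ b * herm n m w) = 0) /\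
  (m' = m -> (n' + b)%N = n ->
    cintegral (fun w => conjc (herm n' m' w) * conjc w ^+ b * herm n m w) = (m`! * n`!)%N%:R).
Proof.
elim: n' b m' => [|n' IH] b m'.
  rewrite (_ : (fun w => _) = (fun w => mono m' b w * herm n m w)); last first.
    by apply/funext => w; rewrite /mono /= rmorphXn/= conjcK.
  rewrite herm_moment add0n; split=> [/orP[h|h]|-> ->].
  - by rewrite leqNgt h.
  - by rewrite ffact_small// !muln0.
  - by rewrite leqnn addnC eqxx mul1n ffactnn.
have i b' m'' : cintegrable (fun w => conjc (herm n' m'' w) * conjc w ^+ b' * herm n m w).
  apply: expbd_cintegrable; apply: expbdM; last exact: expbd_herm.
  apply: expbdM; first by apply: expbd_conj; exact: expbd_herm.
  by apply: expbdX; exact: expbd_conj (expbd_id R).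
have -> : cintegral (fun w => conjc (herm n'.+1 m' w) * conjc w ^+ b * herm n m w) =
    cintegral (fun w => conjc (herm n' m' w) * conjc w ^+ b.+1 * herm n m w) -
    m'%:R * cintegral (fun w => conjc (herm n' m'.-1 w) * conjc w ^+ b * herm n m w).
  rewrite -cintegralZ// -cintegralB//; last exact: cintegrableZ.
  congr cintegral; apply/funext => w /=; rewrite rmorphB !rmorphM/= rmorph_nat exprS; ring.
have [h1 h2] := IH b.+1 m'; have [k1 k2] := IH b m'.-1.
split=> [h|mm nn].
- rewrite h1; last by rewrite addnS -addSn.
  rewrite k1 ?mulr0 ?subr0//; case/orP: h => h; apply/orP; [left|right].
    by rewrite (leq_ltn_trans (leq_pred _)).
  by rewrite (ltn_trans _ h).
- rewrite h2// ?addnS -?addSn//.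
  case: m' mm {h1 h2} k1 k2 => [|m'] mm k1 _; first by rewrite mul0r subr0.
  by rewrite k1 ?mulr0 ?subr0//= -mm ltnSn.
Qed.

Lemma herm_ip n' m' n m : cintegral (fun w => conjc (herm n' m' w) * herm n m w) =
  (((m' == m) && (n' == n)) * (m`! * n`!))%N%:R.
Proof.
have E k l k' l' : cintegral (fun w => conjc (herm k l w) * herm k' l' w) =
   cintegral (fun w => conjc (herm k l w) * conjc w ^+ 0 * herm k' l' w).
  by congr cintegral; apply/funext => w; rewrite expr0 mulr1.
have [h1 h2] := herm_ip_aux n' 0 m' m n.
have [k1 k2] := herm_ip_aux n 0 m m' n'.
have [/andP[/eqP mm /eqP nn]|h] := boolP ((m' == m) && (n' == n)).
  by rewrite E h2 ?mul1n// addn0.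
rewrite mul0n.
have [l|l] := boolP ((m' < m)%N || (n' < n)%N); first by rewrite E h1 ?addn0.
rewrite negb_or -!leqNgt in l; move/andP: l => [l1 l2].
(* Both indices on the left are now at least those on the right, one strictly; conjugation exchanges
   the roles. *)
have sw : cintegral (fun w => conjc (herm n' m' w) * herm n m w) =
    conjc (cintegral (fun w => conjc (herm n m w) * herm n' m' w)).
  rewrite -cintegral_conj; last first.
    apply: expbd_cintegrable; apply: expbdM; last exact: expbd_herm.
    by apply: expbd_conj; exact: expbd_herm.
  by congr cintegral; apply/funext => w; rewrite rmorphM/= conjcK mulrC.
rewrite sw E k1 ?rmorph0// addn0.
move: h; rewrite negb_and => /orP[h|h]; apply/orP; [left|right].
  by rewrite ltn_neqAle eq_sym h.
by rewrite ltn_neqAle eq_sym h.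
Qed.

Definition herm_series N n z w := \sum_(0 <= m < N) z ^+ m / m`!%:R * herm n m w.

(** Since m / m! = 1 / (m-1)!, the lowered term in the recursion of [herm] sums to z times the
    partial sum with one term fewer. *)
Lemma herm_series_rec N n z w : herm_series N n.+1 z w =
  w * herm_series N n z w - z * herm_series N.-1 n z w.
Proof.
rewrite /herm_series !mulr_sumr; case: N => [|N]; first by rewrite !big_geq// subrr.
rewrite /= [in RHS]big_nat_recl// big_nat_recl//= mul0r subr0 -addrA; congr (_ + _); first by ring.
rewrite -sumrB; apply: eq_bigr => m _ /=.
have ? : (m`!%:R : R[i]) != 0 by rewrite pnatr_eq0 -lt0n fact_gt0.
have ? : (m.+1%:R : R[i]) != 0 by rewrite pnatr_eq0.
rewrite factS natrM exprS; field; rewrite -?natr1.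
by apply/andP; split.
Qed.

(** Each step of the recursion costs a factor |w| + |z|; uniformity in [N] is what dominated
    convergence needs. *)
Lemma normc_herm_series N n z w :
  normc (herm_series N n z w) <= (normc w + normc z) ^+ n * expR (normc z * normc w).
Proof.
elim: n N => [|n IH] N.
  rewrite /herm_series /= expr0 mul1r -(normc_conj w) -normcM.
  rewrite (_ : \sum_(_ <= _ < _) _ = expS N (z * conjc w)) ?normc_expS//.
  by apply: eq_bigr => m _; rewrite exprMn; ring.
rewrite herm_series_rec (le_trans (ler_normcB _ _))// !normcM exprS -mulrA mulrDl.
by rewrite lerD// ler_wpM2l ?normc_ge0.
Qed.

Lemma herm_series_cvg n z w :
  ((fun N => herm_series N n z w) : nat -> R[i]^o) @ \oo -->
    ((w - z) ^+ n * cexp (z * conjc w) : R[i]^o).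
Proof.
elim: n => [|n IH].
  rewrite expr0 mul1r (_ : (fun N => _) = (fun N => expS N (z * conjc w))); first exact: cexp_cvg.
  by apply/funext => N; apply: eq_bigr => m _; rewrite /= exprMn; ring.
under eq_fun do rewrite herm_series_rec.
rewrite exprS -mulrA mulrBl; apply: (@cvgB _ (R[i]^o)).
  by apply: (@cvgM R[i]); [exact: cvg_cst|exact: IH].
apply: (@cvgM R[i]); first exact: cvg_cst.
rewrite -(cvg_shiftS (fun N => herm_series N.-1 n z w : R[i]^o)).
exact: IH.
Qed.

End hermite.

(** * The transform as a polyanalytic series; Riesz-Fischer *)

Section transform_expansion.
Variable R : realType.
Implicit Types (f : R[i] -> R[i]) (w z : R[i]).

(** The Fourier coefficient of [f] along conj([herm n m]), whose squared norm is m! n!. *)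
Definition hcoef f n m : R[i] :=
  cintegral (fun w => f w * herm n m w) / (m`!%:R * n`!%:R).

Definition fcoef f n z : R[i] :=
  cintegral (fun w => f w * ((w - z) ^+ n * cexp (z * conjc w))) / n`!%:R.

Lemma expbd_shift_kernel n z : expbd (fun w => (w - z) ^+ n * cexp (z * conjc w)).
Proof.
apply: expbdM; last exact: expbd_cexp_conj.
apply: expbdX; exact: (expbdD (expbd_id R) (expbd_cst (- z))).
Qed.

Lemma expbd_sum (I : Type) (s : seq I) (F : I -> R[i] -> R[i]) :
  (forall i, expbd (F i)) -> expbd (fun w => \sum_(i <- s) F i w).
Proof.
move=> hF; elim: s => [|i s IH].
  by under eq_fun do rewrite big_nil; exact: expbd_cst.
by under eq_fun do rewrite big_cons; exact: expbdD.
Qed.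

Lemma hcoef_series f n z : L2 f ->
  ((fun N => \sum_(0 <= m < N) hcoef f n m * z ^+ m) : nat -> R[i]^o) @ \oo -->
    (fcoef f n z : R[i]^o).
Proof.
move=> fL.
have ih m : cintegrable (fun w => f w * herm n m w) by apply: L2_mul_expbd => //; exact: expbd_herm.
have E N : \sum_(0 <= m < N) hcoef f n m * z ^+ m =
    n`!%:R^-1 * cintegral (fun w => f w * herm_series N n z w).
  have -> : cintegral (fun w => f w * herm_series N n z w) =
      cintegral (fun w => \sum_(m <- index_iota 0 N) z ^+ m / m`!%:R * (f w * herm n m w)).
    congr cintegral; apply/funext => w; rewrite /herm_series mulr_sumr.
    by apply: eq_bigr => m _; rewrite mulrCA.
  rewrite cintegral_sum; last by move=> m; exact: cintegrableZ.
  rewrite mulr_sumr; apply: eq_bigr => m _; rewrite cintegralZ// /hcoef invfM; ring.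
under eq_fun do rewrite E.
rewrite /fcoef mulrC; apply: (@cvgM R[i]); first exact: cvg_cst.
pose a := normc z.
have a0 : 0 <= a by exact: normc_ge0.
(* Obtained from the bound on [herm_series] with (|w| + a)^n <= e^(n (|w| + a)). *)
pose G w := expR (n%:R * a) * (normc (f w) * expR ((n%:R + a) * normc w)).
have n0 : 0 <= n%:R + a by rewrite addr_ge0.
have := @cintegral_cvg R (fun N w => f w * herm_series N n z w)
  (fun w => f w * ((w - z) ^+ n * cexp (z * conjc w))) G.
case=> //.
- move=> N; apply: cmeasurableM; first exact: L2_measurable.
  have [//] : expbd (herm_series N n z).
  apply: expbd_sum => m; apply: expbdM; last exact: expbd_herm.
  exact: expbd_cst.
- by apply: rintegrableZ; exact: rintegrable_expR_normc.
- move=> N w; rewrite normcM /G mulrCA ler_wpM2l ?normc_ge0//.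
  apply: (le_trans (normc_herm_series _ _ _ _)).
  apply: (@le_trans _ _ (expR (normc w + a) ^+ n * expR (a * normc w))).
    rewrite ler_wpM2r ?expR_ge0// lerXn2r ?nnegrE ?addr_ge0 ?normc_ge0 ?expR_ge0//.
    by rewrite (le_trans _ (expR_ge1Dx _))// lerDr.
  rewrite -expRM_natl -!expRD ler_expR.
  clearbody a; move: (normc w) (n%:R : R) => x y.
  by rewrite mulrDr mulrDl addrCA addrA [y * x + _ + _]addrC addrA.
- by move=> w; apply: (@cvgM R[i]); [exact: cvg_cst|exact: herm_series_cvg].
Qed.

Lemma real_cexp (x : R) : (expR x)%:C%C = cexp x%:C%C.
Proof. by rewrite /cexp/= cos0 sin0 mulr1 mulr0. Qed.

Lemma B_kernelE z w : (expR (- normc z ^+ 2))%:C%C * K z w =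
  cexp (conjc z * (w - z)) * cexp (z * conjc w).
Proof.
rewrite real_cexp /K -!cexpD; congr cexp.
case: z w => [a b] [c d]; apply: eq_ReIm;
  rewrite !(cReD, cImD, cReM, cImM, cReN, cImN)/= ?sqr_sqrtr ?addr_ge0 ?sqr_ge0//; ring.
Qed.

Lemma B_integrandE f z w : B_integrand f z w =
  f w * (cexp (conjc z * (w - z)) * cexp (z * conjc w)).
Proof. by rewrite /B_integrand B_kernelE mulrC. Qed.

Lemma expbd_B_kernel z : expbd (fun w => cexp (conjc z * (w - z)) * cexp (z * conjc w)).
Proof.
apply: expbdM; last exact: expbd_cexp_conj.
have := expbdM (expbd_cexp (conjc z)) (expbd_cst (cexp (- (conjc z * z)))).
by under eq_fun do rewrite -cexpD -mulrBr.
Qed.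

Lemma B_integrable f z : L2 f -> cintegrable (B_integrand f z).
Proof.
move=> fL; rewrite (_ : B_integrand f z = fun w => f w * (cexp (conjc z * (w - z)) * cexp (z * conjc w))).
  by apply: L2_mul_expbd => //; exact: expbd_B_kernel.
by apply/funext => w; exact: B_integrandE.
Qed.

Lemma B_series f z : L2 f ->
  ([series (conjc z) ^+ n * fcoef f n z]_n : nat -> R[i]^o) @ \oo --> (B f z : R[i]^o).
Proof.
move=> fL.
have ik n : cintegrable (fun w => f w * ((w - z) ^+ n * cexp (z * conjc w))).
  by apply: L2_mul_expbd => //; exact: expbd_shift_kernel.
rewrite (_ : [series _]_n = (fun N => cintegral (fun w => f w * (expS N (conjc z * (w - z)) * cexp (z * conjc w))))); last first.
  apply/funext => N; rewrite /series/=.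
  have -> : (fun w => f w * (expS N (conjc z * (w - z)) * cexp (z * conjc w))) =
     (fun w => \sum_(n <- index_iota 0 N) (conjc z ^+ n / n`!%:R) * (f w * ((w - z) ^+ n * cexp (z * conjc w)))).
    apply/funext => w; rewrite /expS mulr_suml mulr_sumr.
    by apply: eq_bigr => n _; rewrite exprMn; ring.
  rewrite cintegral_sum; last by move=> n; exact: cintegrableZ.
  by apply: eq_bigr => n _; rewrite cintegralZ// /fcoef; ring.
rewrite /B (_ : B_integrand f z = fun w => f w * (cexp (conjc z * (w - z)) * cexp (z * conjc w))); last first.
  by apply/funext => w; exact: B_integrandE.
pose a := normc z.
have a0 : 0 <= a by exact: normc_ge0.
(* The exponents |conj(z) (w - z)| and |z conj(w)| add up to at most a^2 + 2 a |w|. *)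
pose G w := expR (a * a) * (normc (f w) * expR ((a + a) * normc w)).
have aa0 : 0 <= a + a by rewrite addr_ge0.
have [] := @cintegral_cvg R (fun N w => f w * (expS N (conjc z * (w - z)) * cexp (z * conjc w)))
  (fun w => f w * (cexp (conjc z * (w - z)) * cexp (z * conjc w))) G _ _ _ _ => //.
- move=> N; apply: cmeasurableM; first exact: L2_measurable.
  have [//] : expbd (fun w => expS N (conjc z * (w - z)) * cexp (z * conjc w)).
  apply: expbdM; last exact: expbd_cexp_conj.
  apply: expbd_sum => n; apply: expbdM; last exact: expbd_cst.
  apply: expbdX; apply: expbdM; first exact: expbd_cst.
  exact: (expbdD (expbd_id R) (expbd_cst (- z))).
- by apply: rintegrableZ; exact: rintegrable_expR_normc.
- move=> N w; rewrite normcM /G mulrCA ler_wpM2l ?normc_ge0// normcM.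
  apply: (le_trans (ler_pM (normc_ge0 _) (normc_ge0 _) (normc_expS _ _) (normc_cexp_le _))).
  rewrite -!expRD ler_expR !normcM !normc_conj -/a.
  have := ler_wpM2l a0 (ler_normcB w z); rewrite -/a; lra.
- move=> w; apply: (@cvgM R[i]); first exact: cvg_cst.
  by apply: (@cvgM R[i]); [exact: cexp_cvg|exact: cvg_cst].
Qed.

End transform_expansion.

(** * Bessel's inequality and the Riesz-Fischer theorem for an orthogonal sequence *)

Section riesz_fischer.
Variable R : realType.
Implicit Types (f g : R[i] -> R[i]).

Lemma n2_fatou (g_ : nat -> R[i] -> R[i]) g M : (forall n, L2 (g_ n)) ->
  (forall w, ((fun n => g_ n w) : nat -> R[i]^o) @ \oo --> (g w : R[i]^o)) ->
  (forall n, n2 (g_ n) <= M) -> L2 g /\ n2 g <= M.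
Proof.
move=> gL cg gM.
have mg : cmeasurable g by apply: cmeasurable_cvg cg => n; exact: L2_measurable.
pose F n (p : plane R) := (normc (g_ n (toC p)) ^+ 2)%:E.
have cF p : F ^~ p @ \oo --> (normc (g (toC p)) ^+ 2)%:E.
  apply: cvg_EFin; first exact: nearW.
  have /cvgc_ReIm[h1 h2] := cg (toC p).
  rewrite normc_sqr /F; under eq_fun do rewrite /= normc_sqr.
  by apply: cvgD; rewrite expr2; under eq_fun do rewrite expr2; apply: cvgM.
have le : (normL2sq g <= M%:E)%E.
  rewrite /normL2sq.
  have -> : (\int[mu R]_p (normc (g (toC p)) ^+ 2)%:E = \int[mu R]_p limn_einf (F ^~ p))%E.
    by apply: eq_integral => p _; have h := cF p; rewrite is_cvg_limn_einfE; [exact/esym/cvg_lim|by apply/cvg_ex; eexists; exact: h].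
  apply: (le_trans (@fatou _ _ _ (mu R) setT measurableT F _ _)).
  - by move=> n; apply/measurable_EFinP; exact: cmeasurable_sqr (L2_measurable (gL n)).
  - by move=> n p _; rewrite lee_fin sqr_ge0.
  rewrite limn_einf_lim; apply: lime_le; first exact: is_cvg_einfs.
  apply: nearW => n; apply: (@le_trans _ _ (\int[mu R]_p F n p)%E).
    by apply: ereal_inf_lbound; exists n => //=.
  by have := normL2sqE (gL n); rewrite /normL2sq /F => ->; rewrite lee_fin.
have gL2 : L2 g by split=> //; rewrite (le_lt_trans le)// ltry.
by split=> //; move: le; rewrite normL2sqE.
Qed.


Section orthogonal_sequence.
Variables (e : nat -> R[i] -> R[i]) (N : nat -> R).
Hypothesis eL : forall i, L2 (e i).
Hypothesis e_orth : forall i j, ip (e i) (e j) = ((i == j)%:R * N i)%:C%C.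

Definition psum (c : nat -> R[i]) k w := \sum_(0 <= i < k) c i * e i w.
Definition psum_sqr (c : nat -> R[i]) k : R := \sum_(0 <= i < k) normc (c i) ^+ 2 * N i.

Lemma L2_psum c k : L2 (psum c k).
Proof. by apply: L2_sum => i; exact: L2_Z. Qed.

Lemma orth_ge0 i : 0 <= N i.
Proof.
have := ip_self (eL i); rewrite e_orth eqxx mul1r => -[->]; exact: n2_ge0.
Qed.

Lemma ip_psum c k j : ip (psum c k) (e j) = (j < k)%N%:R * (c j * (N j)%:C%C).
Proof.
rewrite ip_suml//; last by move=> i; exact: L2_Z.
under eq_bigr do rewrite ipZl// e_orth.
have [jk|kj] := ltnP j k.
  rewrite (bigD1_seq j) ?mem_index_iota ?iota_uniq//= eqxx mul1r mul1r big1 ?addr0// => i ij.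
  by rewrite (negbTE ij) mul0r mulr0.
rewrite mul0r big_nat big1// => i /andP[_ ik].
by rewrite ltn_eqF ?mul0r ?mulr0// (leq_trans ik).
Qed.

Lemma ip_psumr f c k : L2 f -> (forall i, ip f (e i) = c i * (N i)%:C%C) ->
  ip f (psum c k) = (psum_sqr c k)%:C%C.
Proof.
move=> fL fc; rewrite ip_conj//; last exact: L2_psum.
rewrite ip_suml//; last by move=> i; exact: L2_Z.
rewrite /psum_sqr rmorph_sum [RHS]rmorph_sum; apply: eq_bigr => i _.
rewrite ipZl// ip_conj// fc; case: (c i) => a b.
apply: eq_ReIm; rewrite ?(cReM, cImM) /= ?(cReM, cImM) /= ?sqr_sqrtr ?addr_ge0 ?sqr_ge0//; ring.
Qed.

Lemma n2_sub_psum f c k : L2 f -> (forall i, ip f (e i) = c i * (N i)%:C%C) ->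
  n2 (fun w => f w - psum c k w) = n2 f - psum_sqr c k.
Proof.
move=> fL fc; rewrite n2B//; last exact: L2_psum.
rewrite (ip_psumr k fL fc)/=.
have -> : n2 (psum c k) = psum_sqr c k.
  apply: (@complexI R); rewrite -ip_self; last exact: L2_psum.
  rewrite /psum_sqr rmorph_sum ip_conj; [|exact: L2_psum|exact: L2_psum].
  rewrite /psum ip_suml; [|by move=> i; exact: L2_Z|exact: L2_psum].
  rewrite rmorph_sum big_nat [RHS]big_nat; apply: eq_bigr => i /andP[_ ik].
  rewrite ipZl//; last exact: L2_psum.
  rewrite ip_conj//; last exact: L2_psum.
  rewrite ip_psum ik mul1r; case: (c i) => a b.
  apply: eq_ReIm; rewrite ?(cReM, cImM) /= ?(cReM, cImM) /= ?sqr_sqrtr ?addr_ge0 ?sqr_ge0//; ring.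
ring.
Qed.

Lemma bessel f c k : L2 f -> (forall i, ip f (e i) = c i * (N i)%:C%C) ->
  psum_sqr c k <= n2 f.
Proof.
move=> fL fc; have := n2_ge0 (fun w => f w - psum c k w).
by rewrite (n2_sub_psum k fL fc) subr_ge0.
Qed.

(** The coefficients of [psum c l] are the sequence [c'], cut off at [l]; since [psum c k] does not
    see the cut for k <= l, [n2_sub_psum] applies with [c']. *)
Lemma n2_psumB c k l : (k <= l)%N ->
  n2 (fun w => psum c l w - psum c k w) = psum_sqr c l - psum_sqr c k.
Proof.
move=> kl; pose c' i := (i < l)%N%:R * c i.
have E j : (j <= l)%N -> psum c j = psum c' j.
  move=> jl; apply/funext => w; rewrite /psum !big_nat; apply: eq_bigr => i /andP[_ ij].
  by rewrite /c' (leq_trans ij jl) mul1r.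
have E' j : (j <= l)%N -> psum_sqr c j = psum_sqr c' j.
  move=> jl; rewrite /psum_sqr !big_nat; apply: eq_bigr => i /andP[_ ij].
  by rewrite /c' (leq_trans ij jl) mul1r.
have ipc i : ip (psum c l) (e i) = c' i * (N i)%:C%C.
  by rewrite ip_psum mulrA.
rewrite [psum c k]E// n2_sub_psum; [|exact: L2_psum|exact: ipc].
rewrite -(E' _ kl); congr (_ - _).
have := n2_sub_psum l (L2_psum c l) ipc; rewrite -(E _ (leqnn _)) -(E' _ (leqnn _)).
rewrite (_ : (fun w => _) = (fun=> 0)); last by apply/funext => w; rewrite subrr.
rewrite (_ : n2 (fun=> 0) = 0); first by move/esym/eqP; rewrite subr_eq0 => /eqP.
rewrite /n2; under eq_fun do rewrite normc0 expr0n/=.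
by rewrite /rintegral Rintegral_cst// mul0r.
Qed.

Lemma psum_sqr_nd c : nondecreasing_seq (psum_sqr c).
Proof.
apply/nondecreasing_seqP => k; rewrite /psum_sqr big_nat_recr//= lerDl.
by rewrite mulr_ge0 ?sqr_ge0 ?orth_ge0.
Qed.

(* Along a subsequence with [n2 (S_{j+1} - S_j) <= 4^-j] the telescoping
   series converges absolutely almost everywhere; Fatou's lemma then bounds
   the distance of the limit to every partial sum. *)
Lemma riesz_fischer_limit c M : (forall k, psum_sqr c k <= M) ->
  exists2 f, L2 f & forall k, n2 (fun w => f w - psum c k w) <= limn (psum_sqr c) - psum_sqr c k.
Proof.
move=> HM; pose t := limn (psum_sqr c).
have cvt : psum_sqr c @ \oo --> t.
  apply: nondecreasing_is_cvgn; first exact: psum_sqr_nd.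
  by exists M => _ [k _ <-].
have tle k : psum_sqr c k <= t.
  by apply: nondecreasing_cvgn_le; [exact: psum_sqr_nd|apply/cvg_ex; exists t].
have /choice[sub0 Hsub0] : forall j, exists k0, forall k, (k0 <= k)%N -> t - psum_sqr c k <= (4 ^+ j)^-1.
  move=> j; have p : 0 < (4 ^+ j)^-1 :> R by rewrite invr_gt0 exprn_gt0.
  move/cvgrPdist_le : cvt => /(_ _ p)[k0 _ H]; exists k0 => k /H /=.
  by rewrite ger0_norm// subr_ge0.
pose sub := fix sub j := if j is j'.+1 then maxn (sub j').+1 (sub0 j) else sub0 0%N.
have sub_lt j : (sub j < sub j.+1)%N by rewrite /= leq_maxl.
have sub_nd j : (sub j <= sub j.+1)%N by exact: ltnW.
have Hsub j k : (sub j <= k)%N -> t - psum_sqr c k <= (4 ^+ j)^-1.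
  move=> jk; apply: Hsub0; apply: leq_trans jk.
  by case: j => //= j; rewrite leq_maxr.
pose S j := psum c (sub j).
have SL j : L2 (S j) by exact: L2_psum.
pose D j w := S j.+1 w - S j w.
have DL j : L2 (D j) by exact: L2_B.
have nD j : n2 (D j) <= (4 ^+ j)^-1.
  rewrite /D /S n2_psumB//; apply: le_trans (Hsub j (sub j) (leqnn _)).
  by rewrite lerD2r.
pose a j (p : plane R) := (normc (D j (toC p)))%:E.
have ma j : measurable_fun setT (a j).
  by apply/measurable_EFinP; exact: cmeasurable_normc (L2_measurable (DL j)).
have ia j : (\int[mu R]_p a j p <= ((2 ^+ j)^-1)%:E)%E.
  have i1 : rintegrable (fun w => normc (D j w)).
    apply: cintegrable_normc.
    have := L2_mul_expbd (DL j) (expbd_cst 1).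
    by under eq_fun do rewrite mulr1.
  have i2 := L2_rintegrable (DL j).
  (* The inequality x <= 2^-j / 2 + (2^j / 2) x^2 on a space of mass 1 turns the bound 4^-j for [n2]
     into 2^-j for the integral of the modulus. *)
  have i0 : rintegrable (fun=> (2 ^+ j)^-1 / 2 : R).
    exact: finite_measure_integrable_cst.
  have i3 := rintegrableD i0 (rintegrableZ (2 ^+ j / 2) i2).
  have h := rintegral_le i1 i3.
  rewrite /a (rintegralE i1) lee_fin; apply: (le_trans (h _)) => [w|].
    move: (normc _) => x; have q : 0 < (2 ^+ j)^-1 :> R by rewrite invr_gt0 exprn_gt0.
    rewrite -subr_ge0.
    have -> : (2 ^+ j)^-1 / 2 + 2 ^+ j / 2 * x ^+ 2 - x = (2 ^+ j)^-1 / 2 * (1 - 2 ^+ j * x) ^+ 2.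
      by field; rewrite expf_neq0.
    by rewrite mulr_ge0 ?sqr_ge0// divr_ge0// ltW.
  rewrite (rintegralD i0 (rintegrableZ _ i2)) (rintegralZ _ i2).
  have -> : rintegral (fun=> (2 ^+ j)^-1 / 2 : R) = (2 ^+ j)^-1 / 2.
    by rewrite /rintegral Rintegral_cst//= gauss2_setT mulr1.
  have q0 : 0 <= 2 ^+ j / 2 :> R by rewrite divr_ge0 ?exprn_ge0.
  have hh := ler_wpM2l q0 (nD j).
  apply: (le_trans (lerD (lexx _) hh)).
  have -> : (4 : R) = 2 * 2 by rewrite -natrM.
  rewrite exprMn le_eqVlt; apply/orP; left; apply/eqP.
  by field; rewrite expf_neq0.
pose G p := (\sum_(0 <= j <oo) a j p)%E.
have mG : measurable_fun setT G.
  by apply: ge0_emeasurable_sum => // j p _; rewrite lee_fin normc_ge0.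
have G0 p : (0 <= G p)%E by apply: nneseries_ge0 => j _ _; rewrite lee_fin normc_ge0.
have iG : (mu R).-integrable setT G.
  apply/integrableP; split=> //; under eq_integral do rewrite gee0_abs//.
  rewrite integral_nneseries//; last by move=> j p _; rewrite lee_fin normc_ge0.
  apply: (@le_lt_trans _ _ (\sum_(0 <= j <oo) ((2 ^+ j)^-1)%:E)%E).
    apply: lee_nneseries => // j _ _; apply: integral_ge0 => p _.
    by rewrite lee_fin normc_ge0.
  have /cvg_lim h := @cvg_geometric_eseries_half R 2 0.
  rewrite (_ : limn _ = (2 / 2 ^+ 0)%:E) ?ltry// -h//; congr (limn _).
  apply/funext => n; rewrite /eseries/=; apply: eq_bigr => j _; congr EFin.
  rewrite addn1 expnS natrM natrX; field; rewrite expf_neq0//.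
pose pl (w : R[i]) : plane R := (complex.Re w, complex.Im w).
have plK w : toC (pl w) = w by case: w.
(* Cutting off where the telescoping series may diverge makes the sequence converge at every point;
   almost nothing is lost, because [G] is integrable. *)
pose chi w : R[i] := (G (pl w) \is a fin_num)%:R.
have chi1 w : normc (chi w) <= 1 by rewrite normc_nat lern1 leq_b1.
have mchi : cmeasurable chi.
  have mA : measurable [set p | G p \is a fin_num].
    by have := emeasurable_fin_num measurableT mG; rewrite setTI.
  split.
    rewrite (_ : (fun p => _) = \1_[set p | G p \is a fin_num]); first exact: measurable_indic.
    apply/funext => p; rewrite /chi indicE -(rmorph_nat (real_complex R))/=.
    have -> : pl (toC p) = p by case: p.
    by rewrite (_ : (p \in _) = (G p \is a fin_num))//; apply/idP/idP; rewrite inE.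
  rewrite (_ : (fun p => _) = (fun=> 0)); first exact: measurable_cst.
  by apply/funext => p; rewrite /chi -(rmorph_nat (real_complex R)).
have chiL g : L2 g -> L2 (fun w => chi w * g w).
  move=> gL; apply: (L2_le _ gL) => [|w]; first by apply: cmeasurableM => //; exact: L2_measurable.
  by rewrite normcM ler_piMl ?normc_ge0.
have chi_ae g : L2 g -> n2 (fun w => chi w * g w) = n2 g.
  move=> gL; rewrite /n2 /rintegral /Rintegral; congr fine.
  apply: ae_eq_integral => //.
  - by apply/measurable_EFinP; exact: cmeasurable_sqr (L2_measurable (chiL _ gL)).
  - by apply/measurable_EFinP; exact: cmeasurable_sqr (L2_measurable gL).
  apply: filterS (integrable_ae measurableT iG) => p /(_ I) fp _.
  have E : pl (toC p) = p by case: p {fp}.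
  by rewrite /chi E fp mul1r.
have chi_le g : L2 g -> n2 (fun w => chi w * g w) <= n2 g.
  by move=> /chi_ae ->.
have cvgS w : cvgn (fun j => complex.Re (chi w * S j w)) /\ cvgn (fun j => complex.Im (chi w * S j w)).
  rewrite /chi; case: (boolP (G (pl w) \is a fin_num)) => Gw; last first.
    by split; under eq_fun do rewrite mul0r; exact: is_cvg_cst.
  have cx : cvgn (series (fun j => normc (D j w))).
    apply: nondecreasing_is_cvgn.
      by apply/nondecreasing_seqP => n; rewrite /series/= big_nat_recr//= lerDl normc_ge0.
    exists (fine (G (pl w))) => _ [n _ <-].
    rewrite -lee_fin fineK// /series/= -sumEFin.
    have := @nneseries_lim_ge R (fun j => a j (pl w)) xpredT 0%N n.
    rewrite /G /a plK; apply => j _ _; by rewrite lee_fin normc_ge0.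
  have tel n : S n w = S 0%N w + \sum_(0 <= j < n) D j w.
    by rewrite /D telescope_sumr// addrC subrK.
  have cr (r : R[i] -> R) : (forall z, `|r z| <= normc z) -> cvgn (series (fun j => r (D j w))).
    move=> rle; apply: normed_cvg; apply: series_le_cvg cx => j; [exact: normr_ge0|exact: normc_ge0|exact: rle].
  split.
    under eq_fun => n do rewrite mul1r tel cReD [complex.Re (\sum_(0 <= j < n) _)]Re_sum.
    have /cvg_ex[l hl] := cr _ (@Re_le_normc R).
    by apply/cvg_ex; eexists; apply: cvgD; [exact: cvg_cst|exact: hl].
  under eq_fun => n do rewrite mul1r tel cImD [complex.Im (\sum_(0 <= j < n) _)]Im_sum.
  have /cvg_ex[l hl] := cr _ (@Im_le_normc R).
  by apply/cvg_ex; eexists; apply: cvgD; [exact: cvg_cst|exact: hl].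
pose f w : R[i] := Complex (limn (fun j => complex.Re (chi w * S j w)))
                   (limn (fun j => complex.Im (chi w * S j w))).
have cf w : ((fun j => chi w * S j w) : nat -> R[i]^o) @ \oo --> (f w : R[i]^o).
  by apply/cvgc_ReIm; split; [exact: (cvgS w).1|exact: (cvgS w).2].
have chif w : chi w * f w = f w.
  have h : ((fun j => chi w * (chi w * S j w)) : nat -> R[i]^o) @ \oo --> (chi w * f w : R[i]^o).
    by apply: (@cvgM R[i]); [exact: cvg_cst|exact: cf].
  apply: (cvgc_unique h).
  rewrite (_ : (fun j => _) = (fun j => chi w * S j w)); first exact: cf.
  by apply/funext => j; rewrite mulrA /chi -natrM mulnb andbb.
have key k : L2 (fun w => f w - chi w * psum c k w) /\ n2 (fun w => f w - chi w * psum c k w) <= t - psum_sqr c k.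
  (* Delaying the subsequence past [k] makes [n2_psumB] applicable to every term before Fatou. *)
  have [j0 Hj0] : exists j0, forall j, (k <= sub (j + j0))%N.
    exists k => j; elim: j => [|j IH]; last by rewrite addSn (leq_trans IH).
    rewrite add0n; elim: k => // k IH.
    exact: leq_ltn_trans IH (sub_lt k).
  apply: (@n2_fatou (fun j w => chi w * (S (j + j0)%N w - psum c k w))).
  - by move=> j; apply: (chiL (fun w => S (j + j0)%N w - psum c k w)); apply: L2_B => //; exact: L2_psum.
  - move=> w; under eq_fun do rewrite mulrBr.
    apply: (@cvgB _ (R[i]^o)); last exact: cvg_cst.
    by have := cf w; rewrite -(cvg_shiftn j0).
  - move=> j; apply: (le_trans (chi_le (fun w => S (j + j0)%N w - psum c k w) _)).
      by apply: L2_B => //; exact: L2_psum.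
    by rewrite /S n2_psumB// lerD2r.
have fL : L2 f.
  have := L2_D (key 0%N).1 (chiL _ (L2_psum c 0%N)).
  by under eq_fun do rewrite subrK.
exists f => // k.
have e1 := chi_ae _ (L2_B fL (L2_psum c k)).
rewrite -e1; apply: le_trans (key k).2.
rewrite (_ : (fun w => chi w * _) = (fun w => f w - chi w * psum c k w))//.
by apply/funext => w; rewrite mulrBr chif.
Qed.

Lemma riesz_fischer c M : (forall k, psum_sqr c k <= M) ->
  exists f, [/\ L2 f, forall i, ip f (e i) = c i * (N i)%:C%C &
    psum_sqr c @ \oo --> n2 f].
Proof.
move=> /[dup] HM /riesz_fischer_limit[f fL]; set t := limn _ => Hf.
have cvt : psum_sqr c @ \oo --> t.
  apply: nondecreasing_is_cvgn; first exact: psum_sqr_nd.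
  by exists M => _ [k _ <-].
have fc i : ip f (e i) = c i * (N i)%:C%C.
  apply/eqP; rewrite -subr_eq0; apply/eqP/normc0P/eqP.
  rewrite eq_le normc_ge0 andbT; apply/ler_addgt0Pr => d d0; rewrite add0r.
  have n0 := n2_ge0 (e i).
  (* Weight for [normc_cintegralM_le]: it makes the term of [e i] at most d / 2, after which [k] is
     taken so large that the other term is at most d / 2 too. *)
  pose s := (n2 (e i) + 1) / (d / 2).
  have s0 : 0 < s by rewrite divr_gt0 ?divr_gt0// ltr_wpDl.
  have d2 : 0 < d / 2 / s by apply: divr_gt0 => //; exact: divr_gt0.
  move/cvgrPdist_lt : cvt => /(_ _ d2)[k0 _ Hk0].
  pose k := maxn k0 i.+1.
  have := Hk0 k (leq_maxl _ _) => /= hk.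
  have -> : ip f (e i) - c i * (N i)%:C%C = ip (fun w => f w - psum c k w) (e i).
    rewrite ipBl//; last exact: L2_psum.
    by rewrite ip_psum (_ : (i < k)%N) ?mul1r// leq_maxr.
  have fkL : L2 (fun w => f w - psum c k w) by apply: L2_B => //; exact: L2_psum.
  apply: (le_trans (normc_cintegralM_le s0 fkL (L2_conj (eL i)))).
  rewrite [d]splitr lerD//.
    rewrite mulrC -ler_pdivlMr//; apply: (le_trans (Hf k)).
    by rewrite (le_trans (ler_norm _))// ltW.
  have -> : n2 (fun w => conjc (e i w)) = n2 (e i).
    by rewrite /n2; congr rintegral; apply/funext => w; rewrite normc_conj.
  rewrite mulrC -ler_pdivlMr ?invr_gt0// invrK /s mulrC divfK ?gt_eqF ?divr_gt0//.
  by rewrite lerDl.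
exists f; split=> //.
apply/cvgrPdist_le => d d0; move/cvgrPdist_le : cvt => /(_ _ d0).
apply: filterS => k; have := Hf k; rewrite (n2_sub_psum k fL fc) => h1 h2.
have h3 := bessel k fL fc.
rewrite ger0_norm ?subr_ge0// (le_trans h1)// (le_trans _ h2)// ler_norm//.
Qed.


End orthogonal_sequence.

End riesz_fischer.

(** * Injectivity *)

Section sign_iteration.
Variable R : realType.
Implicit Types s : R.

(* [s |-> (3 s - s^3) / 2] has the attracting fixed points [1] and [-1], so its
   iterates converge to the sign on [[-1, 1]]. *)
Definition sgstep s := (3 * s - s ^+ 3) / 2.

Lemma sgstepN s : sgstep (- s) = - sgstep s.
Proof. by rewrite /sgstep; field. Qed.

Lemma iter_sgstepN n s : iter n sgstep (- s) = - iter n sgstep s.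
Proof. by elim: n => //= n ->; rewrite sgstepN. Qed.

Lemma sgstep_bounds s : 0 <= s <= 1 -> s <= sgstep s <= 1.
Proof.
move=> /andP[s0 s1]; rewrite -subr_ge0 -[_ <= 1]subr_ge0.
have -> : sgstep s - s = s * (1 - s) * (1 + s) / 2 by rewrite /sgstep; field.
have -> : 1 - sgstep s = (1 - s) ^+ 2 * (2 + s) / 2 by rewrite /sgstep; field.
rewrite !(divr_ge0, mulr_ge0, sqr_ge0) ?subr_ge0// ?addr_ge0//.
Qed.

Lemma iter_sgstep_bounds n s : 0 <= s <= 1 -> s <= iter n sgstep s <= 1.
Proof.
move=> /andP[s0 s1]; elim: n => [|n /andP[h1 h2]] /=; first by rewrite lexx s1.
have /sgstep_bounds/andP[h3 h4] : 0 <= iter n sgstep s <= 1 by rewrite h2 andbT (le_trans s0).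
by rewrite h4 (le_trans h1 h3).
Qed.

Lemma norm_iter_sgstep n s : `|s| <= 1 -> `|iter n sgstep s| <= 1.
Proof.
wlog s0 : s / 0 <= s.
  move=> H; have [s0|/ltW s0] := leP 0 s; first exact: H.
  by have := H (- s); rewrite iter_sgstepN !normrN oppr_ge0; exact.
rewrite ger0_norm// => s1; have /(iter_sgstep_bounds n)/andP[h1 h2] : 0 <= s <= 1 by rewrite s0.
by rewrite ger0_norm// (le_trans s0).
Qed.

Lemma iter_sgstep_cvg s : `|s| <= 1 -> (fun n => iter n sgstep s) @ \oo --> Num.sg s.
Proof.
wlog s0 : s / 0 <= s.
  move=> H; have [s0|/ltW s0] := leP 0 s; first exact: H.
  move=> s1; rewrite -[X in _ --> X]opprK -sgrN.
  rewrite (_ : (fun n => _) = (fun n => - iter n sgstep (- s))).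
    by apply: cvgN; apply: H; rewrite ?oppr_ge0// normrN.
  by apply/funext => n; rewrite iter_sgstepN opprK.
rewrite ger0_norm// => s1.
have [->|sn0] := eqVneq s 0.
  rewrite sgr0; under eq_fun => n.
    have -> : iter n sgstep 0 = 0 by elim: n => //= n ->; rewrite /sgstep mulr0 expr0n subrr mul0r.
    over.
  exact: cvg_cst.
have sp : 0 < s by rewrite lt_neqAle eq_sym sn0.
rewrite gtr0_sg//.
(* A step multiplies the distance to 1 by 1 - (x + x^2) / 2, at most [q] since the iterates stay
   above [s]. *)
pose q := 1 - s / 2.
have q0 : 0 <= q by rewrite /q; lra.
have q1 : q < 1 by rewrite /q; lra.
have bnd n : 0 <= 1 - iter n sgstep s <= q ^+ n.
  elim: n => [|n /andP[h1 h2]].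
    by rewrite expr0 /=; apply/andP; split; lra.
  have sn : 0 <= s <= 1 by rewrite s0.
  have /andP[k1 k2] := iter_sgstep_bounds n sn.
  have /andP[_ k4] := iter_sgstep_bounds n.+1 sn.
  rewrite subr_ge0 k4 /= exprS; set x := iter n sgstep s in h1 h2 k1 k2 *.
  have -> : 1 - sgstep x = (1 - (x + x ^+ 2) / 2) * (1 - x) by rewrite /sgstep; field.
  apply: ler_pM => //.
    by have : x ^+ 2 <= 1; [rewrite expr_le1// (le_trans s0)|lra].
  by rewrite /q; have := sqr_ge0 x; lra.
have h : (fun n => q ^+ n) @ \oo --> (0 : R).
  by apply: cvg_expr; rewrite ger0_norm.
rewrite -[X in _ --> X]subr0.
have -> : (fun n => iter n sgstep s) = (fun n => 1 - (1 - iter n sgstep s)).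
  by apply/funext => n; rewrite subKr.
apply: cvgB; first exact: cvg_cst.
by apply: (squeeze_cvgr _ (cvg_cst 0) h); exact: nearW.
Qed.

End sign_iteration.

(** * Uniqueness for the Laplace transform of a function in L^2(mu) *)

Section laplace_uniqueness.
Variable R : realType.
Variable g : R[i] -> R.
Hypothesis mg : rmeasurable g.
Hypothesis ig2 : rintegrable (fun w => g w ^+ 2).
Implicit Types (psi phi : R[i] -> R) (w : R[i]).

Let bdd psi C c := forall w, `|psi w| <= C * expR (c * onorm w).

Lemma rintegrable_bddM (C c : R) : rintegrable (fun w => C * expR (c * onorm w) * `|g w|).
Proof.
have iK := rintegrable_onorm (C ^+ 2) (2 * c).
apply: (rintegrable_le _ (rintegrableD iK ig2)) => [|w].
  apply: measurable_funM; last by apply: measurableT_comp.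
  exact: (rintegrable_measurable (rintegrable_onorm C c)).
have -> : C ^+ 2 * expR (2 * c * onorm w) = (C * expR (c * onorm w)) ^+ 2.
  by rewrite exprMn -mulrA mulr_natl mulr2n expRD -expr2.
rewrite normrM normr_id -(real_normK (num_real (_ * _))) -(real_normK (num_real (g w))).
move: (`|_|) (`|_|) => a b; have := sqr_ge0 (a - b); have := sqr_ge0 a; have := sqr_ge0 b.
by rewrite sqrrB; nra.
Qed.

(* [lz psi]: the Laplace transform of [psi g mu] vanishes identically. *)
Definition lz psi := [/\ rmeasurable psi, exists C c, bdd psi C c &
  forall s t, rintegral (fun w => psi w * expR (s * complex.Re w + t * complex.Im w) * g w) = 0].

Lemma rmeasurable_lin (s t : R) : rmeasurable (fun w => s * complex.Re w + t * complex.Im w).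
Proof.
by rewrite /rmeasurable/=; apply: measurable_funD; apply: measurable_funM.
Qed.

Lemma rmeasurable_expR_lin (s t : R) : rmeasurable (fun w => expR (s * complex.Re w + t * complex.Im w)).
Proof. by apply: measurableT_comp => //; exact: rmeasurable_lin. Qed.

Lemma lin_le_onorm (s t : R) w : `|s * complex.Re w + t * complex.Im w| <= (`|s| + `|t|) * onorm w.
Proof.
rewrite (le_trans (ler_normD _ _))// !normrM mulrDl lerD// ler_wpM2l//.
  by rewrite /onorm lerDl.
by rewrite /onorm lerDr.
Qed.

Lemma bdd_exp psi C c s t : bdd psi C c ->
  forall w, `|psi w * expR (s * complex.Re w + t * complex.Im w) * g w| <=
    C * expR ((c + (`|s| + `|t|)) * onorm w) * `|g w|.
Proof.
move=> H w; rewrite !normrM ler_wpM2r// mulrDl [expR (_ * onorm w + _)]expRD mulrA ler_pM//.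
rewrite ger0_norm ?expR_ge0// ler_expR (le_trans (ler_norm _))//.
exact: lin_le_onorm.
Qed.

Lemma rmeasurable_lz psi s t : rmeasurable psi ->
  rmeasurable (fun w => psi w * expR (s * complex.Re w + t * complex.Im w) * g w).
Proof.
move=> mp; apply: measurable_funM => //; apply: measurable_funM => //.
exact: rmeasurable_expR_lin.
Qed.

Lemma lz_integrable psi s t : lz psi ->
  rintegrable (fun w => psi w * expR (s * complex.Re w + t * complex.Im w) * g w).
Proof.
move=> [mp [C [c H]] _]; apply: (rintegrable_le _ (rintegrable_bddM C _)) (bdd_exp _ _ H).
exact: rmeasurable_lz.
Qed.

(** Dominated convergence; the growth constants must be common to the whole sequence. *)
Lemma lz_lim (psi_ : nat -> R[i] -> R) psi C c : (forall n, lz (psi_ n)) ->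
  (forall n, bdd (psi_ n) C c) -> (forall w, (fun n => psi_ n w) @ \oo --> psi w) -> lz psi.
Proof.
move=> lp bp cp; split.
- apply: (@measurable_fun_cvg _ _ _ _ (fun n (p : plane R) => psi_ n (toC p))) => [n|p _].
    by case: (lp n).
  exact: cp.
- exists C, c => w; have h : (fun n => `|psi_ n w|) @ \oo --> `|psi w| by apply: cvg_norm.
  rewrite -(cvg_lim _ h)//; apply: limr_le; first by apply/cvg_ex; eexists; exact: h.
  by apply: nearW => n; exact: bp.
- move=> s t.
  have [] := @rintegral_cvg R
    (fun n w => psi_ n w * expR (s * complex.Re w + t * complex.Im w) * g w)
    (fun w => psi w * expR (s * complex.Re w + t * complex.Im w) * g w) _ _
    (rintegrable_bddM C (c + (`|s| + `|t|))) _ _.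
  + by move=> n; apply: rmeasurable_lz; case: (lp n).
  + by move=> n w; exact: bdd_exp.
  + by move=> w; apply: cvgMl; apply: cvgMl; exact: cp.
  + move=> _ h; apply: (cvg_unique _ h) => //.
    rewrite /= (_ : (fun n => _) = fun=> 0); first exact: cvg_cst.
    by apply/funext => n; case: (lp n).
Qed.

Lemma lzZ k psi : lz psi -> lz (fun w => k * psi w).
Proof.
move=> lp; have [mp [C [c H]] E] := lp; split.
- by apply: measurable_funM.
- by exists (`|k| * C), c => w; rewrite normrM -mulrA ler_wpM2l.
- move=> s t; have := rintegralZ k (lz_integrable s t lp); rewrite E mulr0 => <-.
  by congr rintegral; apply/funext => w; rewrite !mulrA.
Qed.

Lemma lzD psi phi : lz psi -> lz phi -> lz (fun w => psi w + phi w).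
Proof.
move=> lp lq; have [mp [C [c H]] E] := lp; have [mq [C' [c' H']] E'] := lq; split.
- exact: measurable_funD.
- have C0 : 0 <= C.
    by have := H 0; rewrite /onorm/= normr0 addr0 mulr0 expR0 mulr1 => /(le_trans _); apply.
  have C'0 : 0 <= C'.
    by have := H' 0; rewrite /onorm/= normr0 addr0 mulr0 expR0 mulr1 => /(le_trans _); apply.
  exists (C + C'), (Num.max c c') => w; rewrite (le_trans (ler_normD _ _))// mulrDl lerD//.
    by rewrite (le_trans (H w))// ler_wpM2l// ler_expR ler_wpM2r ?onorm_ge0// le_max lexx.
  by rewrite (le_trans (H' w))// ler_wpM2l// ler_expR ler_wpM2r ?onorm_ge0// le_max lexx orbT.
- move=> s t; have := rintegralD (lz_integrable s t lp) (lz_integrable s t lq).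
  rewrite E E' addr0 => <-.
  by congr rintegral; apply/funext => w; rewrite !mulrDl.
Qed.

(** An exponential factor only shifts the argument (s, t) of the Laplace transform. *)
Lemma lz_exp p q psi : lz psi ->
  lz (fun w => expR (p * complex.Re w + q * complex.Im w) * psi w).
Proof.
move=> [mp [C [c H]] E]; split.
- by apply: measurable_funM => //; exact: rmeasurable_expR_lin.
- exists C, (c + (`|p| + `|q|)) => w; rewrite normrM mulrDl [expR (_ * onorm w + _)]expRD mulrA mulrC ler_pM//.
  rewrite ger0_norm ?expR_ge0// ler_expR (le_trans (ler_norm _))//.
  exact: lin_le_onorm.
- move=> s t; rewrite -(E (p + s) (q + t)); congr rintegral; apply/funext => w.
  have -> : (p + s) * complex.Re w + (q + t) * complex.Im w =
    (p * complex.Re w + q * complex.Im w) + (s * complex.Re w + t * complex.Im w) by ring.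
  by rewrite [in RHS]expRD; ring.
Qed.

Lemma expRB1_le (u : R) : `|expR u - 1| <= `|u| * expR `|u|.
Proof.
have [u0|u0] := leP 0 u.
  rewrite ger0_norm; last by rewrite subr_ge0 -expR0 ler_expR.
  have := expR_ge1Dx (- u); have := expR_gt0 u; rewrite expRN => e0 h.
  by have := ler_wpM2l (ltW e0) h; rewrite divff ?gt_eqF// ger0_norm//; nra.
rewrite ler0_norm; last by rewrite subr_le0 -expR0 ler_expR ltW.
have := expR_ge1Dx u; have : 1 <= expR `|u| by rewrite -expR0 ler_expR.
by rewrite ltr0_norm// => h1 h2; nra.
Qed.

Lemma expRB1D_le (u : R) : `|expR u - 1 - u| <= u ^+ 2 * expR `|u|.
Proof.
have := normc_cexpB1 u%:C%C.
have -> : cexp u%:C%C - (1 + u%:C%C) = (expR u - 1 - u)%:C%C.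
  by apply: eq_ReIm => /=; rewrite ?cos0 ?sin0; ring.
by rewrite !normcR real_normK ?num_real.
Qed.

Lemma expRB1_cvg (u : R) : (fun k : nat => k.+1%:R * (expR (u / k.+1%:R) - 1)) @ \oo --> u.
Proof.
have h : (fun k : nat => u ^+ 2 * expR `|u| * k.+1%:R^-1) @ \oo --> (0 : R).
  by rewrite -[X in _ --> X](mulr0 (u ^+ 2 * expR `|u|)); apply: cvgMr; exact: cvg_harmonic.
have hl : (fun k : nat => u - u ^+ 2 * expR `|u| * k.+1%:R^-1) @ \oo --> u.
  by rewrite -[X in _ --> X]subr0; apply: cvgB => //; exact: cvg_cst.
have hr : (fun k : nat => u + u ^+ 2 * expR `|u| * k.+1%:R^-1) @ \oo --> u.
  by rewrite -[X in _ --> X]addr0; apply: cvgD => //; exact: cvg_cst.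
apply: (squeeze_cvgr _ hl hr); apply: nearW => k.
have k0 : 0 < k.+1%:R :> R by [].
rewrite -ler_distlC -normrN opprB.
have -> : k.+1%:R * (expR (u / k.+1%:R) - 1) - u =
    k.+1%:R * (expR (u / k.+1%:R) - 1 - u / k.+1%:R) by field.
rewrite normrM ger0_norm//.
apply: (@le_trans _ _ (k.+1%:R * ((u / k.+1%:R) ^+ 2 * expR `|u|))).
  rewrite ler_wpM2l// (le_trans (expRB1D_le _))// ler_wpM2l ?sqr_ge0// ler_expR.
  by rewrite normrM (ger0_norm (_ : 0 <= k.+1%:R^-1)) ?invr_ge0// ler_pdivrMr// ler_peMr// ler1n.
by have -> : k.+1%:R * ((u / k.+1%:R) ^+ 2 * expR `|u|) = u ^+ 2 * expR `|u| * k.+1%:R^-1 by field.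
Qed.

(** A linear factor L is the limit of k (e^(L/k) - 1), covered by [lz_exp]; the bound |L| e^|L| <=
    e^(2|L|), uniform in k, allows [lz_lim]. This stands in for differentiating the Laplace
    transform. *)
Lemma lz_lin p q psi : lz psi -> lz (fun w => (p * complex.Re w + q * complex.Im w) * psi w).
Proof.
move=> lp; pose L w := p * complex.Re w + q * complex.Im w.
have [_ [C [c H]] _] := lp.
apply: (@lz_lim (fun k w => k.+1%:R * (expR (L w / k.+1%:R) - 1) * psi w) _ C (c + 2 * (`|p| + `|q|))).
- move=> k; have := lzZ k.+1%:R (lzD (lz_exp (p / k.+1%:R) (q / k.+1%:R) lp) (lzZ (-1) lp)).
  congr lz; apply/funext => w; rewrite /L mulN1r -{2}[psi w]mul1r -mulrBl mulrA.
  by congr (_ * (expR _ - 1) * _); rewrite mulrDl; congr +%R; rewrite mulrAC.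
- move=> k w; rewrite normrM mulrC.
  have k0 : 0 < k.+1%:R :> R by [].
  have Lw : `|L w| <= (`|p| + `|q|) * onorm w by exact: lin_le_onorm.
  have : `|k.+1%:R * (expR (L w / k.+1%:R) - 1)| <= expR (2 * ((`|p| + `|q|) * onorm w)).
    rewrite normrM ger0_norm//.
    apply: (le_trans (ler_wpM2l (ltW k0) (expRB1_le _))).
    rewrite normrM (ger0_norm (_ : 0 <= k.+1%:R^-1)) ?invr_ge0//.
    have -> e : k.+1%:R * (`|L w| / k.+1%:R * e) = `|L w| * e by field.
    have h : `|L w| / k.+1%:R <= `|L w|.
      by rewrite ler_pdivrMr// ler_peMr// ler1n.
    apply: (@le_trans _ _ (expR `|L w| * expR `|L w|)).
      rewrite ler_pM ?expR_ge0// ?ler_expR//.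
      by rewrite (le_trans _ (expR_ge1Dx _))// lerDr.
    by rewrite -expRD ler_expR mulr_natl mulr2n lerD.
  move=> h; rewrite (mulrDl c) [expR (_ * onorm w + _)]expRD mulrA ler_pM//.
  by rewrite (le_trans h)// ler_expR mulrA.
- by move=> w; apply: cvgMl; exact: expRB1_cvg.
Qed.

Lemma lz_linX p q n psi : lz psi ->
  lz (fun w => (p * complex.Re w + q * complex.Im w) ^+ n * psi w).
Proof.
move=> lp; elim: n => [|n IH]; first by under eq_fun do rewrite expr0 mul1r.
by under eq_fun do rewrite exprS -mulrA; exact: lz_lin.
Qed.

(** With coefficients at most 1 / n! all partial sums are bounded by e^|L|, a common exponential
    bound. *)
Lemma lz_series p q (a : nat -> R) (S : R -> R) psi :
  (forall n, `|a n| <= n`!%:R^-1) ->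
  (forall x, (fun N => \sum_(0 <= n < N) a n * x ^+ n) @ \oo --> S x) ->
  lz psi -> lz (fun w => S (p * complex.Re w + q * complex.Im w) * psi w).
Proof.
move=> ha hS lp; have [_ [C [c H]] _] := lp.
pose L w := p * complex.Re w + q * complex.Im w.
apply: (@lz_lim (fun N w => (\sum_(0 <= n < N) a n * L w ^+ n) * psi w) _ C (c + (`|p| + `|q|))).
- elim=> [|N IH].
    by have := lzZ 0 lp; congr lz; apply/funext => w; rewrite big_geq.
  under eq_fun do rewrite big_nat_recr//= mulrDl.
  apply: lzD => //; under eq_fun do rewrite -mulrA.
  by apply: lzZ; exact: lz_linX.
- move=> N w; rewrite normrM mulrC (mulrDl c) [expR (_ * onorm w + _)]expRD mulrA ler_pM//.
  apply: (@le_trans _ _ (expS N `|L w|)).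
    rewrite (le_trans (ler_norm_sum _ _ _))//; apply: ler_sum => n _.
    by rewrite normrM normrX mulrC ler_wpM2l ?exprn_ge0.
  rewrite (le_trans (expS_le_expR _ _))// ler_expR; exact: lin_le_onorm.
- by move=> w; apply: cvgMl; exact: hS.
Qed.

Lemma lz_sin p q d psi : lz psi ->
  lz (fun w => sin (p * complex.Re w + q * complex.Im w + d) * psi w).
Proof.
move=> lp.
have hs : lz (fun w => sin (p * complex.Re w + q * complex.Im w) * psi w).
  apply: (@lz_series p q (fun n => (odd n)%:R * (-1) ^+ n.-1./2 * n`!%:R^-1) sin) => //.
    move=> n; rewrite !normrM normrX normrN1 expr1n mulr1 ger0_norm// ger0_norm ?invr_ge0//.
    by rewrite ler_piMl ?invr_ge0// lern1 leq_b1.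
  by move=> x; have := @is_cvg_series_sin_coeff R x; rewrite sin.unlock sin_coeffE; exact.
have hc : lz (fun w => cos (p * complex.Re w + q * complex.Im w) * psi w).
  apply: (@lz_series p q (fun n => (~~ odd n)%:R * (-1) ^+ n./2 * n`!%:R^-1) cos) => //.
    move=> n; rewrite !normrM normrX normrN1 expr1n mulr1 ger0_norm// ger0_norm ?invr_ge0//.
    by rewrite ler_piMl ?invr_ge0// lern1 leq_b1.
  by move=> x; have := @is_cvg_series_cos_coeff R x; rewrite cos.unlock cos_coeffE; exact.
have := lzD (lzZ (cos d) hs) (lzZ (sin d) hc).
congr lz; apply/funext => w; move: (p * _ + _) => x; rewrite sinD; ring.
Qed.

(** The bound by 1 leaves the growth constants of [psi] unchanged, so that pointwise limits of
    multipliers are again multipliers. *)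
Definition lzmult phi := (forall w, `|phi w| <= 1) /\ forall psi, lz psi -> lz (fun w => phi w * psi w).

Lemma lzmult_lim (phi_ : nat -> R[i] -> R) phi : (forall n, lzmult (phi_ n)) ->
  (forall w, (fun n => phi_ n w) @ \oo --> phi w) -> lzmult phi.
Proof.
move=> hp cp; split=> [w|psi lp].
  have h : (fun n => `|phi_ n w|) @ \oo --> `|phi w| by apply: cvg_norm; exact: cp.
  rewrite -(cvg_lim _ h)//; apply: limr_le; first by apply/cvg_ex; eexists; exact: h.
  by apply: nearW => n; exact: (hp n).1.
have [_ [C [c H]] _] := lp.
apply: (@lz_lim (fun n w => phi_ n w * psi w) _ C c).
- by move=> n; exact: (hp n).2.
- by move=> n w; rewrite normrM (le_trans _ (H w))// ler_piMl// (hp n).1.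
- by move=> w; apply: cvgMl; exact: cp.
Qed.

Lemma lzmult_sgstep phi : lzmult phi -> lzmult (fun w => sgstep (phi w)).
Proof.
move=> [p1 hp]; split=> [w|psi lp]; first by have := @norm_iter_sgstep R 1 (phi w) (p1 w).
have h1 := hp _ lp; have h3 := hp _ (hp _ h1).
have := lzD (lzZ (3 / 2) h1) (lzZ (- (1 / 2)) h3).
by congr lz; apply/funext => w; rewrite /sgstep; field.
Qed.

Lemma lzmult_sg_sin p q d : lzmult (fun w => Num.sg (sin (p * complex.Re w + q * complex.Im w + d))).
Proof.
pose phi w := sin (p * complex.Re w + q * complex.Im w + d).
have p1 w : `|phi w| <= 1 by rewrite ler_norml sin_geN1 sin_le1.
apply: (@lzmult_lim (fun n w => iter n (@sgstep R) (phi w))).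
  elim=> [|n IH] /=; last exact: lzmult_sgstep.
  by split=> // psi; exact: lz_sin.
by move=> w; exact: iter_sgstep_cvg.
Qed.

(** For fixed w the sign of sin (u / k) equals that of u as soon as |u| / k < pi, so the signs of
    stretched sines converge to the sign of the affine function. *)
Lemma lzmult_sg p q d : lzmult (fun w => Num.sg (p * complex.Re w + q * complex.Im w + d)).
Proof.
apply: (@lzmult_lim (fun n w => Num.sg (sin (p / n.+1%:R * complex.Re w + q / n.+1%:R * complex.Im w + d / n.+1%:R)))).
  by move=> n; exact: lzmult_sg_sin.
move=> w; set u := p * complex.Re w + q * complex.Im w + d.
apply: cvg_near_cst.
have E n : p / n.+1%:R * complex.Re w + q / n.+1%:R * complex.Im w + d / n.+1%:R = u / n.+1%:R.
  by rewrite /u; field.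
pose N := Num.bound (`|u| / pi); exists N => // n /= Nn; rewrite E.
have n0 : 0 < n.+1%:R :> R by [].
have un : `|u / n.+1%:R| < pi.
  rewrite normrM (ger0_norm (_ : 0 <= n.+1%:R^-1)) ?invr_ge0// ltr_pdivrMr//.
  rewrite mulrC -ltr_pdivrMr ?pi_gt0//.
  apply: (@lt_le_trans _ _ N%:R).
    by apply: archi_boundP; rewrite divr_ge0// pi_ge0.
  by rewrite ler_nat ltnW.
have sgpos (v : R) : 0 < v < pi -> Num.sg (sin v) = 1 by move=> /sin_gt0_pi; exact: gtr0_sg.
have [u0|u0|->] := ltrgtP u 0; last by rewrite mul0r sin0 sgr0.
- rewrite (ltr0_sg u0) -[X in sin X]opprK sinN sgrN sgpos// -mulNr.
  rewrite divr_gt0 ?oppr_gt0//= (le_lt_trans _ un)// -normrN -mulNr ler_norm//.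
- rewrite (gtr0_sg u0) sgpos// divr_gt0//= (le_lt_trans _ un)// ler_norm//.
Qed.

Hypothesis g_laplace0 : forall s t,
  rintegral (fun w => expR (s * complex.Re w + t * complex.Im w) * g w) = 0.

Lemma lz1 : lz (fun=> 1).
Proof.
split; first exact: measurable_cst.
  by exists 1, 0 => w; rewrite mul0r expR0 mulr1 normr1.
by move=> s t; rewrite -[RHS](g_laplace0 s t); congr rintegral; apply/funext => w; rewrite mul1r.
Qed.

Lemma lzmult_cst1 : lzmult (fun=> 1).
Proof. by split=> [w|psi]; [rewrite normr1|under [X in _ -> lz X]eq_fun do rewrite mul1r]. Qed.

Lemma lzmultM phi phi' : lzmult phi -> lzmult phi' -> lzmult (fun w => phi w * phi' w).
Proof.
move=> [p1 hp] [p1' hp']; split=> [w|psi lp]; first by rewrite normrM mulr_ile1.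
by have := hp _ (hp' _ lp); under eq_fun do rewrite mulrA.
Qed.

Lemma lzmultB1 phi : lzmult phi -> (forall w, 0 <= phi w) -> lzmult (fun w => 1 - phi w).
Proof.
move=> [p1 hp] p0; split=> [w|psi lp].
  by have := p1 w; rewrite ger0_norm// => h; rewrite ger0_norm; have := p0 w; lra.
have := lzD lp (lzZ (-1) (hp _ lp)); congr lz; apply/funext => w; ring.
Qed.

Let toP w : plane R := (complex.Re w, complex.Im w).

Definition lzset (A : set (plane R)) := lzmult (fun w => \1_A (toP w)).

Lemma lzsetC A : lzset A -> lzset (~` A).
Proof.
move=> hA; have := lzmultB1 hA (fun w => ler0n _ _); congr lzmult; apply/funext => w.
by rewrite !indicE in_setC; case: (_ \in A); rewrite ?subrr ?subr0.
Qed.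

Lemma lzsetT : lzset setT.
Proof. by rewrite /lzset; under eq_fun do rewrite indicT; exact: lzmult_cst1. Qed.

(** The indicator of the complement is the pointwise limit of finite products of 1 - 1_(F k), and
    multipliers are stable under products. *)
Lemma lzset_bigcup (F : nat -> set (plane R)) : (forall n, lzset (F n)) -> lzset (\bigcup_n F n).
Proof.
move=> hF; rewrite -[\bigcup_n _]setCK; apply: lzsetC.
apply: (@lzmult_lim (fun n w => \prod_(0 <= k < n) (1 - \1_(F k) (toP w)))).
  elim=> [|n IH]; first by under eq_fun do rewrite big_geq//; exact: lzmult_cst1.
  under eq_fun do rewrite big_nat_recr//=.
  by apply: (lzmultM IH); apply: (lzmultB1 (hF n)) => w; rewrite indicE.
move=> w; apply: cvg_near_cst; have [[k _ Fk]|nF] := pselect ((\bigcup_n F n) (toP w)).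
  exists k.+1 => // n /= kn; rewrite indicE in_setC mem_set; last by exists k.
  rewrite (big_cat_nat (n := k.+1))//= big_nat_recr//= indicE mem_set// subrr mulr0 mul0r//.
near=> n; rewrite indicE mem_set// big1// => k _.
by rewrite indicE memNset ?subr0// => Fk; apply: nF; exists k.
Unshelve. all: end_near. Qed.

Lemma sigma_algebra_lzset : sigma_algebra setT lzset.
Proof.
split; first by rewrite -setCT; apply: lzsetC; exact: lzsetT.
- by move=> A hA; rewrite setTD; exact: lzsetC.
- exact: lzset_bigcup.
Qed.

(** The indicator of u > 0 is (sg(u)^2 + sg(u)) / 2, which is also right on the boundary u = 0. *)
Lemma lzset_halfplane p q d : lzset [set x : plane R | 0 < p * x.1 + q * x.2 + d].
Proof.
have hs := lzmult_sg p q d; have hs2 := lzmultM hs hs.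
split=> [w|psi lp]; first by rewrite ger0_norm ?indicE// lern1 leq_b1.
have := lzD (lzZ (1 / 2) (hs2.2 _ lp)) (lzZ (1 / 2) (hs.2 _ lp)).
congr lz; apply/funext => w; move: {psi lp}(psi w) => r.
have [u0|u0] := ltP 0 (p * complex.Re w + q * complex.Im w + d).
  by rewrite (gtr0_sg u0) indicE mem_set//=; field.
rewrite indicE memNset/=; last by apply/negP; rewrite -leNgt.
move: u0; rewrite le_eqVlt => /orP[/eqP ->|u0]; first by rewrite sgr0 /=; ring.
by rewrite (ltr0_sg u0) /=; field.
Qed.

(** The product sigma-algebra is generated by horizontal and vertical strips, and those by the
    half-planes x > d and y > d. *)
Lemma lzset_measurable A : measurable A -> lzset A.
Proof.
suff [h1 h2] : (forall I : set (measurableTypeR R), measurable I -> lzset (I `*` setT)) /\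
    (forall I : set (measurableTypeR R), measurable I -> lzset (setT `*` I)).
  apply: smallest_sub; first exact: sigma_algebra_lzset.
  by rewrite subUset; split => _ [I mI <-]; rewrite setTI;
    [have := h1 _ mI; rewrite setXT|have := h2 _ mI; rewrite setTX].
split=> I mI.
- have : (@RGenOInfty.G R).-sigma.-measurable I by rewrite -RGenOInfty.measurableE.
  apply: (@smallest_sub _ _ _ (fun I : set R => lzset (I `*` setT))) => //.
    split; first by rewrite set0X -setCT; apply: lzsetC; exact: lzsetT.
      by move=> J /lzsetC; congr lzset; apply/seteqP; split=> -[x y] /=; tauto.
    move=> F hF; have := lzset_bigcup hF; congr lzset; apply/seteqP; split=> -[x y] /=.
      by move=> [k _ [? ?]]; split=> //; exists k.
    by move=> [[k _ ?] _]; exists k.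
  move=> _ [x ->]; have := lzset_halfplane 1 0 (- x); congr lzset.
  by apply/seteqP; split=> -[a b] /=; rewrite in_itv/= andbT mul1r mul0r addr0 subr_gt0 => //; case.
- have : (@RGenOInfty.G R).-sigma.-measurable I by rewrite -RGenOInfty.measurableE.
  apply: (@smallest_sub _ _ _ (fun I : set R => lzset (setT `*` I))) => //.
    split; first by rewrite setX0 -setCT; apply: lzsetC; exact: lzsetT.
      by move=> J /lzsetC; congr lzset; apply/seteqP; split=> -[x y] /=; tauto.
    move=> F hF; have := lzset_bigcup hF; congr lzset; apply/seteqP; split=> -[x y] /=.
      by move=> [k _ [? ?]]; split=> //; exists k.
    by move=> [_ [k _ ?]]; exists k.
  move=> _ [x ->]; have := lzset_halfplane 0 1 (- x); congr lzset.
  by apply/seteqP; split=> -[a b] /=; rewrite in_itv/= andbT mul1r mul0r add0r subr_gt0 => //; case.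
Qed.

(** At (s, t) = (0, 0), [lzset_measurable] says that [g] has integral 0 over every measurable
    set. *)
Lemma laplace_ae0 : {ae mu R, forall p, g (toC p) = 0}.
Proof.
have ig : rintegrable g.
  have := lz_integrable 0 0 lz1.
  by under eq_fun do rewrite mul1r !mul0r addr0 expR0 mul1r.
have : ae_eq (mu R) setT (fun p => (g (toC p))%:E) (cst 0%E).
  apply: integral_ae_eq => // E _ mE.
  rewrite integral_cst// mul0e integral_mkcond.
  have [_ _ /(_ 0 0) E0] := (lzset_measurable mE).2 _ lz1.
  have iE := lz_integrable 0 0 ((lzset_measurable mE).2 _ lz1).
  have := rintegralE iE; rewrite E0 => iE0; rewrite -[RHS]iE0; apply: eq_integral => -[x y] _ /=.
  rewrite !mul0r addr0 expR0 !mulr1 /patch indicE /toP /=.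
  by case: ifPn => hE /=; rewrite ?mul1r ?mul0r.
by apply: filterS => p /= /(_ I) [].
Qed.

End laplace_uniqueness.

Lemma B_eq0 (R : realType) (f : R[i] -> R[i]) : L2 f -> (forall z, B f z = 0) -> aeq f (fun=> 0).
Proof.
move=> Lf Bf0; have [mr mi] := L2_measurable Lf.
have i2 := L2_rintegrable Lf.
have sqrE w : normc (f w) ^+ 2 = complex.Re (f w) ^+ 2 + complex.Im (f w) ^+ 2 by exact: normc_sqr.
have ir : rintegrable (fun w => complex.Re (f w) ^+ 2).
  apply: (rintegrable_le _ i2) => [|w]; first exact: measurable_funX.
  by rewrite ger0_norm ?sqr_ge0// sqrE lerDl sqr_ge0.
have ii : rintegrable (fun w => complex.Im (f w) ^+ 2).
  apply: (rintegrable_le _ i2) => [|w]; first exact: measurable_funX.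
  by rewrite ger0_norm ?sqr_ge0// sqrE lerDr sqr_ge0.
(* At this point z conj(w) + conj(z) w is the real number s Re w + t Im w; the kernel being real, Re
   f and Im f are treated separately. *)
pose z s t : R[i] := Complex (s / 2) (t / 2).
pose k s t : R := expR (- normc (z s t) ^+ 2).
have k0 s t : k s t != 0 by rewrite gt_eqF ?expR_gt0.
have E s t : B_integrand f (z s t) =
    fun w => (k s t * expR (s * complex.Re w + t * complex.Im w))%:C%C * f w.
  apply/funext => -[x y]; rewrite /B_integrand; congr (_ * _).
  rewrite /K /cexp (_ : complex.Im _ = 0); last by rewrite /z /=; ring.
  rewrite (_ : complex.Re _ = s * x + t * y); last by rewrite /z /=; field.
  by rewrite cos0 sin0 mulr1 mulr0; apply: eq_ReIm; rewrite /= ?mul0r ?mulr0 ?subr0 ?addr0.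
have ae1 : {ae mu R, forall p, complex.Re (f (toC p)) = 0}.
  apply: (laplace_ae0 mr ir) => s t.
  have [h _] := B_integrable (z s t) Lf; have := Bf0 (z s t).
  move=> /(congr1 (@complex.Re R)) /=; rewrite E in h *.
  have F w : complex.Re ((k s t * expR (s * complex.Re w + t * complex.Im w))%:C%C * f w) =
    k s t * (expR (s * complex.Re w + t * complex.Im w) * complex.Re (f w)).
    by rewrite cReM /=; ring.
  have h' : rintegrable (fun w => k s t * (expR (s * complex.Re w + t * complex.Im w) * complex.Re (f w))).
    by move: h; under eq_fun do rewrite F.
  under eq_Rintegral do rewrite F.
  move=> h0; have := rintegralZ (k s t)^-1 h'; rewrite /rintegral h0 mulr0 => <-.
  by apply: eq_Rintegral => p _; rewrite mulrA mulVf// mul1r.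
have ae2 : {ae mu R, forall p, complex.Im (f (toC p)) = 0}.
  apply: (laplace_ae0 mi ii) => s t.
  have [_ h] := B_integrable (z s t) Lf; have := Bf0 (z s t).
  move=> /(congr1 (@complex.Im R)) /=; rewrite E in h *.
  have F w : complex.Im ((k s t * expR (s * complex.Re w + t * complex.Im w))%:C%C * f w) =
    k s t * (expR (s * complex.Re w + t * complex.Im w) * complex.Im (f w)).
    by rewrite cImM /=; ring.
  have h' : rintegrable (fun w => k s t * (expR (s * complex.Re w + t * complex.Im w) * complex.Im (f w))).
    by move: h; under eq_fun do rewrite F.
  under eq_Rintegral do rewrite F.
  move=> h0; have := rintegralZ (k s t)^-1 h'; rewrite /rintegral h0 mulr0 => <-.
  by apply: eq_Rintegral => p _; rewrite mulrA mulVf// mul1r.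
apply: filterS2 ae1 ae2 => p h1 h2; exact: eq_ReIm.
Qed.

(** * Fock spaces and the isomorphism *)

Section double_series.
Variable R : realType.

Lemma nneseries_EFin (u : nat -> R) (l : R) :
  (fun k => \sum_(0 <= i < k) u i) @ \oo --> l -> (\sum_(0 <= i <oo) (u i)%:E)%E = l%:E.
Proof.
move=> h; apply: cvg_lim => //.
under eq_fun do rewrite sumEFin.
by apply: cvg_EFin => //; exact: nearW.
Qed.

Lemma nneseries_le (u : nat -> R) (M : R) : (forall i, 0 <= u i) ->
  ((\sum_(0 <= i <oo) (u i)%:E)%E <= M%:E)%E <-> (forall k, \sum_(0 <= i < k) u i <= M).
Proof.
move=> u0; split=> [h k|h].
  rewrite -lee_fin -sumEFin (le_trans _ h)//; apply: nneseries_lim_ge => i _ _.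
  by rewrite lee_fin.
apply: lime_le; first by apply: is_cvg_nneseries => i _ _; rewrite lee_fin.
by apply: nearW => k; rewrite sumEFin lee_fin.
Qed.

Lemma nat_pair_bij : exists f : nat -> nat * nat, set_bij setT setT f.
Proof.
have /card_esym/ppcard_eqP[f] := card_nat2.
by exists f; exact: 'bij_f.
Qed.

Lemma nneseries_pair (f : nat -> nat * nat) (a : nat * nat -> \bar R) :
  set_bij setT setT f -> (forall p, 0 <= a p)%E ->
  (\sum_(0 <= k <oo) a (f k) = \sum_(0 <= n <oo) \sum_(0 <= m <oo) a (n, m))%E.
Proof.
move=> fb a0; rewrite nneseries_esumT// -(reindex_esum _ _ _ _ fb).
rewrite nneseries_esumT; last by move=> n; apply: nneseries_ge0.
under [RHS]eq_esum do rewrite nneseries_esumT//.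
rewrite (@esum_esum _ _ _ setT (fun=> setT) (fun n m => a (n, m)))//.
rewrite (_ : setT `*`` (fun=> setT) = setT); last by apply/seteqP; split.
by apply: eq_esum => -[].
Qed.

End double_series.

(** * Power series and Parseval's identity in the Fock space *)

Section fock_space.
Variable R : realType.
Implicit Types (f g h : R[i] -> R[i]) (w z : R[i]) (c : nat -> R[i]).

Let pw i w : R[i] := w ^+ i.
Let fct i : R := i`!%:R.

Let pwL i : L2 (pw i).
Proof. by apply: expbd_L2; apply: expbdX; exact: expbd_id. Qed.

Let pw_orth i j : ip (pw i) (pw j) = ((i == j)%:R * fct i)%:C%C.
Proof.
rewrite /ip /pw (_ : (fun w => _) = @mono R i j); last by apply/funext => w; rewrite /mono rmorphXn.
by rewrite momentE natrM rmorphM/= !(rmorph_nat (real_complex R)).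
Qed.

Definition fock_sqr c k : R := \sum_(0 <= i < k) normc (c i) ^+ 2 * i`!%:R.

Lemma fock_bessel h k : L2 h -> fock_sqr (fock_coef h) k <= n2 h.
Proof.
move=> hL; apply: (bessel pwL pw_orth k hL) => i.
rewrite /ip /fock_coef (rmorph_nat (real_complex R)) divfK ?pnatr_eq0 -?lt0n ?fact_gt0//.
by congr cintegral; apply/funext => w; rewrite /pw rmorphXn.
Qed.

(* Differentiation under the integral sign. *)
Lemma centire_fock_transform f : L2 f -> centire (fun z => cintegral (fun w => f w * cexp (z * conjc w))).
Proof.
move=> fL z.
have eC : expbd (@conjc R) by exact: expbd_conj (expbd_id R).
have I1 u : cintegrable (fun w => f w * cexp (u * conjc w)).
  by apply: L2_mul_expbd => //; exact: expbd_cexp_conj.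
have I2 : cintegrable (fun w => f w * (conjc w * cexp (z * conjc w))).
  by apply: L2_mul_expbd => //; apply: expbdM => //; exact: expbd_cexp_conj.
(* The 3 collects |w|^2 <= e^(2|w|) from the second-order remainder and e^(|k||w|) <= e^|w| for |k|
   < 1. *)
pose G w := normc (f w) * expR ((normc z + 3) * normc w).
have G0 w : 0 <= G w by rewrite mulr_ge0 ?normc_ge0 ?expR_ge0.
have iG : rintegrable G by apply: rintegrable_expR_normc; rewrite // addr_ge0 ?normc_ge0.
exists (cintegral (fun w => f w * (conjc w * cexp (z * conjc w)))) => e e0.
have IG0 : 0 <= rintegral G by exact: rintegral_ge0.
(* The 2 is the constant of [normc_cintegral_le]; the added 1 keeps the denominator positive. *)
exists (Num.min 1 (e / (2 * rintegral G + 1))).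
  by rewrite lt_min ltr01 divr_gt0// ltr_wpDl// mulr_ge0.
move=> k; rewrite lt_min => /andP[k1 k2].
rewrite mulrC -cintegralZ//.
pose r w := f w * cexp ((z + k) * conjc w) - f w * cexp (z * conjc w)
  - k * (f w * (conjc w * cexp (z * conjc w))).
have Ir : cintegrable r by apply: cintegrableB; [exact: cintegrableB|exact: cintegrableZ].
have -> : cintegral (fun w => f w * cexp ((z + k) * conjc w)) - cintegral (fun w => f w * cexp (z * conjc w))
  - cintegral (fun w => k * (f w * (conjc w * cexp (z * conjc w)))) = cintegral r.
  by rewrite -!cintegralB//; [exact: cintegrableB|exact: cintegrableZ].
have rG w : normc (r w) <= normc k ^+ 2 * G w.
  have -> : r w = f w * (cexp (z * conjc w) * (cexp (k * conjc w) - (1 + k * conjc w))).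
    by rewrite /r mulrDl cexpD; ring.
  rewrite /G !normcM [leRHS]mulrCA ler_wpM2l ?normc_ge0//.
  have h1 : normc (cexp (z * conjc w)) <= expR (normc z * normc w).
    by rewrite (le_trans (normc_cexp_le _))// normcM normc_conj.
  have h2 := normc_cexpB1 (k * conjc w); rewrite normcM normc_conj in h2.
  have w0 := normc_ge0 w; have kk := normc_ge0 k.
  have h3 : normc w <= expR (normc w) by rewrite (le_trans _ (expR_ge1Dx _))// lerDr.
  have h4 : expR (normc k * normc w) <= expR (normc w) by rewrite ler_expR ler_piMl// ltW.
  apply: (le_trans (ler_pM (normc_ge0 _) (normc_ge0 _) h1 h2)).
  have -> : (normc z + 3) * normc w = normc z * normc w + normc w + normc w + normc w by ring.
  rewrite !expRD; set a := expR (normc z * _) in h1 *; set b := expR (normc w) in h3 h4 *.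
  have b0 : 0 <= b by exact: expR_ge0.
  have -> : normc k ^+ 2 * (a * b * b * b) = a * ((normc k * b) ^+ 2 * b) by ring.
  rewrite ler_wpM2l ?expR_ge0// ler_pM ?expR_ge0 ?sqr_ge0//.
  by rewrite ler_pXn2r ?nnegrE ?mulr_ge0// ler_wpM2l.
apply: (le_trans (normc_cintegral_le Ir)).
have := rintegral_le (cintegrable_normc Ir) (rintegrableZ _ iG) rG.
rewrite rintegralZ// => h.
move: k2; rewrite ltr_pdivlMr ?ltr_wpDl ?mulr_ge0// => k2.
have := normc_ge0 k; set I0 := rintegral G in IG0 h k2 *; set nk := normc k in h k2 *.
move=> nk0; apply: (@le_trans _ _ (2 * (nk ^+ 2 * I0))); first by rewrite ler_wpM2l.
have -> : 2 * (nk ^+ 2 * I0) = nk * (nk * (2 * I0)) by ring.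
by rewrite [e * _]mulrC ler_wpM2l// (le_trans _ (ltW k2))// ler_wpM2l// lerDl.
Qed.

(* Riesz-Fischer for the monomials represents the power series by
   [z |-> \int F(w) e^(z conj(w)) dmu(w)], which yields convergence for free. *)
Lemma fock_power_series c M : (forall k, fock_sqr c k <= M) ->
  exists h, [/\ centire h, L2 h, n2 h <= M &
    forall z, ((fun N => \sum_(0 <= m < N) c m * z ^+ m) : nat -> R[i]^o) @ \oo --> (h z : R[i]^o)].
Proof.
move=> cM; have [F [FL Fc _]] := riesz_fischer pwL pw_orth cM.
(* Since [herm 0 m] is conj(w)^m, the monomials are the row n = 0 of the Hermite family, and
   [hcoef_series] sums the power series. *)
have hc m : hcoef F 0 m = c m.
  rewrite /hcoef mulr1; have := Fc m; rewrite /ip /fct (rmorph_nat (real_complex R)).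
  rewrite (_ : (fun w => F w * conjc (pw m w)) = (fun w => F w * herm 0 m w)).
    by move=> ->; rewrite mulfK ?pnatr_eq0 -?lt0n ?fact_gt0.
  by apply/funext => w; rewrite /pw rmorphXn.
have cv z : ((fun N => \sum_(0 <= m < N) c m * z ^+ m) : nat -> R[i]^o) @ \oo --> (fcoef F 0 z : R[i]^o).
  by have := @hcoef_series R F 0 z FL; under eq_fun do under eq_bigr do rewrite hc.
have [hL hM] : L2 (fcoef F 0) /\ n2 (fcoef F 0) <= M.
  apply: (@n2_fatou R (psum pw c)) => // [k|k]; first exact: L2_psum.
  rewrite (_ : psum pw c k = fun w => psum pw c k w - psum pw c 0 w); last first.
    by apply/funext => w; rewrite [psum pw c 0 w]big_geq// subr0.
  by rewrite (n2_psumB pwL pw_orth c (leq0n k)) [psum_sqr _ c 0]big_geq// subr0.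
exists (fcoef F 0); split=> //.
rewrite (_ : fcoef F 0 = fun z => cintegral (fun w => F w * cexp (z * conjc w))).
  exact: centire_fock_transform.
by apply/funext => z; rewrite /fcoef divr1; under eq_fun do rewrite expr0 mul1r.
Qed.

(** One inequality is Bessel's. For the other, [fock_power_series] yields a function with the same
    Taylor coefficients and squared norm at most the sum; by [fock_series] it is [h] itself. *)
Lemma fock_n2 h : centire h -> L2 h ->
  (\sum_(0 <= m <oo) (normc (fock_coef h m) ^+ 2 * m`!%:R)%:E)%E = (n2 h)%:E.
Proof.
move=> ch hL; have u0 m : 0 <= normc (fock_coef h m) ^+ 2 * m`!%:R by rewrite mulr_ge0 ?sqr_ge0.
set S := (\sum_(0 <= m <oo) _)%E.
have S1 : (S <= (n2 h)%:E)%E by apply/nneseries_le => // k; exact: fock_bessel.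
have S0 : (0 <= S)%E by apply: nneseries_ge0 => m _ _; rewrite lee_fin.
have Sf : S = (fine S)%:E by rewrite fineK// ge0_fin_numE// (le_lt_trans S1)// ltry.
apply/eqP; rewrite eq_le S1 /= Sf lee_fin.
have [|h' [_ _ h'n h's]] := @fock_power_series (fock_coef h) (fine S).
  by move=> k; apply: (nneseries_le _ u0).1; rewrite -Sf.
suff <- : h' = h by [].
by apply/funext => z; exact: cvgc_unique (h's z) (@fock_series R h z ch hL).
Qed.

Lemma normFsqE h : centire h -> normFsq h = normL2sq h.
Proof.
move=> ch; have [m1 m2] := centire_cmeasurable ch.
have mF : measurable_fun setT (fun p : plane R => normc (h (toC p)) ^+ 2).
  exact: cmeasurable_sqr (conj m1 m2).
rewrite /normL2sq ge0_integral_gauss2; last 2 first.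
- by apply/measurable_EFinP.
- by move=> p; rewrite lee_fin sqr_ge0.
rewrite /normFsq -ge0_integralZl//; last 3 first.
- apply/measurable_EFinP; apply: measurable_funM => //; apply: measurableT_comp => //.
  apply: measurableT_comp => //.
  exact: (cmeasurable_sqr (L2_measurable (expbd_L2 (expbd_id R)))).
- by move=> p _; rewrite lee_fin mulr_ge0 ?sqr_ge0 ?expR_ge0.
- by rewrite lee_fin invr_ge0 pi_ge0.
by apply: eq_integral => p _; rewrite -!EFinM /gauss_density mulrCA.
Qed.

Lemma FockP h : Fock h <-> centire h /\ L2 h.
Proof.
split=> [[/entireE ch]|[ch hL]].
  by rewrite normFsqE// => hn; split=> //; split=> //; exact: centire_cmeasurable.
by split; [exact/entireE|rewrite normFsqE//; case: hL].
Qed.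

End fock_space.

(** * Hermite expansions and the polyanalytic Fock space *)

Section polyanalytic_fock_space.
Variable R : realType.
Implicit Types (f g h : R[i] -> R[i]) (w z : R[i]) (fn : nat -> R[i] -> R[i]).
Variable phi : nat -> nat * nat.
Hypothesis phi_bij : set_bij setT setT phi.

(** Conjugated because [hcoef] pairs [f] with [herm] without a conjugate; [phi] lists the index
    pairs so that the results on sequences apply. *)
Let e i w := conjc (herm (phi i).1 (phi i).2 w) : R[i].
Let N i : R := ((phi i).2`! * (phi i).1`!)%N%:R.

Let eL i : L2 (e i).
Proof. by apply: expbd_L2; apply: expbd_conj; exact: expbd_herm. Qed.

Let phi_inj i j : ((phi i).2 == (phi j).2) && ((phi i).1 == (phi j).1) = (i == j).
Proof.
apply/andP/eqP => [[/eqP h2 /eqP h1]|->]; last by rewrite !eqxx.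
have [_ inj _] := phi_bij; apply: inj; rewrite ?inE//.
by rewrite [LHS]surjective_pairing [RHS]surjective_pairing h1 h2.
Qed.

Let e_orth i j : ip (e i) (e j) = ((i == j)%:R * N i)%:C%C.
Proof.
rewrite /ip /e; under eq_fun do rewrite conjcK.
rewrite herm_ip phi_inj -natrM (rmorph_nat (real_complex R)); congr (_%:R).
by case: eqP => [->|_]; rewrite ?mul0n.
Qed.

Let ip_hcoef f i : ip f (e i) = hcoef f (phi i).1 (phi i).2 * (N i)%:C%C.
Proof.
rewrite /N (rmorph_nat (real_complex R)) /hcoef -natrM divfK.
  by rewrite /ip /e; under eq_fun do rewrite conjcK.
by rewrite pnatr_eq0 -lt0n muln_gt0 !fact_gt0.
Qed.

(** With a(n, m) the Taylor coefficients of f_n, the inner sum is ||f_n||^2, so the Hermite norm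
    becomes the norm of SF(C). *)
Let pair_sum (a : nat -> nat -> R[i]) :
  (\sum_(0 <= i <oo) (normc (a (phi i).1 (phi i).2) ^+ 2 * N i)%:E =
   \sum_(0 <= n <oo) (n`!%:R)%:E * \sum_(0 <= m <oo) (normc (a n m) ^+ 2 * m`!%:R)%:E)%E.
Proof.
have := @nneseries_pair R phi (fun p => (normc (a p.1 p.2) ^+ 2 * (p.2`! * p.1`!)%N%:R)%:E) phi_bij.
move=> ->; last by move=> p; rewrite lee_fin mulr_ge0 ?sqr_ge0.
apply: eq_eseriesr => n _; rewrite -nneseriesZl; last by move=> m _; rewrite lee_fin mulr_ge0 ?sqr_ge0.
by apply: eq_eseriesr => m _; rewrite -EFinM natrM /=; congr EFin; ring.
Qed.

(** Bessel's inequality bounds the double sum by [n2 f]; as n! >= 1, each row is finite, and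
    [fock_power_series] places each f_n in the Fock space. *)
Lemma B_SF f : L2 f -> SF (B f).
Proof.
move=> fL.
have u0 i : 0 <= normc (hcoef f (phi i).1 (phi i).2) ^+ 2 * N i by rewrite mulr_ge0 ?sqr_ge0.
pose S n := (\sum_(0 <= m <oo) (normc (hcoef f n m) ^+ 2 * m`!%:R)%:E)%E.
have S0 n : (0 <= S n)%E by apply: nneseries_ge0 => m _ _; rewrite lee_fin mulr_ge0 ?sqr_ge0.
have total : (\sum_(0 <= n <oo) (n`!%:R)%:E * S n <= (n2 f)%:E)%E.
  rewrite -pair_sum; apply/nneseries_le => // k.
  exact: (bessel eL e_orth k fL (ip_hcoef f)).
have fS n : ((n`!%:R)%:E * S n <= (n2 f)%:E)%E.
  apply: le_trans total.
  have T0 k : (0 <= (k`!%:R)%:E * S k)%E by rewrite mule_ge0// lee_fin.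
  apply: (le_trans _ (nneseries_lim_ge n.+1 (fun k _ _ => T0 k))).
  by rewrite big_nat_recr//= leeDr// sume_ge0.
have Sfin n : S n = (fine (S n))%:E.
  rewrite fineK// ge0_fin_numE//; apply: le_lt_trans (ltry (n2 f)).
  apply: le_trans (fS n); rewrite lee_pemull// lee_fin ler1n fact_gt0//.
have H n : [/\ centire (fcoef f n), L2 (fcoef f n) & n2 (fcoef f n) <= fine (S n)].
  have [|h [ch hL hn hs]] := @fock_power_series R (hcoef f n) (fine (S n)).
    move=> k; apply: (nneseries_le _ _).1; first by move=> i; rewrite mulr_ge0 ?sqr_ge0.
    by rewrite -Sfin.
  suff -> : fcoef f n = h by [].
  by apply/funext => z; exact: cvgc_unique (@hcoef_series R f n z fL) (hs z).
exists (fcoef f); split=> [n||z]; last exact: B_series.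
  by apply/FockP; have [] := H n.
apply: le_lt_trans (ltry (n2 f)); apply: le_trans total.
apply: lee_nneseries => n _; have [ch hL hn] := H n; rewrite normFsqE// normL2sqE//.
  by rewrite mule_ge0// lee_fin// n2_ge0.
by rewrite lee_wpmul2l ?lee_fin// Sfin lee_fin.
Qed.

(** Riesz-Fischer prescribes the Taylor coefficients of all the f_n as Hermite coefficients of [f].
    Then [fcoef f n] and [fn n] have the same power series, hence agree, and [B_series] sums to
    [h]. *)
Lemma SF_decomp_B h fn : SF_decomp h fn ->
  exists f, [/\ L2 f, B f = h & normSFsq_seq fn = (n2 f)%:E].
Proof.
move=> [Ffn fin hs].
have H n : centire (fn n) /\ L2 (fn n) by apply/FockP.
pose a n m := fock_coef (fn n) m.
have u0 i : 0 <= normc (a (phi i).1 (phi i).2) ^+ 2 * N i by rewrite mulr_ge0 ?sqr_ge0.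
have total : (\sum_(0 <= i <oo) (normc (a (phi i).1 (phi i).2) ^+ 2 * N i)%:E)%E = normSFsq_seq fn.
  rewrite pair_sum; apply: eq_eseriesr => n _; have [ch hL] := H n.
  by rewrite normFsqE// normL2sqE// fock_n2.
have fE : normSFsq_seq fn = (fine (normSFsq_seq fn))%:E.
  by rewrite fineK// ge0_fin_numE// -total nneseries_ge0// => i _ _; rewrite lee_fin.
have [|f [fL fc fn2]] := @riesz_fischer R e N eL e_orth (fun i => a (phi i).1 (phi i).2) (fine (normSFsq_seq fn)).
  by move=> k; apply: (nneseries_le _ u0).1; rewrite total -fE.
exists f; split=> //; last by rewrite -total; exact: nneseries_EFin.
have hc n m : hcoef f n m = a n m.
  have [_ _ /(_ (n, m) I)[i _ ip_nm]] := phi_bij.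
  have := fc i; rewrite ip_hcoef ip_nm /= => /mulIf; apply.
  by rewrite /N (rmorph_nat (real_complex R)) pnatr_eq0 -lt0n muln_gt0 !fact_gt0.
have fnE n z : fcoef f n z = fn n z.
  have [ch hL] := H n.
  apply: cvgc_unique (@hcoef_series R f n z fL) _.
  by under eq_fun do under eq_bigr do rewrite hc; exact: fock_series.
apply/funext => z; apply: cvgc_unique (@B_series R f z fL) _.
rewrite (_ : [series _]_n = [series conjc z ^+ n * fn n z]_n); first exact: hs.
by apply/funext => k; apply: eq_bigr => n _ /=; rewrite fnE.
Qed.

End polyanalytic_fock_space.

(** * Linearity, injectivity and isometry of the transform *)

Section B_isometry.
Variable R : realType.
Implicit Types (f g h : R[i] -> R[i]).

Lemma B_linear (a : R[i]) f g : L2 f -> L2 g ->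
  B (fun w => a * f w + g w) = (fun z => a * B f z + B g z).
Proof.
move=> fL gL; apply/funext => z.
have If := @B_integrable R f z fL; have Ig := @B_integrable R g z gL.
rewrite /B -cintegralZ// -cintegralD//; last exact: cintegrableZ.
by congr cintegral; apply/funext => w; rewrite /B_integrand; ring.
Qed.

Lemma aeq_cintegral f g : cmeasurable f -> cmeasurable g -> aeq f g -> cintegral f = cintegral g.
Proof.
move=> [f1 f2] [g1 g2] fg; apply: eq_ReIm; rewrite /= /Rintegral; congr fine.
  apply: ae_eq_integral => //; try by apply/measurable_EFinP.
  by apply: filterS fg => p -> _.
apply: ae_eq_integral => //; try by apply/measurable_EFinP.
by apply: filterS fg => p -> _.
Qed.

Lemma aeq_n2 f g : L2 f -> L2 g -> aeq f g -> n2 f = n2 g.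
Proof.
move=> fL gL fg; rewrite /n2 /rintegral /Rintegral; congr fine.
apply: ae_eq_integral => //.
- by apply/measurable_EFinP; exact: cmeasurable_sqr (L2_measurable fL).
- by apply/measurable_EFinP; exact: cmeasurable_sqr (L2_measurable gL).
- by apply: filterS fg => p -> _.
Qed.

Lemma B_inj f g : L2 f -> L2 g -> B f = B g <-> aeq f g.
Proof.
move=> fL gL; split=> [fg|fg].
  have : aeq (fun w => f w - g w) (fun=> 0).
    apply: B_eq0; first exact: L2_B.
    move=> z; have := B_linear (-1) gL fL; rewrite -fg.
    under eq_fun do rewrite mulN1r addrC.
    by move=> /(congr1 (@^~ z)) ->; rewrite mulN1r addNr.
  by apply: filterS => p /eqP; rewrite subr_eq0 => /eqP.
apply/funext => z; apply: aeq_cintegral.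
- exact: cintegrable_measurable (@B_integrable R f z fL).
- exact: cintegrable_measurable (@B_integrable R g z gL).
- by apply: filterS fg => p; rewrite /B_integrand => ->.
Qed.

(** The chosen decomposition of B f comes from some [g] with B g = B f and the right norm; by
    injectivity [g] equals [f] almost everywhere. *)
Lemma B_normSF f : L2 f -> normSF (B f) = normL2 f.
Proof.
move=> fL; have [phi phib] := nat_pair_bij.
have [fn hfn] := B_SF phib fL.
have : SF_decomp (B f) (SF_coef (B f)) by exact: (xgetPex _ (ex_intro _ fn hfn)).
move=> /(SF_decomp_B phib)[g [gL /(B_inj gL fL) gf E]].
by rewrite /normSF E normL2E//= (aeq_n2 gL fL gf).
Qed.

End B_isometry.

Theorem theorem5p9 (R : realType) :
  (forall (f : R[i] -> R[i]) (z : R[i]), L2 f -> cintegrable (B_integrand f z)) /\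
  isomorphism_L2_SF (@B R) /\
  (forall f : R[i] -> R[i], L2 f -> normSF (B f) = normL2 f).
Proof.
have [phi phib] := nat_pair_bij.
split; first exact: B_integrable.
split; last exact: B_normSF.
split.
- by move=> f; exact: (B_SF phib).
- exact: B_linear.
- exact: B_inj.
- by move=> h [fn /(SF_decomp_B phib)[f [fL fh _]]]; exists f.
- by exists 1, 1; split=> // f fL; rewrite !mul1r B_normSF.
Qed.
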